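(* Let $p\in(1,2]$ and $K\ge1$, and define $$c(K,p)=\left(\frac{\tan^{p-1}\frac{\pi}{2p}}{\cot\frac{\pi}{2p}}+(K^2-1)\frac{\sin^{p-1}\frac{\pi}{2p}}{\cos\frac{\pi}{2p}}\right)^{1/p},\qquad d(K,p)=\left(\Bigl(\cos\frac{\pi}{2p}\Bigr)^{-p}+(K^2-1)\tan\frac{\pi}{2p}\right)^{1/p}.$$ Let $f$ be a $K$-quasiregular harmonic mapping of the unit disk $\mathbb{D}$ into $\mathbb{C}$ such that $\arg f(0)\in\left(-\frac{\pi}{2p},\frac{\pi}{2p}\right)$, $\operatorname{Re} f\in\mathbf{h}^p$, and $f(\mathbb{D})\cap(-\infty,0)=\emptyset$. Then $f\in\mathbf{h}^p$ and (a) $\|\operatorname{Im} f\|_p\le c(K,p)\,\|\operatorname{Re} f\|_p$; (b) $\|f\|_p\le d(K,p)\,\|\operatorname{Re} f\|_p$.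
   Context: A mapping $f:\mathbb{D}\to\mathbb{C}\cong\mathbb{R}^2$ is $K$-quasiregular ($K\ge1$) if it is continuous, nonconstant, belongs to $W^{1,2}_{loc}$, and $|Df(z)|\le K\,\ell(Df(z))$ for a.e. $z$, where $|Df|=\sup_{|h|=1}|Df\,h|$ and $\ell(Df)=\inf_{|h|=1}|Df\,h|$. A harmonic mapping is one with $\Delta f=0$, equivalently $f=g+\overline{h}$ with $g,h$ holomorphic in $\mathbb{D}$. For harmonic $f$ on $\mathbb{D}$, $\|f\|_p=\sup_{0<r<1}\left(\int_0^{2\pi}|f(re^{it})|^p\frac{dt}{2\pi}\right)^{1/p}$, and $f\in\mathbf{h}^p$ means $\|f\|_p<\infty$. Here $\arg$ denotes the principal argument with values in $(-\pi,\pi]$. *)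

(* Defs.v *)
From Stdlib Require Import Reals.
From Coquelicot Require Import Coquelicot.
Open Scope R_scope.

Definition inD (z : C) : Prop := Cmod z < 1.

(* x^a for x >= 0 and real a > 0, with the convention 0^a = 0 *)
Definition rpow (x a : R) : R := if Rle_dec x 0 then 0 else Rpower x a.

Definition holomorphic_D (g : C -> C) : Prop :=
  forall z, inD z -> @ex_derive C_AbsRing C_NormedModule g z.

Definition harmonic_D (f : C -> C) : Prop :=
  exists g h : C -> C, holomorphic_D g /\ holomorphic_D h /\
    forall z, inD z -> f z = Cplus (g z) (Cconj (h z)).

Definition R_linear (L : C -> C) : Prop :=
  (forall u v, L (Cplus u v) = Cplus (L u) (L v)) /\
  (forall (r : R) u, L (Cmult (RtoC r) u) = Cmult (RtoC r) (L u)).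

Definition real_differential (f : C -> C) (z : C) (L : C -> C) : Prop :=
  R_linear L /\
  forall eps : R, 0 < eps -> exists delta : R, 0 < delta /\
    forall w : C, Cmod w < delta ->
      Cmod (Cminus (Cminus (f (Cplus z w)) (f z)) (L w)) <= eps * Cmod w.

Definition null_set (N : C -> Prop) : Prop :=
  forall eps : R, 0 < eps ->
    exists a b c d : nat -> R,
      (forall n, a n <= b n /\ c n <= d n) /\
      (forall z, N z -> exists n,
          a n <= fst z <= b n /\ c n <= snd z <= d n) /\
      (forall n, sum_f_R0 (fun k => (b k - a k) * (d k - c k)) n < eps).

(* K-quasiregular on D: continuous, nonconstant, and for a.e. z in D,
   |Df(z)| <= K l(Df(z)), i.e. |Df(z) h| <= K |Df(z) k| for all unit h, k.
   (W^{1,2}_loc is automatic for harmonic maps.) *)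
Definition quasiregular_D (K : R) (f : C -> C) : Prop :=
  (forall z, inD z -> continuous f z) /\
  (exists z1 z2, inD z1 /\ inD z2 /\ f z1 <> f z2) /\
  exists N : C -> Prop, null_set N /\
    forall z, inD z -> ~ N z ->
      exists L, real_differential f z L /\
        forall h k : C, Cmod h = 1 -> Cmod k = 1 ->
          Cmod (L h) <= K * Cmod (L k).

Definition Mp (p : R) (f : C -> C) (r : R) : R :=
  rpow (RInt (fun t => rpow (Cmod (f (Cmult (RtoC r) (cos t, sin t)))) p)
              0 (2 * PI) / (2 * PI)) (/ p).

Definition hp_norm (p : R) (f : C -> C) : Rbar :=
  Lub_Rbar (fun x => exists r, 0 < r < 1 /\ x = Mp p f r).

Definition in_hp (p : R) (f : C -> C) : Prop := is_finite (hp_norm p f).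

Definition ReF (f : C -> C) : C -> C := fun z => RtoC (Re (f z)).
Definition ImF (f : C -> C) : C -> C := fun z => RtoC (Im (f z)).

Definition principal_arg (z : C) (theta : R) : Prop :=
  z <> RtoC 0 /\ - PI < theta <= PI /\
  z = Cmult (RtoC (Cmod z)) (cos theta, sin theta).

Definition cKp (K p : R) : R :=
  rpow (rpow (tan (PI / (2 * p))) (p - 1) / (cos (PI / (2 * p)) / sin (PI / (2 * p)))
        + (K ^ 2 - 1) * (rpow (sin (PI / (2 * p))) (p - 1) / cos (PI / (2 * p))))
       (/ p).

Definition dKp (K p : R) : R :=
  rpow (/ rpow (cos (PI / (2 * p))) p + (K ^ 2 - 1) * tan (PI / (2 * p))) (/ p).

(* Main.v *)
Require Import Defs.
From Stdlib Require Import Reals Lra Lia Psatz ClassicalEpsilon.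
From Coquelicot Require Import Coquelicot.
Open Scope R_scope.

(** Write [f = u + i v], let [A], [B] be the two constants in [c^p = A + (K^2 - 1) B], and put
    [theta0 = pi / (2 p)].  On the slit plane [|v|^p <= A |u|^p - B Re (f^p)], because the quotient
    of both sides by [|u|^p] is extremal at [arg f = theta0].  Since [f] is harmonic,
    [Delta Re (f^p) = 4 p (p-1) Re (f^(p-2) g' conj h')], while
    [Delta |u|^p = p (p-1) |u|^(p-2) |g' + h'|^2]; quasiregularity gives
    [4 |g'| |h'| <= (K^2 - 1) |g' + h'|^2] and [p <= 2] gives [|f|^(p-2) <= |u|^(p-2)], so that
    [(K^2 - 1) |u|^p + Re (f^p)] is subharmonic.  Its value at [0] is nonnegative by the hypothesis
    on [arg f(0)], hence so are its circular means.  The bound for [|f|^p] is the same with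
    [1 <= A' |cos t|^p - B' cos (p t)].

    To stay in the smooth range [f] is replaced by [f + s] with [s > 0], which does not vanish, and
    [|u|^p] by [(u^2 + eps)^(p/2)], at the price of a factor [1 + s] on [K^2 - 1]; then [s -> 0].
    The sub-mean value property is convexity in [log r] of the circular means.  The regularity of
    holomorphic functions is obtained from Goursat's theorem for the pullback of [phi dz] to a
    rectangle, applied to a homotopy from a large circle to a small one around the point. *)

(** * Bisection of rectangles *)

(** The constants are forced by contact at [theta0]: there [cos (p theta0) = 0], which gives
    [A = tan^p theta0], and [B] makes the derivative of the quotient vanish, by
    [sin ((p-1) theta0) = cos theta0]. The factor [K^2 - 1] arises from
    [(|g'| + |h'|)^2 <= K^2 (|g'| - |h'|)^2] and [(|g'| - |h'|)^2 <= |g' + h'|^2].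

    The obstacle is that [u] and [f] may vanish, where the powers need not be twice differentiable.
    The two regularizations are coupled: [eps <= s |f + s|^2] on a disc slightly larger than the one
    in question turns [u^2 + eps] into at most [(1 + s) |f + s|^2], which is the whole cost in
    comparing the negative powers, while [eps <= s^2] keeps the error in the integrals of order [s].

    In the coordinates [z = e^(x + it)] the angular second derivative integrates to 0 by
    periodicity; this is why the means are convex in [x], and a convex function with a finite limit
    at [-infinity] is nondecreasing.

    The dilatation bound holds only almost everywhere, but it relates continuous functions, so it
    suffices that a null set contains no rectangle. Compactness always enters through bisection of
    rectangles. *)

Section Bisection.

Variable P : R -> R -> R -> R -> Prop.

Let rect := ((R * R) * (R * R))%type.
Let lo1 (q : rect) := fst (fst q).
Let hi1 (q : rect) := snd (fst q).
Let lo2 (q : rect) := fst (snd q).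
Let hi2 (q : rect) := snd (snd q).
Let holds (q : rect) := P (lo1 q) (hi1 q) (lo2 q) (hi2 q).

(** The last quarter is an untested default: if the other three satisfy [P] and the whole rectangle
    does not, the splitting hypothesis forces it to fail. *)
Let bad_quarter (q : rect) : rect :=
  let m := (lo1 q + hi1 q) / 2 in
  let n := (lo2 q + hi2 q) / 2 in
  if excluded_middle_informative (P (lo1 q) m (lo2 q) n)
  then if excluded_middle_informative (P m (hi1 q) (lo2 q) n)
       then if excluded_middle_informative (P (lo1 q) m n (hi2 q))
            then ((m, hi1 q), (n, hi2 q))
            else ((lo1 q, m), (n, hi2 q))
       else ((m, hi1 q), (lo2 q, n))
  else ((lo1 q, m), (lo2 q, n)).

(** Otherwise nested bad quarters shrink to a point whose local condition they violate. The same
    principle serves for Goursat's subdivision, for the covering argument on null sets and for a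
    positive lower bound on a compact disc. *)
Lemma rect_bisection (a0 b0 c0 d0 : R) :
  a0 <= b0 -> c0 <= d0 ->
  (forall a b c d, a0 <= a -> a <= b -> b <= b0 -> c0 <= c -> c <= d -> d <= d0 ->
     P a ((a + b) / 2) c ((c + d) / 2) -> P ((a + b) / 2) b c ((c + d) / 2) ->
     P a ((a + b) / 2) ((c + d) / 2) d -> P ((a + b) / 2) b ((c + d) / 2) d ->
     P a b c d) ->
  (forall x y, a0 <= x <= b0 -> c0 <= y <= d0 -> exists delta, 0 < delta /\
     forall a b c d, a0 <= a -> b <= b0 -> c0 <= c -> d <= d0 ->
       a <= x <= b -> c <= y <= d -> b - a < delta -> d - c < delta -> P a b c d) ->
  P a0 b0 c0 d0.
Proof.
  intros Hab Hcd Hsplit Hloc.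
  destruct (excluded_middle_informative (P a0 b0 c0 d0)) as [H | Hbad]; [exact H | exfalso].
  set (q := fun n => Nat.iter n bad_quarter ((a0, b0), (c0, d0))).
  assert (Hq : forall n,
    (a0 <= lo1 (q n) /\ lo1 (q n) <= hi1 (q n) /\ hi1 (q n) <= b0) /\
    (c0 <= lo2 (q n) /\ lo2 (q n) <= hi2 (q n) /\ hi2 (q n) <= d0) /\
    ~ holds (q n) /\
    hi1 (q n) - lo1 (q n) = (b0 - a0) / 2 ^ n /\ hi2 (q n) - lo2 (q n) = (d0 - c0) / 2 ^ n).
  { induction n as [| n IH].
    - unfold q, holds, lo1, hi1, lo2, hi2; simpl; repeat split; try lra; exact Hbad.
    - destruct IH as [(H1 & H2 & H3) [(H4 & H5 & H6) [H7 [H8 H9]]]].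
      assert (E : forall x, x / 2 ^ S n = x / 2 ^ n / 2).
      { intro x; simpl; field; apply pow_nonzero; lra. }
      rewrite !E, <- H8, <- H9.
      change (q (S n)) with (bad_quarter (q n)).
      unfold holds in *; unfold bad_quarter; cbv zeta.
      revert H1 H2 H3 H4 H5 H6 H7; generalize (q n); intros [[a b] [c d]].
      unfold lo1, hi1, lo2, hi2; simpl; intros.
      destruct excluded_middle_informative as [K1 | K1];
        [destruct excluded_middle_informative as [K2 | K2];
        [destruct excluded_middle_informative as [K3 | K3] |] |];
        simpl; repeat split; try lra; try assumption.
      intro K4; apply H7, Hsplit; assumption. }
  assert (Hstep : forall n, lo1 (q n) <= lo1 (q (S n)) /\ hi1 (q (S n)) <= hi1 (q n) /\
                            lo2 (q n) <= lo2 (q (S n)) /\ hi2 (q (S n)) <= hi2 (q n)).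
  { intro n; destruct (Hq n) as [(H1 & H2 & H3) [(H4 & H5 & H6) _]].
    change (q (S n)) with (bad_quarter (q n)); unfold bad_quarter; cbv zeta.
    revert H1 H2 H3 H4 H5 H6; generalize (q n); intros [[a b] [c d]].
    unfold lo1, hi1, lo2, hi2; simpl; intros.
    repeat destruct excluded_middle_informative; simpl; lra. }
  assert (Hmono : forall n k, lo1 (q n) <= lo1 (q (n + k)%nat) /\ hi1 (q (n + k)%nat) <= hi1 (q n) /\
                              lo2 (q n) <= lo2 (q (n + k)%nat) /\ hi2 (q (n + k)%nat) <= hi2 (q n)).
  { intros n; induction k as [| k IH].
    - rewrite Nat.add_0_r; lra.
    - rewrite Nat.add_succ_r; generalize (Hstep (n + k)%nat); lra. }
  (* Comparing two stages through a common later one bounds every lower end by every upper end, so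
     the suprema of the lower ends lie in all the rectangles. *)
  assert (Hcross : forall n k, lo1 (q n) <= hi1 (q k) /\ lo2 (q n) <= hi2 (q k)).
  { intros n k; generalize (Hmono n k) (Hmono k n) (Hq (n + k)%nat).
    rewrite (Nat.add_comm k n); lra. }
  destruct (completeness (fun x => exists n, x = lo1 (q n))) as [x [Hx1 Hx2]].
  { exists (hi1 (q 0%nat)); intros y [n ->]; apply Hcross. }
  { exists (lo1 (q 0%nat)), 0%nat; reflexivity. }
  destruct (completeness (fun x => exists n, x = lo2 (q n))) as [y [Hy1 Hy2]].
  { exists (hi2 (q 0%nat)); intros y [n ->]; apply Hcross. }
  { exists (lo2 (q 0%nat)), 0%nat; reflexivity. }
  assert (Hx : forall n, lo1 (q n) <= x <= hi1 (q n)).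
  { intro n; split; [apply Hx1; exists n; reflexivity |].
    apply Hx2; intros z [k ->]; apply Hcross. }
  assert (Hy : forall n, lo2 (q n) <= y <= hi2 (q n)).
  { intro n; split; [apply Hy1; exists n; reflexivity |].
    apply Hy2; intros z [k ->]; apply Hcross. }
  destruct (Hloc x y) as [delta [Hd HP]].
  { generalize (Hx 0%nat) (Hq 0%nat); lra. }
  { generalize (Hy 0%nat) (Hq 0%nat); lra. }
  assert (Hlim : forall w, 0 <= w -> exists N, forall n, (N <= n)%nat -> w / 2 ^ n < delta).
  { intros w Hw.
    destruct (pow_lt_1_zero (/ 2) ltac:(rewrite Rabs_pos_eq; lra) (delta / (w + 1))) as [N HN].
    { apply Rdiv_lt_0_compat; lra. }
    exists N; intros n Hn; specialize (HN n Hn).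
    rewrite Rabs_pos_eq in HN by (apply pow_le; lra).
    rewrite pow_inv in HN.
    apply (Rmult_lt_compat_l (w + 1)) in HN; [| lra].
    replace ((w + 1) * (delta / (w + 1))) with delta in HN by (field; lra).
    unfold Rdiv; eapply Rle_lt_trans; [| exact HN].
    apply Rmult_le_compat_r; [| lra].
    left; apply Rinv_0_lt_compat, pow_lt; lra. }
  destruct (Hlim (b0 - a0)) as [N1 HN1]; [lra |].
  destruct (Hlim (d0 - c0)) as [N2 HN2]; [lra |].
  set (N := (N1 + N2)%nat).
  destruct (Hq N) as [(H1 & H2 & H3) [(H4 & H5 & H6) [H7 [H8 H9]]]].
  apply H7, HP; try apply Hx; try apply Hy; try lra.
  - rewrite H8; apply HN1; unfold N; lia.
  - rewrite H9; apply HN2; unfold N; lia.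
Qed.

End Bisection.

(** * Complex derivatives *)

Section ComplexContinuity.

Context {T : UniformSpace}.

Lemma continuous_pairC (f : T -> C) (x : T) :
  continuous (fun y => fst (f y)) x -> continuous (fun y => snd (f y)) x ->
  continuous f x.
Proof.
  intros Hf Hg P [eps HP]; change (locally x (fun y => P (f y))).
  apply filter_imp with (fun y => ball (fst (f x)) eps (fst (f y)) /\ ball (snd (f x)) eps (snd (f y))).
  { intros y Hy; apply HP; exact Hy. }
  apply filter_and; [apply Hf | apply Hg]; apply locally_ball.
Qed.

Lemma continuous_fstC (f : T -> C) (x : T) :
  continuous f x -> continuous (fun y => fst (f y)) x.
Proof.
  intros Hf P [eps HP]; apply (Hf (fun z => P (fst z))); exists eps; intros z [Hz _]; apply HP, Hz.
Qed.

Lemma continuous_sndC (f : T -> C) (x : T) :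
  continuous f x -> continuous (fun y => snd (f y)) x.
Proof.
  intros Hf P [eps HP]; apply (Hf (fun z => P (snd z))); exists eps; intros z [_ Hz]; apply HP, Hz.
Qed.

Lemma continuous_Rplus (f g : T -> R) (x : T) :
  continuous f x -> continuous g x -> continuous (fun y => f y + g y) x.
Proof. exact (continuous_plus (V := R_NormedModule) f g x). Qed.

Lemma continuous_Ropp (f : T -> R) (x : T) :
  continuous f x -> continuous (fun y => - f y) x.
Proof. exact (continuous_opp (V := R_NormedModule) f x). Qed.

Lemma continuous_Rminus (f g : T -> R) (x : T) :
  continuous f x -> continuous g x -> continuous (fun y => f y - g y) x.
Proof. exact (continuous_minus (V := R_NormedModule) f g x). Qed.

Lemma continuous_Rmult (f g : T -> R) (x : T) :
  continuous f x -> continuous g x -> continuous (fun y => f y * g y) x.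
Proof. exact (continuous_mult (K := R_AbsRing) f g x). Qed.

Lemma continuous_Rinv' (f : T -> R) (x : T) :
  continuous f x -> f x <> 0 -> continuous (fun y => / f y) x.
Proof.
  intros Hf H0; apply (continuous_comp f Rinv); [exact Hf | apply continuous_Rinv, H0].
Qed.

Lemma continuous_Cplus (f g : T -> C) (x : T) :
  continuous f x -> continuous g x -> continuous (fun y => Cplus (f y) (g y)) x.
Proof.
  intros Hf Hg; apply continuous_pairC; simpl; apply continuous_Rplus;
    (apply continuous_fstC || apply continuous_sndC); assumption.
Qed.

Lemma continuous_Copp (f : T -> C) (x : T) :
  continuous f x -> continuous (fun y => Copp (f y)) x.
Proof.
  intros Hf; apply continuous_pairC; simpl; apply continuous_Ropp;
    (apply continuous_fstC || apply continuous_sndC); assumption.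
Qed.

Lemma continuous_Cmult (f g : T -> C) (x : T) :
  continuous f x -> continuous g x -> continuous (fun y => Cmult (f y) (g y)) x.
Proof.
  intros Hf Hg; apply continuous_pairC; simpl;
    [apply continuous_Rminus | apply continuous_Rplus]; apply continuous_Rmult;
    (apply continuous_fstC || apply continuous_sndC); assumption.
Qed.

Lemma continuous_Cmod (f : T -> C) (x : T) :
  continuous f x -> continuous (fun y => Cmod (f y)) x.
Proof.
  intros Hf; unfold Cmod.
  apply (continuous_comp (fun y => fst (f y) ^ 2 + snd (f y) ^ 2) sqrt).
  - simpl; apply continuous_Rplus; repeat apply continuous_Rmult;
    try apply continuous_const; (apply continuous_fstC || apply continuous_sndC); assumption.
  - apply continuous_sqrt.
Qed.

Lemma continuous_Cinv (f : T -> C) (x : T) :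
  continuous f x -> f x <> RtoC 0 -> continuous (fun y => Cinv (f y)) x.
Proof.
  intros Hf H0.
  assert (H1 : fst (f x) ^ 2 + snd (f x) ^ 2 <> 0).
  { intro H; apply H0; apply Cmod_eq_0; unfold Cmod; rewrite H; apply sqrt_0. }
  assert (H2 : continuous (fun y => fst (f y) ^ 2 + snd (f y) ^ 2) x).
  { simpl; apply continuous_Rplus; repeat apply continuous_Rmult;
    try apply continuous_const; (apply continuous_fstC || apply continuous_sndC); assumption. }
  apply continuous_pairC; unfold Cinv, Rdiv; cbn [fst snd]; apply continuous_Rmult;
    try apply continuous_Ropp; try (apply continuous_Rinv'; assumption);
    (apply continuous_fstC || apply continuous_sndC); assumption.
Qed.

End ComplexContinuity.

Lemma continuous_epsC (g : C -> C) (z : C) :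
  continuous g z <->
  (forall eps, 0 < eps -> exists delta, 0 < delta /\
     forall w, Cmod (Cminus w z) < delta -> Cmod (Cminus (g w) (g z)) < eps).
Proof.
  split.
  - intros H eps He.
    assert (H1 : continuous (fun w => Cmod (Cminus (g w) (g z))) z).
    { apply continuous_Cmod, continuous_Cplus; [exact H | apply continuous_const]. }
    destruct (H1 (fun r => r < eps)) as [d Hd].
    { unfold Cminus; rewrite Cplus_opp_r, Cmod_0; exists (mkposreal _ He); intros y Hy.
      change (Rabs (y - 0) < eps) in Hy; apply Rabs_def2 in Hy; lra. }
    exists d; split; [apply cond_pos |]; intros w Hw; apply Hd.
    exact (C_NormedModule_mixin_compat1 z w d Hw).
  - intros H P [eps HP].
    destruct (H eps (cond_pos eps)) as [d [Hd0 Hd]].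
    (* A ball of radius [d / 2] in the product uniformity bounds the modulus only by
       [sqrt 2 * (d / 2)], which is at most [d]. *)
    assert (Hd2 : 0 < d / 2) by lra.
    exists (mkposreal _ Hd2); intros w Hw.
    apply HP, C_NormedModule_mixin_compat1; apply Hd.
    eapply Rlt_le_trans; [exact (C_NormedModule_mixin_compat2 z w (mkposreal _ Hd2) Hw) |].
    simpl; assert (sqrt 2 <= 2); [| nra].
    rewrite <- (sqrt_square 2) at 2 by lra; apply sqrt_le_1; lra.
Qed.

(** Carathéodory's form trades the limit of difference quotients for the continuity of a slope
    function, so that the chain rule just multiplies slopes. *)
Lemma is_derive_caratheodory (f : R -> R) (x l : R) :
  is_derive f x l <->
  exists q : R -> R, (forall y, f y = f x + q y * (y - x)) /\ continuous q x /\ q x = l.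
Proof.
  split.
  - intros H; exists (fun y => if Req_EM_T y x then l else (f y - f x) / (y - x)).
    split; [| split].
    + intro y; destruct Req_EM_T as [-> | Hn]; [ring | field; lra].
    + apply is_derive_Reals in H; intros P [eps HP].
      destruct (Req_EM_T x x) as [_ | Hn] in HP; [| lra].
      destruct (H eps (cond_pos eps)) as [d Hd].
      exists d; intros y Hy; apply HP.
      change (Rabs (y - x) < d) in Hy.
      destruct Req_EM_T as [-> | Hn]; [apply ball_center |].
      change (Rabs ((f y - f x) / (y - x) - l) < eps).
      replace (f y) with (f (x + (y - x))) by (f_equal; ring).
      apply Hd; [lra | exact Hy].
    + destruct Req_EM_T; [reflexivity | lra].
  - intros [q [H1 [H2 H3]]]; apply is_derive_Reals; intros eps He.
    destruct (H2 (fun r => Rabs (r - l) < eps)) as [d Hd].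
    { rewrite H3; exists (mkposreal _ He); intros y Hy; exact Hy. }
    exists d; intros h Hh Hhd; rewrite (H1 (x + h)).
    replace ((f x + q (x + h) * (x + h - x) - f x) / h) with (q (x + h)) by (field; exact Hh).
    apply Hd; change (Rabs (x + h - x) < d); replace (x + h - x) with h by ring; exact Hhd.
Qed.

Ltac Cnorm := cbv beta; match goal with |- @eq _ ?a ?b => let a1 := constr:(a : C) in let b1 := constr:(b : C) in change (@eq C a1 b1) end.
Ltac Cring := Cnorm; ring.
Ltac Cfield := Cnorm; field.

(** Carathéodory's form of complex differentiability. The factorization is local because, for a
    reciprocal, it may fail where the function vanishes. *)
Definition is_Cderive (g : C -> C) (z l : C) : Prop :=
  exists Q : C -> C,
    locally z (fun w => g w = Cplus (g z) (Cmult (Q w) (Cminus w z))) /\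
    continuous Q z /\ Q z = l.

(** Taken coordinatewise so that real derivative computations and the real fundamental theorem apply
    to each component. *)
Definition is_path_derive (c : R -> C) (s : R) (c' : C) : Prop :=
  is_derive (fun x => fst (c x)) s (fst c') /\ is_derive (fun x => snd (c x)) s (snd c').

Lemma is_Cderive_continuous (g : C -> C) (z l : C) : is_Cderive g z l -> continuous g z.
Proof.
  intros [Q [H1 [H2 H3]]].
  apply continuous_ext_loc with (fun w => Cplus (g z) (Cmult (Q w) (Cminus w z))).
  { apply filter_imp with (2 := H1); intros w Hw; symmetry; exact Hw. }
  apply continuous_Cplus; [apply continuous_const |].
  apply continuous_Cmult; [exact H2 |].
  apply continuous_Cplus; [apply continuous_id | apply continuous_const].
Qed.

Lemma is_Cderive_const (a z : C) : is_Cderive (fun _ => a) z (RtoC 0).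
Proof.
  exists (fun _ => RtoC 0); split; [| split; [apply continuous_const | reflexivity]].
  apply filter_forall; intro w; Cring.
Qed.

Lemma is_Cderive_id (z : C) : is_Cderive (fun w => w) z (RtoC 1).
Proof.
  exists (fun _ => RtoC 1); split; [| split; [apply continuous_const | reflexivity]].
  apply filter_forall; intro w; Cring.
Qed.

Lemma is_Cderive_plus (f g : C -> C) (z lf lg : C) :
  is_Cderive f z lf -> is_Cderive g z lg ->
  is_Cderive (fun w => Cplus (f w) (g w)) z (Cplus lf lg).
Proof.
  intros [P [H1 [H2 H3]]] [Q [K1 [K2 K3]]].
  exists (fun w => Cplus (P w) (Q w)); split; [| split].
  - apply filter_imp with (2 := filter_and _ _ H1 K1); intros w [-> ->]; Cring.
  - apply continuous_Cplus; assumption.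
  - rewrite H3, K3; reflexivity.
Qed.

Lemma is_Cderive_mult (f g : C -> C) (z lf lg : C) :
  is_Cderive f z lf -> is_Cderive g z lg ->
  is_Cderive (fun w => Cmult (f w) (g w)) z (Cplus (Cmult lf (g z)) (Cmult (f z) lg)).
Proof.
  intros Hf Hg; generalize (is_Cderive_continuous _ _ _ Hg); intro Hc.
  destruct Hf as [P [H1 [H2 H3]]], Hg as [Q [K1 [K2 K3]]].
  exists (fun w => Cplus (Cmult (P w) (g w)) (Cmult (f z) (Q w))); split; [| split].
  - apply filter_imp with (2 := filter_and _ _ H1 K1); intros w [-> ->]; Cring.
  - apply continuous_Cplus; apply continuous_Cmult; try assumption; apply continuous_const.
  - rewrite H3, K3; reflexivity.
Qed.

Lemma continuous_neq_0_C {T : UniformSpace} (g : T -> C) (z : T) :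
  continuous g z -> g z <> RtoC 0 -> locally z (fun w => g w <> RtoC 0).
Proof.
  intros Hc H0.
  assert (Hm := proj1 (Cmod_gt_0 (g z)) H0).
  assert (H1 := continuous_Cmod _ _ Hc).
  apply filter_imp with (fun w => 0 < Cmod (g w)).
  { intros w Hw; apply Cmod_gt_0, Hw. }
  apply H1; exists (mkposreal _ Hm); intros y Hy.
  change (Rabs (y - Cmod (g z)) < Cmod (g z)) in Hy; apply Rabs_def2 in Hy; lra.
Qed.

Lemma is_Cderive_inv (g : C -> C) (z l : C) :
  is_Cderive g z l -> g z <> RtoC 0 ->
  is_Cderive (fun w => Cinv (g w)) z (Copp (Cmult l (Cinv (Cmult (g z) (g z))))).
Proof.
  intros Hg H0; generalize (is_Cderive_continuous _ _ _ Hg); intro Hc.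
  destruct Hg as [Q [K1 [K2 K3]]].
  exists (fun w => Copp (Cmult (Q w) (Cinv (Cmult (g w) (g z))))); split; [| split].
  - apply filter_imp with (2 := filter_and _ _ K1 (continuous_neq_0_C g z Hc H0)).
    intros w [Hw Hw0].
    assert (E : Cmult (Q w) (Cminus w z) = Cminus (g w) (g z)) by (rewrite Hw at 1; Cring).
    transitivity (Cplus (Cinv (g z)) (Copp (Cmult (Cmult (Q w) (Cminus w z)) (Cinv (Cmult (g w) (g z)))))).
    { rewrite E; Cfield; split; assumption. }
    Cring.
  - apply continuous_Copp, continuous_Cmult; [exact K2 |].
    apply continuous_Cinv; [apply continuous_Cmult; [exact Hc | apply continuous_const] |].
    apply Cmult_neq_0; assumption.
  - rewrite K3; reflexivity.
Qed.

Lemma is_path_derive_continuous (c : R -> C) (s : R) (c' : C) :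
  is_path_derive c s c' -> continuous c s.
Proof.
  intros [H1 H2]; apply continuous_pairC; apply (ex_derive_continuous (V := R_NormedModule));
    eexists; eassumption.
Qed.

(** The slope of the composite is [Q (c x)] times the slope of the curve, continuous at [s]; its
    real and imaginary parts are the slopes of the two components. *)
Lemma is_path_derive_comp (g : C -> C) (c : R -> C) (s : R) (l c' : C) :
  is_Cderive g (c s) l -> is_path_derive c s c' ->
  is_path_derive (fun x => g (c x)) s (Cmult l c').
Proof.
  intros [Q [K1 [K2 K3]]] Hc; generalize (is_path_derive_continuous _ _ _ Hc); intro Hcc.
  destruct Hc as [H1 H2].
  apply is_derive_caratheodory in H1; destruct H1 as [q1 [A1 [A2 A3]]].
  apply is_derive_caratheodory in H2; destruct H2 as [q2 [B1 [B2 B3]]].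
  assert (Hloc : locally s (fun x => g (c x) =
            Cplus (g (c s)) (Cmult (Cmult (Q (c x)) (q1 x, q2 x)) (RtoC (x - s))))).
  { assert (K := Hcc _ K1).
    change (locally s (fun x => g (c x) = Cplus (g (c s)) (Cmult (Q (c x)) (Cminus (c x) (c s))))) in K.
    revert K; apply filter_imp; intros x ->; f_equal.
    rewrite <- Cmult_assoc; f_equal.
    apply injective_projections; simpl; [rewrite A1 | rewrite B1]; ring. }
  assert (HQ : continuous (fun x => Cmult (Q (c x)) (q1 x, q2 x)) s).
  { apply continuous_Cmult; [apply (continuous_comp c Q); assumption |].
    apply continuous_pairC; assumption. }
  assert (E : Cmult (Q (c s)) (q1 s, q2 s) = Cmult l c').
  { rewrite K3, A3, B3; destruct c'; reflexivity. }
  split.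
  - apply is_derive_ext_loc with
      (fun x => fst (g (c s)) + fst (Cmult (Q (c x)) (q1 x, q2 x)) * (x - s)).
    { apply filter_imp with (2 := Hloc); intros x ->; simpl; ring. }
    apply is_derive_caratheodory; exists (fun x => fst (Cmult (Q (c x)) (q1 x, q2 x))).
    split; [intro y; ring | split; [apply continuous_fstC, HQ | rewrite <- E; reflexivity]].
  - apply is_derive_ext_loc with
      (fun x => snd (g (c s)) + snd (Cmult (Q (c x)) (q1 x, q2 x)) * (x - s)).
    { apply filter_imp with (2 := Hloc); intros x ->; simpl; ring. }
    apply is_derive_caratheodory; exists (fun x => snd (Cmult (Q (c x)) (q1 x, q2 x))).
    split; [intro y; ring | split; [apply continuous_sndC, HQ | rewrite <- E; reflexivity]].
Qed.

(** Estimates of integrals produce the limit form, while the algebraic rules consume the slope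
    form. *)
Lemma is_Cderive_eps (g : C -> C) (z l : C) :
  is_Cderive g z l <->
  (forall eps, 0 < eps -> exists delta, 0 < delta /\
     forall w, Cmod (Cminus w z) < delta ->
       Cmod (Cminus (Cminus (g w) (g z)) (Cmult l (Cminus w z))) <= eps * Cmod (Cminus w z)).
Proof.
  split.
  - intros [Q [K1 [K2 K3]]] eps He.
    destruct (proj1 (continuous_epsC Q z) K2 eps He) as [d1 [Hd1 H1]].
    destruct K1 as [d2 H2].
    exists (Rmin d1 d2); split; [apply Rmin_pos; [exact Hd1 | apply cond_pos] |].
    intros w Hw.
    assert (Hw1 : Cmod (Cminus w z) < d1) by (eapply Rlt_le_trans; [exact Hw | apply Rmin_l]).
    assert (Hw2 : Cmod (Cminus w z) < d2) by (eapply Rlt_le_trans; [exact Hw | apply Rmin_r]).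
    rewrite (H2 w (C_NormedModule_mixin_compat1 z w d2 Hw2)), <- K3.
    replace (Cminus _ _) with (Cmult (Cminus (Q w) (Q z)) (Cminus w z)) by Cring.
    rewrite Cmod_mult; apply Rmult_le_compat_r; [apply Cmod_ge_0 |].
    left; apply H1, Hw1.
  - intros H.
    exists (fun w => if excluded_middle_informative (w = z) then l
                     else Cdiv (Cminus (g w) (g z)) (Cminus w z)).
    split; [| split].
    + apply filter_forall; intro w; destruct excluded_middle_informative as [-> | Hn]; [Cring |].
      Cfield; intro E; apply Hn; rewrite <- (Cplus_0_l z), <- E; Cring.
    + apply continuous_epsC; intros eps He.
      destruct (H (eps / 2)) as [d [Hd1 Hd2]]; [lra |].
      exists d; split; [exact Hd1 |]; intros w Hw.
      destruct (excluded_middle_informative (z = z)) as [_ | Hn]; [| congruence].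
      destruct (excluded_middle_informative (w = z)) as [-> | Hn].
      { unfold Cminus; rewrite Cplus_opp_r, Cmod_0; exact He. }
      assert (Hwz : Cminus w z <> RtoC 0).
      { intro E; apply Hn; rewrite <- (Cplus_0_l z), <- E; ring. }
      replace (Cminus _ _) with
        (Cdiv (Cminus (Cminus (g w) (g z)) (Cmult l (Cminus w z))) (Cminus w z)) by (Cfield; exact Hwz).
      rewrite Cmod_div by exact Hwz.
      assert (Hp := proj1 (Cmod_gt_0 _) Hwz).
      apply (Rmult_lt_reg_r (Cmod (Cminus w z))); [exact Hp |].
      unfold Rdiv; rewrite Rmult_assoc, Rinv_l, Rmult_1_r by lra.
      eapply Rle_lt_trans; [apply Hd2, Hw | nra].
    + destruct excluded_middle_informative; [reflexivity | congruence].
Qed.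

(** The passage from the derivative in [holomorphic_D] to the one used throughout the proof. *)
Lemma is_Cderive_of_is_derive (g : C -> C) (z l : C) :
  @is_derive C_AbsRing C_NormedModule g z l -> is_Cderive g z l.
Proof.
  intros [_ H]; apply is_Cderive_eps; intros eps He.
  specialize (H z (fun P HP => HP) (mkposreal eps He)).
  destruct H as [d Hd]; exists d; split; [apply cond_pos |].
  intros w Hw; specialize (Hd w Hw).
  rewrite (Cmult_comm l); exact Hd.
Qed.

(** Needed to identify a derivative obtained by choice with a Cauchy integral in [holo_deriv]. *)
Lemma is_Cderive_unique (g : C -> C) (z l1 l2 : C) :
  is_Cderive g z l1 -> is_Cderive g z l2 -> l1 = l2.
Proof.
  intros H1 H2; rewrite is_Cderive_eps in H1, H2.
  destruct (excluded_middle_informative (l1 = l2)) as [E | Hn]; [exact E | exfalso].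
  assert (Hl : Cminus l1 l2 <> RtoC 0).
  { intro E; apply Hn; rewrite <- (Cplus_0_l l2), <- E; ring. }
  assert (Hp := proj1 (Cmod_gt_0 _) Hl).
  set (m := Cmod (Cminus l1 l2)) in *.
  destruct (H1 (m / 4)) as [d1 [Hd1 K1]]; [lra |].
  destruct (H2 (m / 4)) as [d2 [Hd2 K2]]; [lra |].
  set (d := Rmin d1 d2 / 2).
  assert (Hm := Rmin_pos _ _ Hd1 Hd2).
  assert (Hml := Rmin_l d1 d2); assert (Hmr := Rmin_r d1 d2).
  set (w := Cplus z (RtoC d)).
  assert (Ew : Cminus w z = RtoC d) by (unfold w; ring).
  assert (Em : Cmod (Cminus w z) = d) by (rewrite Ew, Cmod_R, Rabs_pos_eq; unfold d; lra).
  specialize (K1 w); specialize (K2 w); rewrite Em in K1, K2.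
  specialize (K1 ltac:(unfold d; lra)); specialize (K2 ltac:(unfold d; lra)).
  assert (K : m * d <= m / 4 * d + m / 4 * d).
  { unfold m; rewrite <- Em at 1; rewrite <- Cmod_mult.
    replace (Cmult (Cminus l1 l2) (Cminus w z)) with
      (Cplus (Cminus (Cminus (g w) (g z)) (Cmult l2 (Cminus w z)))
             (Copp (Cminus (Cminus (g w) (g z)) (Cmult l1 (Cminus w z))))) by Cring.
    eapply Rle_trans; [apply Cmod_triangle |]; rewrite Cmod_opp.
    unfold m in K1, K2; lra. }
  assert (0 < d) by (unfold d; lra); nra.
Qed.

(** * Path integrals and Goursat's theorem *)

Lemma Cmod_minus_le (x y : C) : Cmod (Cminus x y) <= Cmod x + Cmod y.
Proof. rewrite <- (Cmod_opp y); apply Cmod_triangle. Qed.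

Definition CInt (f : R -> C) (a b : R) : C := @RInt C_R_CompleteNormedModule f a b.

Section PathIntegrals.

Variables (a b : R).
Hypothesis Hab : a <= b.

Lemma CInt_correct (f : R -> C) :
  (forall t, a <= t <= b -> continuous f t) ->
  @is_RInt C_R_NormedModule f a b (CInt f a b).
Proof.
  intros Hf; apply (RInt_correct (V := C_R_CompleteNormedModule)).
  apply (ex_RInt_continuous (V := C_R_CompleteNormedModule)).
  rewrite Rmin_left, Rmax_right by exact Hab; exact Hf.
Qed.

Lemma CInt_unique (f : R -> C) (l : C) : @is_RInt C_R_NormedModule f a b l -> CInt f a b = l.
Proof. exact (is_RInt_unique (V := C_R_CompleteNormedModule) f a b l). Qed.

Lemma CInt_ext (f g : R -> C) : (forall t, a <= t <= b -> f t = g t) -> CInt f a b = CInt g a b.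
Proof.
  intros H; apply (RInt_ext (V := C_R_CompleteNormedModule)).
  rewrite Rmin_left, Rmax_right by exact Hab; intros x Hx; apply H; lra.
Qed.

Lemma CInt_bound (f : R -> C) (M : R) :
  (forall t, a <= t <= b -> continuous f t) ->
  (forall t, a <= t <= b -> Cmod (f t) <= M) -> Cmod (CInt f a b) <= (b - a) * M.
Proof.
  intros Hc HM; rewrite Cmod_norm.
  apply (norm_RInt_le (V := C_R_NormedModule) f (fun _ => M) a b).
  - exact Hab.
  - intros x Hx; eapply Rle_trans; [right; symmetry; apply (Cmod_norm (f x)) | apply HM, Hx].
  - apply CInt_correct, Hc.
  - apply (is_RInt_const (V := R_NormedModule)).
Qed.

Lemma CInt_derive (c c' : R -> C) :
  (forall t, a <= t <= b -> is_path_derive c t (c' t)) ->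
  (forall t, a <= t <= b -> continuous c' t) -> CInt c' a b = Cminus (c b) (c a).
Proof.
  intros Hd Hc; apply CInt_unique, (is_RInt_fct_extend_pair (U := R_NormedModule) (V := R_NormedModule)).
  - apply (is_RInt_derive (V := R_CompleteNormedModule) (fun t => fst (c t)) (fun t => fst (c' t)));
      rewrite Rmin_left, Rmax_right by exact Hab; intros x Hx.
    + apply Hd, Hx.
    + apply continuous_fstC, Hc, Hx.
  - apply (is_RInt_derive (V := R_CompleteNormedModule) (fun t => snd (c t)) (fun t => snd (c' t)));
      rewrite Rmin_left, Rmax_right by exact Hab; intros x Hx.
    + apply Hd, Hx.
    + apply continuous_sndC, Hc, Hx.
Qed.

Lemma CInt_scal (k : C) (f : R -> C) :
  (forall t, a <= t <= b -> continuous f t) ->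
  CInt (fun t => Cmult k (f t)) a b = Cmult k (CInt f a b).
Proof.
  intros Hf; apply CInt_unique.
  assert (H := CInt_correct f Hf).
  assert (H1 := is_RInt_fct_extend_fst (U := R_NormedModule) (V := R_NormedModule) _ _ _ _ H).
  assert (H2 := is_RInt_fct_extend_snd (U := R_NormedModule) (V := R_NormedModule) _ _ _ _ H).
  destruct k as [k1 k2].
  apply (is_RInt_fct_extend_pair (U := R_NormedModule) (V := R_NormedModule)); simpl.
  - exact (is_RInt_minus (V := R_NormedModule) _ _ a b _ _
      (is_RInt_scal (V := R_NormedModule) _ a b k1 _ H1)
      (is_RInt_scal (V := R_NormedModule) _ a b k2 _ H2)).
  - exact (is_RInt_plus (V := R_NormedModule) _ _ a b _ _
      (is_RInt_scal (V := R_NormedModule) _ a b k1 _ H2)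
      (is_RInt_scal (V := R_NormedModule) _ a b k2 _ H1)).
Qed.

Lemma CInt_minus (f g : R -> C) :
  (forall t, a <= t <= b -> continuous f t) -> (forall t, a <= t <= b -> continuous g t) ->
  CInt (fun t => Cminus (f t) (g t)) a b = Cminus (CInt f a b) (CInt g a b).
Proof.
  intros Hf Hg; apply CInt_unique.
  exact (is_RInt_minus (V := C_R_NormedModule) f g a b _ _ (CInt_correct f Hf) (CInt_correct g Hg)).
Qed.

(* [phi0 w + l (w - z0)^2 / 2] is a primitive of the affine part of the integrand. *)
Lemma CInt_near_affine (phi : C -> C) (c c' : R -> C) (phi0 z0 l : C) (M : R) :
  (forall t, a <= t <= b -> is_path_derive c t (c' t)) ->
  (forall t, a <= t <= b -> continuous c' t) ->
  (forall t, a <= t <= b -> continuous phi (c t)) ->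
  (forall t, a <= t <= b ->
     Cmod (Cmult (Cminus (Cminus (phi (c t)) phi0) (Cmult l (Cminus (c t) z0))) (c' t)) <= M) ->
  let F := fun w => Cplus (Cmult phi0 w) (Cmult (Cdiv l (RtoC 2)) (Cmult (Cminus w z0) (Cminus w z0))) in
  Cmod (Cminus (CInt (fun t => Cmult (phi (c t)) (c' t)) a b) (Cminus (F (c b)) (F (c a)))) <= (b - a) * M.
Proof.
  intros Hd Hc' Hphi HM F.
  assert (Hc : forall t, a <= t <= b -> continuous c t).
  { intros t Ht; eapply is_path_derive_continuous, Hd, Ht. }
  assert (HF : forall w, is_Cderive F w (Cplus phi0 (Cmult l (Cminus w z0)))).
  { intros w.
    assert (Hm : is_Cderive (fun w => Cminus w z0) w (RtoC 1)).
    { replace (RtoC 1) with (Cplus (RtoC 1) (RtoC 0)) by ring.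
      apply (is_Cderive_plus (fun w => w) (fun _ => Copp z0));
        [apply is_Cderive_id | apply is_Cderive_const]. }
    assert (H1 := is_Cderive_mult _ _ _ _ _ (is_Cderive_const phi0 w) (is_Cderive_id w)).
    assert (H2 := is_Cderive_mult _ _ _ _ _ (is_Cderive_const (Cdiv l (RtoC 2)) w)
                    (is_Cderive_mult _ _ _ _ _ Hm Hm)).
    assert (H3 := is_Cderive_plus _ _ _ _ _ H1 H2).
    match type of H3 with is_Cderive _ _ ?x =>
      replace (Cplus phi0 (Cmult l (Cminus w z0))) with x; [exact H3 |] end.
    assert (RtoC 2 <> RtoC 0) by (intro E; apply RtoC_inj in E; lra).
    field; assumption. }
  assert (HFc : forall t, a <= t <= b -> continuous
            (fun s => Cmult (Cplus phi0 (Cmult l (Cminus (c s) z0))) (c' s)) t).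
  { intros t Ht; apply continuous_Cmult; [| apply Hc', Ht].
    apply continuous_Cplus; [apply continuous_const |].
    apply continuous_Cmult; [apply continuous_const |].
    apply continuous_Cplus; [apply Hc, Ht | apply continuous_const]. }
  assert (HPc : forall t, a <= t <= b -> continuous (fun s => Cmult (phi (c s)) (c' s)) t).
  { intros t Ht; apply continuous_Cmult; [| apply Hc', Ht].
    apply (continuous_comp c phi); [apply Hc | apply Hphi]; exact Ht. }
  rewrite <- (CInt_derive (fun t => F (c t))
    (fun s => Cmult (Cplus phi0 (Cmult l (Cminus (c s) z0))) (c' s))); [| | exact HFc].
  2: { intros t Ht; apply is_path_derive_comp; [apply HF | apply Hd, Ht]. }
  rewrite <- CInt_minus by assumption.
  apply CInt_bound.
  - intros t Ht; apply continuous_Cplus; [| apply continuous_Copp]; auto.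
  - intros t Ht; eapply Rle_trans; [| apply (HM t Ht)]; right; f_equal; ring.
Qed.

End PathIntegrals.

Lemma CInt_Chasles_mid (f : R -> C) (a b : R) :
  a <= b -> (forall t, a <= t <= b -> continuous f t) ->
  CInt f a b = Cplus (CInt f a ((a + b) / 2)) (CInt f ((a + b) / 2) b).
Proof.
  intros Hab Hf; symmetry.
  apply (RInt_Chasles (V := C_R_CompleteNormedModule));
    apply (ex_RInt_continuous (V := C_R_CompleteNormedModule)); intros t Ht; apply Hf;
    rewrite Rmin_left, Rmax_right in Ht by lra; lra.
Qed.

Section Goursat.

Variables (phi : C -> C) (g g1 g2 : R -> R -> C) (L a0 b0 c0 d0 : R).
Hypothesis Hab0 : a0 <= b0.
Hypothesis Hcd0 : c0 <= d0.
Hypothesis Hg1 : forall s t, a0 <= s <= b0 -> c0 <= t <= d0 -> is_path_derive (fun x => g x t) s (g1 s t).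
Hypothesis Hg2 : forall s t, a0 <= s <= b0 -> c0 <= t <= d0 -> is_path_derive (g s) t (g2 s t).
Hypothesis Hg1c : forall s t, a0 <= s <= b0 -> c0 <= t <= d0 -> continuous (fun x => g1 x t) s.
Hypothesis Hg2c : forall s t, a0 <= s <= b0 -> c0 <= t <= d0 -> continuous (g2 s) t.
Hypothesis Hg1L : forall s t, a0 <= s <= b0 -> c0 <= t <= d0 -> Cmod (g1 s t) <= L.
Hypothesis Hg2L : forall s t, a0 <= s <= b0 -> c0 <= t <= d0 -> Cmod (g2 s t) <= L.
Hypothesis Hphi : forall s t, a0 <= s <= b0 -> c0 <= t <= d0 -> exists l, is_Cderive phi (g s t) l.

Let I1 a b t := CInt (fun s => Cmult (phi (g s t)) (g1 s t)) a b.
Let I2 c d s := CInt (fun t => Cmult (phi (g s t)) (g2 s t)) c d.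
(** The integral of the pullback of [phi dz] under [g] along the positively oriented boundary of the
    rectangle. *)
Let I a b c d := Cminus (Cplus (I1 a b c) (I2 c d b)) (Cplus (I1 a b d) (I2 c d a)).

Let phi_cont s t : a0 <= s <= b0 -> c0 <= t <= d0 -> continuous phi (g s t).
Proof. intros Hs Ht; destruct (Hphi s t Hs Ht) as [l Hl]; eapply is_Cderive_continuous, Hl. Qed.

Let w1_cont s t : a0 <= s <= b0 -> c0 <= t <= d0 ->
  continuous (fun x => Cmult (phi (g x t)) (g1 x t)) s.
Proof.
  intros Hs Ht; apply continuous_Cmult; [| apply Hg1c; assumption].
  apply (continuous_comp (fun x => g x t) phi); [| apply phi_cont; assumption].
  eapply is_path_derive_continuous, Hg1; assumption.
Qed.

Let w2_cont s t : a0 <= s <= b0 -> c0 <= t <= d0 ->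
  continuous (fun x => Cmult (phi (g s x)) (g2 s x)) t.
Proof.
  intros Hs Ht; apply continuous_Cmult; [| apply Hg2c; assumption].
  apply (continuous_comp (g s) phi); [| apply phi_cont; assumption].
  eapply is_path_derive_continuous, Hg2; assumption.
Qed.

Let lip1 s s' t : a0 <= s <= b0 -> a0 <= s' <= b0 -> c0 <= t <= d0 -> s <= s' ->
  Cmod (Cminus (g s' t) (g s t)) <= (s' - s) * L.
Proof.
  intros Hs Hs' Ht Hle.
  rewrite <- (CInt_derive s s' Hle (fun x => g x t) (fun x => g1 x t)).
  - apply CInt_bound; [exact Hle | |]; intros x Hx; [apply Hg1c | apply Hg1L]; lra.
  - intros x Hx; apply Hg1; lra.
  - intros x Hx; apply Hg1c; lra.
Qed.

Let lip2 s t t' : a0 <= s <= b0 -> c0 <= t <= d0 -> c0 <= t' <= d0 -> t <= t' ->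
  Cmod (Cminus (g s t') (g s t)) <= (t' - t) * L.
Proof.
  intros Hs Ht Ht' Hle.
  rewrite <- (CInt_derive t t' Hle (g s) (g2 s)).
  - apply CInt_bound; [exact Hle | |]; intros x Hx; [apply Hg2c | apply Hg2L]; lra.
  - intros x Hx; apply Hg2; lra.
  - intros x Hx; apply Hg2c; lra.
Qed.

Let lip a b c d s s' t t' : a0 <= a -> b <= b0 -> c0 <= c -> d <= d0 ->
  a <= s <= b -> a <= s' <= b -> c <= t <= d -> c <= t' <= d ->
  Cmod (Cminus (g s' t') (g s t)) <= ((b - a) + (d - c)) * L.
Proof.
  intros.
  assert (HL : 0 <= L).
  { eapply Rle_trans; [apply Cmod_ge_0 | apply (Hg1L s t)]; lra. }
  replace (Cminus (g s' t') (g s t)) with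
    (Cplus (Cminus (g s' t') (g s t')) (Cminus (g s t') (g s t))) by ring.
  eapply Rle_trans; [apply Cmod_triangle |].
  rewrite Rmult_plus_distr_r; apply Rplus_le_compat.
  - destruct (Rle_dec s s').
    + eapply Rle_trans; [apply lip1; lra | nra].
    + rewrite <- Cmod_opp, Copp_minus_distr; eapply Rle_trans; [apply lip1; lra | nra].
  - destruct (Rle_dec t t').
    + eapply Rle_trans; [apply lip2; lra | nra].
    + rewrite <- Cmod_opp, Copp_minus_distr; eapply Rle_trans; [apply lip2; lra | nra].
Qed.

(** Near a point [phi] is affine up to a small multiple of the distance. The affine part has a
    primitive and contributes nothing around a closed boundary; the remainder contributes a small
    multiple of the squared side sum, and bisection carries this bound to the full rectangle. *)
Lemma goursat : I a0 b0 c0 d0 = RtoC 0.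
Proof.
  assert (HL : 0 <= L).
  { eapply Rle_trans; [apply Cmod_ge_0 | apply (Hg1L a0 c0)]; lra. }
  assert (Hmain : forall eps, 0 < eps ->
    Cmod (I a0 b0 c0 d0) <= eps * ((b0 - a0) + (d0 - c0)) ^ 2).
  { intros eps He.
    (* The quadratic bound is reproduced exactly under subdivision: four quarters, each with half
       the side sum. *)
    apply (rect_bisection (fun a b c d => Cmod (I a b c d) <= eps * ((b - a) + (d - c)) ^ 2));
      [exact Hab0 | exact Hcd0 | |].
    - intros a b c d Ha Hab Hb Hc Hcd Hd H1 H2 H3 H4.
      set (m := (a + b) / 2) in *; set (n := (c + d) / 2) in *.
      assert (E : I a b c d = Cplus (Cplus (I a m c n) (I m b c n)) (Cplus (I a m n d) (I m b n d))).
      { unfold I, I1, I2.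
        rewrite (CInt_Chasles_mid (fun s => Cmult (phi (g s c)) (g1 s c)) a b Hab)
          by (intros t Ht; apply w1_cont; lra).
        rewrite (CInt_Chasles_mid (fun s => Cmult (phi (g s d)) (g1 s d)) a b Hab)
          by (intros t Ht; apply w1_cont; lra).
        rewrite (CInt_Chasles_mid (fun t => Cmult (phi (g b t)) (g2 b t)) c d Hcd)
          by (intros t Ht; apply w2_cont; lra).
        rewrite (CInt_Chasles_mid (fun t => Cmult (phi (g a t)) (g2 a t)) c d Hcd)
          by (intros t Ht; apply w2_cont; lra).
        fold m n; ring. }
      rewrite E.
      eapply Rle_trans; [apply Cmod_triangle |].
      eapply Rle_trans; [apply Rplus_le_compat; apply Cmod_triangle |].
      replace (m - a) with ((b - a) / 2) in H1, H3 by (unfold m; field).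
      replace (b - m) with ((b - a) / 2) in H2, H4 by (unfold m; field).
      replace (n - c) with ((d - c) / 2) in H1, H2 by (unfold n; field).
      replace (d - n) with ((d - c) / 2) in H3, H4 by (unfold n; field).
      replace (eps * (b - a + (d - c)) ^ 2) with
        ((eps * ((b - a) / 2 + (d - c) / 2) ^ 2 + eps * ((b - a) / 2 + (d - c) / 2) ^ 2)
         + (eps * ((b - a) / 2 + (d - c) / 2) ^ 2 + eps * ((b - a) / 2 + (d - c) / 2) ^ 2)) by field.
      repeat apply Rplus_le_compat; assumption.
    - intros x y Hx Hy.
      destruct (Hphi x y Hx Hy) as [l Hl].
      (* The four sides together contribute [2 * L * L * eta] times the squared side sum; the [+ 1]
         guards against [L = 0]. *)
      set (eta := eps / (2 * L * L + 1)).
      assert (Hden : 0 < 2 * L * L + 1) by nra.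
      assert (Heta : 0 < eta) by (apply Rdiv_lt_0_compat; lra).
      assert (Eeta : eta * (2 * L * L + 1) = eps) by (unfold eta; field; lra).
      destruct (proj1 (is_Cderive_eps _ _ _) Hl eta Heta) as [del [Hdel Hest]].
      (* On a rectangle with both sides below [delta], [g] moves by at most [2 * delta * L], which
         is less than [del]. *)
      set (delta := del / (2 * L + 1)).
      assert (Hdelta : 0 < delta) by (apply Rdiv_lt_0_compat; lra).
      assert (Edelta : delta * (2 * L + 1) = del) by (unfold delta; field; lra).
      exists delta; split; [exact Hdelta |].
      intros a b c d Ha Hb Hc Hd Hxab Hycd Hba Hdc.
      assert (Herr : forall s t, a <= s <= b -> c <= t <= d -> forall k, Cmod k <= L ->
        Cmod (Cmult (Cminus (Cminus (phi (g s t)) (phi (g x y))) (Cmult l (Cminus (g s t) (g x y)))) k)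
        <= eta * L * L * ((b - a) + (d - c))).
      { intros s t Hs Ht k Hk.
        assert (Hlip := lip a b c d x s y t Ha Hb Hc Hd Hxab Hs Hycd Ht).
        rewrite Cmod_mult.
        apply Rle_trans with ((eta * (((b - a) + (d - c)) * L)) * L); [| right; ring].
        apply Rmult_le_compat; try apply Cmod_ge_0; [| exact Hk].
        eapply Rle_trans; [apply Hest; nra |].
        apply Rmult_le_compat_l; [lra | exact Hlip]. }
      set (M := eta * L * L * ((b - a) + (d - c))) in *.
      set (F := fun w => Cplus (Cmult (phi (g x y)) w)
                (Cmult (Cdiv l (RtoC 2)) (Cmult (Cminus w (g x y)) (Cminus w (g x y))))).
      assert (Hh : forall t, c <= t <= d ->
        Cmod (Cminus (I1 a b t) (Cminus (F (g b t)) (F (g a t)))) <= (b - a) * M).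
      { intros t Ht; apply (CInt_near_affine a b) with (c := fun s => g s t); try lra; intros s Hs.
        - apply Hg1; lra.
        - apply Hg1c; lra.
        - apply phi_cont; lra.
        - apply Herr; try lra; apply Hg1L; lra. }
      assert (Hv : forall s, a <= s <= b ->
        Cmod (Cminus (I2 c d s) (Cminus (F (g s d)) (F (g s c)))) <= (d - c) * M).
      { intros s Hs; apply (CInt_near_affine c d) with (c := g s); try lra; intros t Ht.
        - apply Hg2; lra.
        - apply Hg2c; lra.
        - apply phi_cont; lra.
        - apply Herr; try lra; apply Hg2L; lra. }
      (* The increments of the primitive [F] cancel at the four corners, so each side may be
         corrected by its own increment. *)
      assert (E : I a b c d =
        Cplus (Cminus (Cminus (I1 a b c) (Cminus (F (g b c)) (F (g a c))))
                      (Cminus (I1 a b d) (Cminus (F (g b d)) (F (g a d)))))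
              (Cminus (Cminus (I2 c d b) (Cminus (F (g b d)) (F (g b c))))
                      (Cminus (I2 c d a) (Cminus (F (g a d)) (F (g a c)))))) by (unfold I; ring).
      rewrite E.
      apply Rle_trans with (((b - a) * M + (b - a) * M) + ((d - c) * M + (d - c) * M)).
      { eapply Rle_trans; [apply Cmod_triangle |].
        apply Rplus_le_compat; (eapply Rle_trans; [apply Cmod_minus_le |]);
          apply Rplus_le_compat; [apply Hh | apply Hh | apply Hv | apply Hv]; lra. }
      replace ((b - a) * M + (b - a) * M + ((d - c) * M + (d - c) * M))
        with (2 * L * L * eta * (b - a + (d - c)) ^ 2) by (unfold M; ring).
      apply Rmult_le_compat_r; [apply pow2_ge_0 |]; nra. }
  apply Cmod_eq_0, Rle_antisym; [| apply Cmod_ge_0].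
  set (S := ((b0 - a0) + (d0 - c0)) ^ 2) in *.
  assert (HS : 0 <= S) by apply pow2_ge_0.
  apply Rnot_lt_le; intro Hpos.
  specialize (Hmain (Cmod (I a0 b0 c0 d0) / (2 * (S + 1))) ltac:(apply Rdiv_lt_0_compat; lra)).
  set (x := Cmod (I a0 b0 c0 d0)) in *.
  assert (x / (2 * (S + 1)) * S <= x / 2); [| lra].
  replace (x / 2) with (x / (2 * (S + 1)) * (S + 1)) by (field; lra).
  apply Rmult_le_compat_l; [| lra].
  left; apply Rdiv_lt_0_compat; lra.
Qed.

End Goursat.

(** * Cauchy's formula *)

Definition holo (g : C -> C) : Prop := forall z, inD z -> exists l, is_Cderive g z l.

Definition cis (t : R) : C := (cos t, sin t).

Lemma Cmod_cis (t : R) : Cmod (cis t) = 1.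
Proof.
  unfold Cmod, cis; simpl.
  replace (_ + _) with 1; [apply sqrt_1 |].
  generalize (sin2_cos2 t); unfold Rsqr; lra.
Qed.

Lemma cis_2PI : cis (2 * PI) = cis 0.
Proof. unfold cis; rewrite cos_2PI, sin_2PI, cos_0, sin_0; reflexivity. Qed.

Lemma cis_derive (t : R) : is_path_derive cis t (Cmult Ci (cis t)).
Proof.
  split; simpl.
  - auto_derive; [trivial | ring].
  - auto_derive; [trivial | ring].
Qed.

Lemma cis_continuous (t : R) : continuous cis t.
Proof. eapply is_path_derive_continuous, cis_derive. Qed.

Lemma cis_neq_0 (t : R) : cis t <> RtoC 0.
Proof. apply Cmod_gt_0; rewrite Cmod_cis; lra. Qed.

Ltac Ccont :=
  repeat match goal with
  | |- continuous (fun _ => ?k) _ => apply continuous_const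
  | |- continuous (fun x => Cmult (@?f x) (@?g x)) _ => apply (continuous_Cmult f g)
  | |- continuous (fun x => Cplus (@?f x) (@?g x)) _ => apply (continuous_Cplus f g)
  | |- continuous cis _ => apply cis_continuous
  | |- continuous (fun x => cis x) _ => apply cis_continuous
  end.

Lemma locally_Cmod_lt (z : C) (r : R) : Cmod z < r -> locally z (fun w => Cmod w < r).
Proof.
  intro H.
  assert (Hc : continuous (fun w : C => Cmod w) z) by (apply continuous_Cmod, continuous_id).
  assert (Hp : 0 < r - Cmod z) by lra.
  apply (Hc (fun x => x < r)); exists (mkposreal _ Hp); intros y Hy.
  change (Rabs (y - Cmod z) < r - Cmod z) in Hy; apply Rabs_def2 in Hy; lra.
Qed.

Lemma is_Cderive_ext_loc (f g : C -> C) (z l : C) :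
  locally z (fun w => f w = g w) -> is_Cderive f z l -> is_Cderive g z l.
Proof.
  intros Hfg [Q [H1 H2]]; exists Q; split; [| exact H2].
  assert (E : f z = g z) by exact (locally_singleton z _ Hfg).
  generalize (filter_and _ _ Hfg H1); apply filter_imp; intros w [Hw1 Hw2].
  rewrite <- Hw1, <- E; exact Hw2.
Qed.

Lemma CInt_const (k : C) (a b : R) : a <= b -> CInt (fun _ => k) a b = Cmult (RtoC (b - a)) k.
Proof.
  intro Hab; apply CInt_unique; try exact Hab.
  replace (Cmult (RtoC (b - a)) k) with (@scal R_AbsRing C_R_NormedModule (b - a) k).
  - apply is_RInt_const.
  - destruct k as [k1 k2]; apply injective_projections; simpl;
      unfold scal; simpl; unfold mult; simpl; ring.
Qed.

(** Goursat on a homotopy from the circle of radius [rho] about [z] to the circle of radius [r]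
    about the origin moves the integral to the small circle, where the kernel cancels the radius and
    leaves [i g (z + rho e^(it))]. Continuity of [g] at [z] finishes as [rho] tends to 0. *)
Lemma cauchy_formula (g : C -> C) (z : C) (r : R) :
  holo g -> Cmod z < r -> r < 1 ->
  Cmult (Cmult (RtoC (2 * PI)) Ci) (g z) =
  CInt (fun t => Cmult (Cmult (g (Cmult (RtoC r) (cis t))) (Cinv (Cminus (Cmult (RtoC r) (cis t)) z)))
                       (Cmult (RtoC r) (Cmult Ci (cis t)))) 0 (2 * PI).
Proof.
  intros Hg Hz Hr.
  assert (Hpi := PI_RGT_0).
  assert (Hz0 := Cmod_ge_0 z).
  set (J := CInt _ _ _).
  assert (Hhom : forall rho, 0 < rho -> Cmod z + rho < r ->
    J = CInt (fun t => Cmult Ci (g (Cplus z (Cmult (RtoC rho) (cis t))))) 0 (2 * PI)).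
  { intros rho Hrho Hzr.
    set (m := fun s => (1 - s) * rho + s * r).
    (* Interpolating centre and radius together keeps [z] strictly inside every intermediate circle:
       the distance from [z] is at least [m s - s |z| = (1 - s) rho + s (r - |z|) > 0]. *)
    set (ga := fun s t => Cplus (Cmult (RtoC (1 - s)) z) (Cmult (RtoC (m s)) (cis t))).
    set (ga1 := fun (s : R) t => Cminus (Cmult (RtoC (r - rho)) (cis t)) z).
    set (ga2 := fun s t => Cmult (RtoC (m s)) (Cmult Ci (cis t))).
    assert (Hm : forall s, 0 <= s <= 1 -> rho <= m s <= r).
    { intros s Hs; unfold m; nra. }
    assert (Hgain : forall s t, 0 <= s <= 1 -> inD (ga s t)).
    { intros s t Hs; unfold inD, ga.
      eapply Rle_lt_trans; [apply Cmod_triangle |].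
      rewrite !Cmod_mult, !Cmod_R, Cmod_cis, !Rabs_pos_eq; [| specialize (Hm s Hs); lra | lra].
      unfold m; nra. }
    assert (Hganz : forall s t, 0 <= s <= 1 -> Cminus (ga s t) z <> RtoC 0).
    { intros s t Hs; apply Cmod_gt_0.
      assert (E : Cmult (RtoC (m s)) (cis t) = Cplus (Cminus (ga s t) z) (Cmult (RtoC s) z)).
      { unfold ga; rewrite RtoC_minus; ring. }
      assert (H := Cmod_triangle (Cminus (ga s t) z) (Cmult (RtoC s) z)).
      rewrite <- E, !Cmod_mult, !Cmod_R, Cmod_cis, !Rabs_pos_eq in H; [| lra | specialize (Hm s Hs); lra].
      assert (s * Cmod z < m s); [| lra].
      unfold m; nra. }
    assert (G := goursat (fun w => Cmult (g w) (Cinv (Cminus w z))) ga ga1 ga2 2 0 1 0 (2 * PI)).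
    cbv beta zeta in G.
    match type of G with ?A -> ?B -> _ => assert (GA : A) by lra; assert (GB : B) by lra; specialize (G GA GB) end.
    assert (G' := fun h1 h2 h3 h4 h5 h6 => G h1 h2 h3 h4 h5 h6); clear G.
    (* The sides [t = 0] and [t = 2 * PI] are the same curve, so they cancel and Goursat's identity
       compares the two circles. *)
    assert (I0 : CInt (fun s => Cmult (Cmult (g (ga s 0)) (Cinv (Cminus (ga s 0) z))) (ga1 s 0)) 0 1 =
                 CInt (fun s => Cmult (Cmult (g (ga s (2 * PI))) (Cinv (Cminus (ga s (2 * PI)) z))) (ga1 s (2 * PI))) 0 1).
    { unfold ga, ga1; rewrite cis_2PI; reflexivity. }
    assert (G : CInt (fun t => Cmult (Cmult (g (ga 1 t)) (Cinv (Cminus (ga 1 t) z))) (ga2 1 t)) 0 (2 * PI) =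
                CInt (fun t => Cmult (Cmult (g (ga 0 t)) (Cinv (Cminus (ga 0 t) z))) (ga2 0 t)) 0 (2 * PI)).
    { rewrite I0 in G'.
      match type of G' with _ -> _ -> _ -> _ -> _ -> _ -> _ -> Cminus (Cplus ?x ?y) (Cplus ?x ?w) = _ =>
        assert (K : Cminus (Cplus x y) (Cplus x w) = RtoC 0 -> y = w)
          by (intro K; rewrite <- (Cplus_0_r w), <- K; ring) end.
      apply K, G'; clear K G' I0.
      - intros s t Hs Ht; unfold ga, ga1, m, cis; split; simpl; auto_derive; trivial; ring.
      - intros s t Hs Ht; unfold ga, ga2, cis; split; simpl; auto_derive; trivial; ring.
      - intros s t Hs Ht; unfold ga1; apply continuous_const.
      - intros s t Hs Ht; unfold ga2; Ccont.
      - intros s t Hs Ht; unfold ga1; eapply Rle_trans; [apply Cmod_minus_le |].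
        rewrite Cmod_mult, Cmod_R, Cmod_cis, Rabs_pos_eq by lra; lra.
      - intros s t Hs Ht; unfold ga2.
        rewrite !Cmod_mult, Cmod_R, Cmod_cis, Cmod_Ci, Rabs_pos_eq by (specialize (Hm s Hs); lra).
        specialize (Hm s Hs); lra.
      - intros s t Hs Ht.
        destruct (Hg (ga s t) (Hgain s t Hs)) as [l Hl].
        eexists; apply is_Cderive_mult; [exact Hl |].
        apply is_Cderive_inv; [| apply Hganz, Hs].
        apply (is_Cderive_plus (fun w => w) (fun _ => Copp z));
          [apply is_Cderive_id | apply is_Cderive_const]. }
    transitivity (CInt (fun t => Cmult (Cmult (g (ga 1 t)) (Cinv (Cminus (ga 1 t) z))) (ga2 1 t)) 0 (2 * PI)).
    - apply CInt_ext; [lra |]; intros t Ht; unfold ga2, ga.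
      replace (m 1) with r by (unfold m; ring).
      replace (Cplus (Cmult (RtoC (1 - 1)) z) (Cmult (RtoC r) (cis t))) with (Cmult (RtoC r) (cis t));
        [reflexivity |].
      replace (1 - 1) with 0 by ring; ring.
    - rewrite G; apply CInt_ext; [lra |]; intros t Ht.
      assert (E : ga 0 t = Cplus z (Cmult (RtoC rho) (cis t))).
      { unfold ga, m; replace (1 - 0) with 1 by ring; replace (1 * rho + 0 * r) with rho by ring; ring. }
      specialize (Hganz 0 t ltac:(lra)); rewrite E in *.
      replace (Cminus (Cplus z (Cmult (RtoC rho) (cis t))) z) with (Cmult (RtoC rho) (cis t)) in * by ring.
      unfold ga2, m; replace ((1 - 0) * rho + 0 * r) with rho by ring.
      field; split; [apply cis_neq_0 |].
      intro E'; apply RtoC_inj in E'; lra. }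
  destruct (Hg z ltac:(unfold inD; lra)) as [l Hl].
  assert (Hc := proj1 (continuous_epsC g z) (is_Cderive_continuous _ _ _ Hl)).
  assert (Hsmall : forall eps, 0 < eps ->
    Cmod (Cminus J (Cmult (Cmult (RtoC (2 * PI)) Ci) (g z))) <= 2 * PI * eps).
  { intros eps He; destruct (Hc eps He) as [d [Hd1 Hd2]].
    set (rho := Rmin d (r - Cmod z) / 2).
    assert (H1 := Rmin_l d (r - Cmod z)); assert (H2 := Rmin_r d (r - Cmod z)).
    assert (H3 : 0 < Rmin d (r - Cmod z)) by (apply Rmin_pos; lra).
    rewrite (Hhom rho) by (unfold rho; lra).
    assert (Hcont : forall t, 0 <= t <= 2 * PI ->
      continuous (fun t => Cmult Ci (g (Cplus z (Cmult (RtoC rho) (cis t))))) t).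
    { intros t Ht; apply continuous_Cmult; [apply continuous_const |].
      apply (continuous_comp (fun t => Cplus z (Cmult (RtoC rho) (cis t))) g).
      - apply continuous_Cplus; [apply continuous_const |].
        apply continuous_Cmult; [apply continuous_const | apply cis_continuous].
      - destruct (Hg (Cplus z (Cmult (RtoC rho) (cis t)))) as [l' Hl'].
        + unfold inD; eapply Rle_lt_trans; [apply Cmod_triangle |].
          rewrite Cmod_mult, Cmod_R, Cmod_cis, Rabs_pos_eq; unfold rho; lra.
        + eapply is_Cderive_continuous, Hl'. }
    replace (Cmult (Cmult (RtoC (2 * PI)) Ci) (g z)) with (CInt (fun _ => Cmult Ci (g z)) 0 (2 * PI)).
    2: { rewrite CInt_const by lra; rewrite Rminus_0_r; ring. }
    rewrite <- CInt_minus; [| lra | exact Hcont | intros; apply continuous_const].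
    replace (2 * PI * eps) with ((2 * PI - 0) * eps) by ring.
    apply CInt_bound; [lra | |].
    - intros t Ht; apply continuous_Cplus; [apply Hcont, Ht | apply continuous_const].
    - intros t Ht.
      replace (Cminus _ _) with (Cmult Ci (Cminus (g (Cplus z (Cmult (RtoC rho) (cis t)))) (g z))) by ring.
      rewrite Cmod_mult, Cmod_Ci, Rmult_1_l; left; apply Hd2.
      replace (Cminus _ _) with (Cmult (RtoC rho) (cis t)) by ring.
      rewrite Cmod_mult, Cmod_R, Cmod_cis, Rabs_pos_eq; unfold rho; lra. }
  assert (E0 : Cmod (Cminus J (Cmult (Cmult (RtoC (2 * PI)) Ci) (g z))) = 0).
  { apply Rle_antisym; [| apply Cmod_ge_0].
    apply Rnot_lt_le; intro Hp; set (x := Cmod (Cminus J (Cmult (Cmult (RtoC (2 * PI)) Ci) (g z)))) in *.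
    specialize (Hsmall (x / (4 * PI)) ltac:(apply Rdiv_lt_0_compat; lra)).
    replace (2 * PI * (x / (4 * PI))) with (x / 2) in Hsmall by (field; lra); lra. }
  apply Cmod_eq_0 in E0.
  rewrite <- (Cplus_0_r (Cmult _ _)), <- E0; ring.
Qed.

(** A second-order remainder that is uniform in [t] integrates to at most [(b - a) M |w - z|^2],
    which is below [eps |w - z|] close to [z]. *)
Lemma CInt_param_derive (k : R -> C -> C) (k' : R -> C) (a b : R) (z : C) (M del : R) :
  a <= b -> 0 <= M -> 0 < del ->
  (forall w t, Cmod (Cminus w z) < del -> a <= t <= b -> continuous (fun x => k x w) t) ->
  (forall t, a <= t <= b -> continuous k' t) ->
  (forall w t, Cmod (Cminus w z) < del -> a <= t <= b ->
     Cmod (Cminus (Cminus (k t w) (k t z)) (Cmult (Cminus w z) (k' t))) <= M * Cmod (Cminus w z) ^ 2) ->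
  is_Cderive (fun w => CInt (fun t => k t w) a b) z (CInt k' a b).
Proof.
  intros Hab HM Hdel Hk Hk' Hest.
  apply is_Cderive_eps; intros eps He.
  assert (Hden : 0 < M * (b - a) + 1) by nra.
  set (d := eps / (M * (b - a) + 1)).
  assert (Hd : 0 < d) by (apply Rdiv_lt_0_compat; lra).
  assert (Ed : d * (M * (b - a) + 1) = eps) by (unfold d; field; lra).
  exists (Rmin del d); split; [apply Rmin_pos; assumption |].
  intros w Hw.
  assert (Hw1 := Rlt_le_trans _ _ _ Hw (Rmin_l _ _)).
  assert (Hw2 := Rlt_le_trans _ _ _ Hw (Rmin_r _ _)).
  assert (Hz : Cmod (Cminus z z) < del) by (unfold Cminus; rewrite Cplus_opp_r, Cmod_0; exact Hdel).
  assert (Kw : forall t, a <= t <= b -> continuous (fun x => k x w) t) by (intros; apply Hk; assumption).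
  assert (Kz : forall t, a <= t <= b -> continuous (fun x => k x z) t) by (intros; apply Hk; assumption).
  assert (Kd : forall t, a <= t <= b -> continuous (fun x => Cmult (Cminus w z) (k' x)) t).
  { intros t Ht; apply continuous_Cmult; [apply continuous_const | apply Hk', Ht]. }
  assert (Km : forall t, a <= t <= b -> continuous (fun x => Cminus (k x w) (k x z)) t).
  { intros t Ht; apply continuous_Cplus; [| apply continuous_Copp]; auto. }
  rewrite (Cmult_comm (CInt k' a b)).
  rewrite <- CInt_minus, <- CInt_scal, <- CInt_minus by assumption.
  eapply Rle_trans.
  { apply CInt_bound with (M := M * Cmod (Cminus w z) ^ 2); [exact Hab | |].
    - intros t Ht; apply continuous_Cplus; [| apply continuous_Copp]; auto.
    - intros t Ht; apply Hest; assumption. }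
  assert (H0 := Cmod_ge_0 (Cminus w z)); set (x := Cmod (Cminus w z)) in *.
  replace ((b - a) * (M * x ^ 2)) with (((M * (b - a)) * x) * x) by ring.
  apply Rmult_le_compat_r; [exact H0 |].
  assert (0 <= M * (b - a)) by nra; nra.
Qed.

(** On a disc about the origin containing [z], Cauchy's formula gives [g = k T1] with an explicit
    kernel. Two differentiations under the integral, [T1' = T2] and [T2' = T3], show that
    [g' = k T2] is itself differentiable. Iterating this yields the continuous second derivatives
    used for the Laplacian. *)
Lemma holo_deriv (g : C -> C) : holo g ->
  exists g1, (forall z, inD z -> is_Cderive g z (g1 z)) /\ holo g1.
Proof.
  intro Hg.
  assert (Hpi := PI_RGT_0).
  set (g1 := fun z => epsilon (inhabits (RtoC 0)) (fun l => is_Cderive g z l)).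
  assert (Hg1 : forall z, inD z -> is_Cderive g z (g1 z)).
  { intros z Hz; apply epsilon_spec, Hg, Hz. }
  exists g1; split; [exact Hg1 |].
  intros z Hz.
  set (r := (1 + Cmod z) / 2).
  unfold inD in Hz; assert (Hz0 := Cmod_ge_0 z).
  set (ze := fun t => Cmult (RtoC r) (cis t)).
  assert (Hze : forall t, Cmod (ze t) = r).
  { intro t; unfold ze; rewrite Cmod_mult, Cmod_R, Cmod_cis, Rabs_pos_eq; unfold r; lra. }
  set (u := fun t => Cmult (g (ze t)) (Cmult (RtoC r) (Cmult Ci (cis t)))).
  assert (Hzec : forall t, continuous ze t).
  { intro t; apply continuous_Cmult; [apply continuous_const | apply cis_continuous]. }
  assert (Huc : forall t, continuous u t).
  { intro t; apply continuous_Cmult.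
    - apply (continuous_comp ze g); [apply Hzec |].
      destruct (Hg (ze t)) as [l Hl]; [unfold inD; rewrite Hze; unfold r; lra |].
      eapply is_Cderive_continuous, Hl.
    - Ccont. }
  destruct (continuity_ab_maj (fun t => Cmod (u t)) 0 (2 * PI)) as [tm [Htm _]]; [lra | |].
  { intros t Ht; apply continuity_pt_filterlim, continuous_Cmod, Huc. }
  set (M := Cmod (u tm)) in *.
  assert (HM0 : 0 <= M) by apply Cmod_ge_0.
  (* A disc about [w] whose radius is half its distance to the circle stays that far from the
     circle; this bounds every kernel denominator below. *)
  assert (Hfar : forall t w v, Cmod w < r -> Cmod (Cminus v w) < (r - Cmod w) / 2 ->
     (r - Cmod w) / 2 <= Cmod (Cminus (ze t) v)).
  { intros t w v Hw Hv.
    assert (H := Cmod_triangle (Cminus (ze t) v) (Cplus (Cminus v w) w)).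
    replace (Cplus (Cminus (ze t) v) (Cplus (Cminus v w) w)) with (ze t) in H by ring.
    rewrite Hze in H; assert (H' := Cmod_triangle (Cminus v w) w); lra. }
  assert (Hfar0 : forall t w, Cmod w < r -> (r - Cmod w) / 2 <= Cmod (Cminus (ze t) w)).
  { intros t w Hw; apply (Hfar t w w); [exact Hw |].
    unfold Cminus; rewrite Cplus_opp_r, Cmod_0; lra. }
  assert (Hne : forall t w, Cmod w < r -> Cminus (ze t) w <> RtoC 0).
  { intros t w Hw; apply Cmod_gt_0; specialize (Hfar0 t w Hw); lra. }
  assert (Hdc : forall w t, continuous (fun x => Cminus (ze x) w) t).
  { intros w t; apply continuous_Cplus; [apply Hzec | apply continuous_const]. }
  assert (Hcl : forall w v, Cmod w < r -> Cmod (Cminus v w) < (r - Cmod w) / 2 -> Cmod v < r).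
  { intros w v Hw Hv; assert (H := Cmod_triangle (Cminus v w) w).
    replace (Cplus (Cminus v w) w) with v in H by ring; lra. }
  set (iv := fun t w => Cinv (Cminus (ze t) w)).
  assert (Hivc : forall w t, Cmod w < r -> continuous (fun x => iv x w) t).
  { intros w t Hw; apply continuous_Cinv; [apply Hdc | apply Hne, Hw]. }
  assert (Hivm : forall t w eta, Cmod w < r -> 0 < eta -> eta <= Cmod (Cminus (ze t) w) ->
            Cmod (iv t w) <= / eta).
  { intros t w eta Hw He Hle; unfold iv; rewrite Cmod_inv by (apply Hne, Hw).
    apply Rinv_le_contravar; assumption. }
  set (T1 := fun w => CInt (fun t => Cmult (u t) (iv t w)) 0 (2 * PI)).
  set (T2 := fun w => CInt (fun t => Cmult (u t) (Cmult (iv t w) (iv t w))) 0 (2 * PI)).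
  set (T3 := fun w => CInt (fun t => Cmult (u t) (Cmult (RtoC 2) (Cmult (iv t w) (Cmult (iv t w) (iv t w))))) 0 (2 * PI)).
  assert (HT1 : forall w, Cmod w < r -> is_Cderive T1 w (T2 w)).
  { intros w Hw; set (eta := (r - Cmod w) / 2).
    assert (Heta : 0 < eta) by (unfold eta; lra).
    assert (Hie := Rinv_0_lt_compat _ Heta).
    apply (CInt_param_derive (fun t w => Cmult (u t) (iv t w)) (fun t => Cmult (u t) (Cmult (iv t w) (iv t w)))
             0 (2 * PI) w (M * (/ eta * (/ eta * / eta))) eta); [lra | | exact Heta | | |].
    - repeat apply Rmult_le_pos; lra.
    - intros v t Hv Ht; apply continuous_Cmult; [apply Huc | apply Hivc, (Hcl w); assumption].
    - intros t Ht; Ccont; lazymatch goal with |- continuous (fun x => iv x _) _ => apply Hivc, Hw | _ => apply Huc end.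
    - intros v t Hv Ht.
      assert (Hv' := Hcl w v Hw Hv).
      assert (N1 := Hne t w Hw); assert (N2 := Hne t v Hv').
      (* With [D = ze t - w] and [e = v - w]: [1/(D - e) - 1/D - e/D^2 = e^2 / ((D - e) D^2)]. *)
      replace (Cminus _ _) with
        (Cmult (Cmult (u t) (Cmult (iv t v) (Cmult (iv t w) (iv t w)))) (Cmult (Cminus v w) (Cminus v w)))
        by (unfold iv; field; split; assumption).
      assert (B1 := Hivm t w eta Hw Heta (Hfar0 t w Hw)).
      assert (B2 := Hivm t v eta Hv' Heta (Hfar t w v Hw Hv)).
      rewrite !Cmod_mult; simpl; rewrite Rmult_1_r.
      apply Rmult_le_compat_r; [apply Rmult_le_pos; apply Cmod_ge_0 |].
      repeat apply Rmult_le_compat; repeat apply Rmult_le_pos; try apply Cmod_ge_0; try assumption.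
      apply Htm, Ht. }
  assert (HT2 : forall w, Cmod w < r -> is_Cderive T2 w (T3 w)).
  { intros w Hw; set (eta := (r - Cmod w) / 2).
    assert (Heta : 0 < eta) by (unfold eta; lra).
    assert (Hie := Rinv_0_lt_compat _ Heta).
    apply (CInt_param_derive (fun t w => Cmult (u t) (Cmult (iv t w) (iv t w)))
             (fun t => Cmult (u t) (Cmult (RtoC 2) (Cmult (iv t w) (Cmult (iv t w) (iv t w)))))
             0 (2 * PI) w (M * (10 * (/ eta * (/ eta * (/ eta * (/ eta * / eta)))))) eta);
      [lra | | exact Heta | | |].
    - repeat apply Rmult_le_pos; lra.
    - intros v t Hv Ht; Ccont;
        lazymatch goal with |- continuous (fun x => iv x _) _ => apply Hivc, (Hcl w); assumption | _ => apply Huc end.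
    - intros t Ht; Ccont; lazymatch goal with |- continuous (fun x => iv x _) _ => apply Hivc, Hw | _ => apply Huc end.
    - intros v t Hv Ht.
      assert (Hv' := Hcl w v Hw Hv).
      assert (N1 := Hne t w Hw); assert (N2 := Hne t v Hv').
      (* With the same [D] and [e]: [1/(D - e)^2 - 1/D^2 - 2 e/D^3 = e^2 (3 D - 2 e) / ((D - e)^2
         D^3)], and [q] is [3 D - 2 e], crudely bounded by 10 inside the unit disc. *)
      set (q := Cminus (Cmult (RtoC 3) (Cminus (ze t) w)) (Cmult (RtoC 2) (Cminus v w))).
      replace (Cminus _ _) with
        (Cmult (Cmult (u t) (Cmult q (Cmult (iv t v) (Cmult (iv t v) (Cmult (iv t w) (Cmult (iv t w) (iv t w)))))))
           (Cmult (Cminus v w) (Cminus v w)))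
        by (unfold iv, q; field; split; assumption).
      assert (B1 := Hivm t w eta Hw Heta (Hfar0 t w Hw)).
      assert (B2 := Hivm t v eta Hv' Heta (Hfar t w v Hw Hv)).
      assert (B3 : Cmod q <= 10).
      { unfold q; eapply Rle_trans; [apply Cmod_minus_le |].
        rewrite !Cmod_mult, !Cmod_R, !Rabs_pos_eq by lra.
        assert (K := Cmod_minus_le (ze t) w); rewrite Hze in K.
        assert (K' := Cmod_ge_0 w).
        unfold eta, r in *; lra. }
      rewrite !Cmod_mult; simpl; rewrite Rmult_1_r.
      apply Rmult_le_compat_r; [apply Rmult_le_pos; apply Cmod_ge_0 |].
      repeat apply Rmult_le_compat; repeat apply Rmult_le_pos; try apply Cmod_ge_0; try assumption.
      apply Htm, Ht. }
  set (k := Cinv (Cmult (RtoC (2 * PI)) Ci)).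
  assert (Hk : Cmult (RtoC (2 * PI)) Ci <> RtoC 0).
  { apply Cmod_gt_0; rewrite Cmod_mult, Cmod_R, Cmod_Ci, Rabs_pos_eq; lra. }
  assert (HgT : forall w, Cmod w < r -> g w = Cmult k (T1 w)).
  { intros w Hw.
    transitivity (Cmult k (Cmult (Cmult (RtoC (2 * PI)) Ci) (g w))).
    { unfold k; rewrite Cmult_assoc, Cinv_l by exact Hk; ring. }
    f_equal; rewrite (cauchy_formula g w r Hg Hw) by (unfold r; lra).
    apply CInt_ext; [lra |]; intros t Ht; unfold u, iv, ze; ring. }
  assert (Hscal : forall T w l, is_Cderive T w l -> is_Cderive (fun v => Cmult k (T v)) w (Cmult k l)).
  { intros T w l HT.
    assert (H := is_Cderive_mult _ _ _ _ _ (is_Cderive_const k w) HT).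
    replace (Cmult k l) with (Cplus (Cmult (RtoC 0) (T w)) (Cmult k l)) by ring; exact H. }
  assert (Hg1T : forall w, Cmod w < r -> g1 w = Cmult k (T2 w)).
  { intros w Hw; apply is_Cderive_unique with g w.
    - apply Hg1; unfold inD, r in *; lra.
    - apply is_Cderive_ext_loc with (fun v => Cmult k (T1 v)); [| apply Hscal, HT1, Hw].
      generalize (locally_Cmod_lt w r Hw); apply filter_imp; intros v Hv; symmetry; apply HgT, Hv. }
  assert (Hzr : Cmod z < r) by (unfold r; lra).
  exists (Cmult k (T3 z)).
  apply is_Cderive_ext_loc with (fun v => Cmult k (T2 v)); [| apply Hscal, HT2, Hzr].
  generalize (locally_Cmod_lt z r Hzr); apply filter_imp; intros v Hv; symmetry; apply Hg1T, Hv.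
Qed.

(** * Null sets and the dilatation inequality *)

(** Length of the intersection of two intervals, 0 when they are disjoint. It is additive under
    splitting of the first interval, so covered area is additive under bisection. *)
Definition overlap (a b A B : R) : R := Rmax 0 (Rmin b B - Rmax a A).

Lemma overlap_pos (a b A B : R) : 0 <= overlap a b A B.
Proof. apply Rmax_l. Qed.

Lemma overlap_le (a b A B : R) : A <= B -> overlap a b A B <= B - A.
Proof. unfold overlap, Rmax, Rmin; repeat destruct Rle_dec; lra. Qed.

Lemma overlap_split (a m b A B : R) : a <= m <= b -> A <= B ->
  overlap a b A B = overlap a m A B + overlap m b A B.
Proof. unfold overlap, Rmax, Rmin; repeat destruct Rle_dec; lra. Qed.

Lemma overlap_inside (a b A B : R) : A <= a <= b -> b <= B -> overlap a b A B = b - a.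
Proof. unfold overlap, Rmax, Rmin; repeat destruct Rle_dec; lra. Qed.

Lemma sum_f_R0_incr (u : nat -> R) (n m : nat) :
  (forall k, 0 <= u k) -> (n <= m)%nat -> sum_f_R0 u n <= sum_f_R0 u m.
Proof.
  intros Hu Hnm; induction Hnm as [| m Hnm IH]; [lra |].
  simpl; specialize (Hu (S m)); lra.
Qed.

Lemma sum_f_R0_pos (u : nat -> R) (n : nat) : (forall k, 0 <= u k) -> 0 <= sum_f_R0 u n.
Proof. intros Hu; apply Rle_trans with (sum_f_R0 u 0); [apply Hu | apply sum_f_R0_incr; [exact Hu | lia]]. Qed.

(** The closed boxes of a cover are enlarged slightly, with summable growth in area; open boxes are
    what a covering argument needs. *)
Lemma null_set_open_cover (N : C -> Prop) (eps : R) : null_set N -> 0 < eps ->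
  exists a b c d : nat -> R,
    (forall n, a n <= b n /\ c n <= d n) /\
    (forall z, N z -> exists n, a n < fst z < b n /\ c n < snd z < d n) /\
    (forall n, sum_f_R0 (fun k => (b k - a k) * (d k - c k)) n < eps).
Proof.
  intros HN He.
  set (e := Rmin 1 (eps / 2)).
  assert (He1 : e <= 1) by apply Rmin_l.
  assert (He2 : e <= eps / 2) by apply Rmin_r.
  assert (He0 : 0 < e) by (apply Rmin_pos; lra).
  destruct (HN e He0) as [a [b [c [d [H1 [H2 H3]]]]]].
  (* Enlarging box [n] by [de n <= 1] on each side adds at most [de n * W n = e / 2^(n+2)] to its
     area; the increments sum to less than [e / 2], and [e + e / 2 < eps]. *)
  set (W := fun n => 2 * ((b n - a n) + (d n - c n)) + 4).
  assert (HW : forall n, 4 <= W n) by (intro n; unfold W; generalize (H1 n); lra).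
  set (de := fun n => e * (/ 2) ^ (n + 2) / W n).
  assert (Hp : forall n, 0 < (/ 2) ^ n <= 1).
  { induction n as [| n IH]; simpl; lra. }
  assert (Hde : forall n, 0 < de n).
  { intro n; apply Rdiv_lt_0_compat; [| specialize (HW n); lra].
    apply Rmult_lt_0_compat; [exact He0 | apply Hp]. }
  assert (EdeW : forall n, de n * W n = e * (/ 2) ^ (n + 2)).
  { intro n; unfold de; field; specialize (HW n); lra. }
  assert (Hde1 : forall n, de n <= 1).
  { intro n; specialize (EdeW n); specialize (Hp (n + 2)%nat); specialize (HW n); specialize (Hde n); nra. }
  exists (fun n => a n - de n), (fun n => b n + de n), (fun n => c n - de n), (fun n => d n + de n).
  split; [| split].
  - intro n; specialize (H1 n); specialize (Hde n); lra.
  - intros z Hz; destruct (H2 z Hz) as [n Hn]; exists n; specialize (Hde n); lra.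
  - assert (Hsum : forall n,
      sum_f_R0 (fun k => (b k + de k - (a k - de k)) * (d k + de k - (c k - de k))) n <=
      sum_f_R0 (fun k => (b k - a k) * (d k - c k)) n + e * (/ 2 - (/ 2) ^ (n + 2))).
    { assert (Hk : forall k, (b k + de k - (a k - de k)) * (d k + de k - (c k - de k)) <=
                (b k - a k) * (d k - c k) + e * (/ 2) ^ (k + 2)).
      { intro k; rewrite <- EdeW; unfold W; specialize (Hde k); specialize (Hde1 k).
        assert (de k * de k <= de k * 1) by (apply Rmult_le_compat_l; lra); lra. }
      induction n as [| n IH].
      - simpl sum_f_R0; specialize (Hk 0%nat); simpl in Hk |- *; lra.
      - simpl sum_f_R0; specialize (Hk (S n)); simpl in Hk |- *.
        replace (e * (/ 2 - / 2 * (/ 2) ^ (n + 2))) with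
          (e * (/ 2 - (/ 2) ^ (n + 2)) + e * (/ 2 * (/ 2) ^ (n + 2))) by field.
        lra. }
    intro n; specialize (Hsum n); specialize (H3 n); specialize (Hp (n + 2)%nat); nra.
Qed.

(** A rectangle inside a null set would be covered by open boxes of total area at most half its own.
    Bisection plays the part of Heine-Borel: finitely many boxes already account for the full
    area. *)
Lemma null_set_not_rect (N : C -> Prop) (a0 b0 c0 d0 : R) :
  null_set N -> a0 < b0 -> c0 < d0 ->
  exists z, a0 <= fst z <= b0 /\ c0 <= snd z <= d0 /\ ~ N z.
Proof.
  intros HN Hab Hcd; apply NNPP; intro Hcon.
  assert (Hall : forall x y, a0 <= x <= b0 -> c0 <= y <= d0 -> N (x, y)).
  { intros x y Hx Hy; apply NNPP; intro Hn; apply Hcon; exists (x, y); auto. }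
  assert (Har : 0 < (b0 - a0) * (d0 - c0) / 2) by nra.
  destruct (null_set_open_cover N _ HN Har) as [A [B [C0 [D [H1 [H2 H3]]]]]].
  set (u := fun a b c d k => overlap a b (A k) (B k) * overlap c d (C0 k) (D k)).
  assert (Hu : forall a b c d k, 0 <= u a b c d k).
  { intros; apply Rmult_le_pos; apply overlap_pos. }
  assert (HP : exists n, (b0 - a0) * (d0 - c0) <= sum_f_R0 (u a0 b0 c0 d0) n).
  { apply (rect_bisection (fun a b c d => exists n, (b - a) * (d - c) <= sum_f_R0 (u a b c d) n)); try lra.
    - intros a b c d _ Hab' _ _ Hcd' _ [n1 K1] [n2 K2] [n3 K3] [n4 K4].
      set (m := (a + b) / 2) in *; set (k := (c + d) / 2) in *.
      set (n := (n1 + n2 + n3 + n4)%nat); exists n.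
      assert (L1 := sum_f_R0_incr (u a m c k) n1 n (Hu _ _ _ _) ltac:(unfold n; lia)).
      assert (L2 := sum_f_R0_incr (u m b c k) n2 n (Hu _ _ _ _) ltac:(unfold n; lia)).
      assert (L3 := sum_f_R0_incr (u a m k d) n3 n (Hu _ _ _ _) ltac:(unfold n; lia)).
      assert (L4 := sum_f_R0_incr (u m b k d) n4 n (Hu _ _ _ _) ltac:(unfold n; lia)).
      assert (E : sum_f_R0 (u a b c d) n = sum_f_R0 (u a m c k) n + sum_f_R0 (u m b c k) n +
                   sum_f_R0 (u a m k d) n + sum_f_R0 (u m b k d) n).
      { rewrite <- !sum_plus; apply sum_eq; intros i _; unfold u.
        destruct (H1 i) as [HA HC].
        rewrite (overlap_split a m b) by (unfold m; lra || exact HA).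
        rewrite (overlap_split c k d) by (unfold k; lra || exact HC); ring. }
      rewrite E; unfold m, k in *; lra.
    - intros x y Hx Hy; destruct (H2 (x, y) (Hall x y Hx Hy)) as [n [Hn1 Hn2]]; simpl in Hn1, Hn2.
      set (del := Rmin (Rmin (x - A n) (B n - x)) (Rmin (y - C0 n) (D n - y))).
      assert (Hd1 : del <= x - A n) by (eapply Rle_trans; [apply Rmin_l | apply Rmin_l]).
      assert (Hd2 : del <= B n - x) by (eapply Rle_trans; [apply Rmin_l | apply Rmin_r]).
      assert (Hd3 : del <= y - C0 n) by (eapply Rle_trans; [apply Rmin_r | apply Rmin_l]).
      assert (Hd4 : del <= D n - y) by (eapply Rle_trans; [apply Rmin_r | apply Rmin_r]).
      exists del; split; [repeat apply Rmin_pos; lra |].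
      intros a b c d _ _ _ _ Hxab Hycd Hba Hdc; exists n.
      apply Rle_trans with (u a b c d n).
      + unfold u; rewrite !overlap_inside by lra; lra.
      + destruct n as [| n]; [simpl; lra |].
        simpl; generalize (sum_f_R0_pos (u a b c d) n (Hu a b c d)); lra. }
  destruct HP as [n Hn]; specialize (H3 n).
  assert (sum_f_R0 (u a0 b0 c0 d0) n <= sum_f_R0 (fun k => (B k - A k) * (D k - C0 k)) n); [| lra].
  apply sum_Rle; intros k _; unfold u; destruct (H1 k).
  apply Rmult_le_compat; try apply overlap_pos; apply overlap_le; assumption.
Qed.

(** Used with [w = a b] to find the direction in which [h |-> a h + conj (b h)] stretches most. *)
Lemma unit_rotation (w : C) :
  exists eta, Cmod eta = 1 /\ Cmult w (Cmult eta eta) = RtoC (Cmod w).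
Proof.
  destruct w as [x y].
  set (m := Cmod (x, y)).
  assert (Hm0 : 0 <= m) by apply Cmod_ge_0.
  assert (Hm2 : m * m = x * x + y * y).
  { unfold m, Cmod; rewrite sqrt_sqrt; simpl; nra. }
  (* The half-angle formula gives a square root of [conj w / |w|] away from the nonpositive reals;
     there [w = - m], and [i^2 = -1] does the job. *)
  destruct (Rlt_dec 0 (x + m)) as [Hp | Hn].
  - set (s := sqrt (2 * (x + m) * m)).
    assert (Hm : 0 < m) by nra.
    assert (Hs2 : s * s = 2 * (x + m) * m) by (apply sqrt_sqrt; nra).
    assert (Hs : 0 < s) by (apply sqrt_lt_R0; nra).
    exists ((x + m) / s, - y / s); split.
    + unfold Cmod; simpl fst; simpl snd.
      replace (_ + _) with 1; [apply sqrt_1 |].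
      field_simplify_eq; [simpl; nra | lra].
    + apply injective_projections; simpl.
      * transitivity ((x * ((x + m) * (x + m) - y * y) + 2 * (y * y) * (x + m)) / (s * s)); [field; lra |].
        rewrite Hs2; apply Rmult_eq_reg_r with (2 * (x + m) * m); [| nra].
        unfold Rdiv; rewrite Rmult_assoc, Rinv_l by nra.
        replace (y * y) with (m * m - x * x) by lra; ring.
      * transitivity (y * ((x + m) * (x + m) - y * y - 2 * x * (x + m)) / (s * s)); [field; lra |].
        replace ((x + m) * (x + m) - y * y - 2 * x * (x + m)) with 0 by nra; field; lra.
  - assert (Hx : x = - m) by nra.
    assert (Hy : y = 0) by nra.
    exists Ci; split; [apply Cmod_Ci |].
    rewrite Hx, Hy; apply injective_projections; simpl; ring.
Qed.

(** For [X = a eta], [Y = b eta] with [X Y >= 0], the directions [eta] and [i eta] have image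
    lengths [|a| + |b|] and [||a| - |b||]. Comparing the squares gives
    [4 |a| |b| <= (K^2 - 1) (|a| - |b|)^2], and [(|a| - |b|)^2 <= |a + b|^2]. *)
Lemma dilatation_ineq (a b : C) (K : R) :
  1 <= K ->
  (forall h k : C, Cmod h = 1 -> Cmod k = 1 ->
     Cmod (Cplus (Cmult a h) (Cconj (Cmult b h))) <= K * Cmod (Cplus (Cmult a k) (Cconj (Cmult b k)))) ->
  4 * (Cmod a * Cmod b) <= (K ^ 2 - 1) * Cmod (Cplus a b) ^ 2.
Proof.
  intros HK H.
  destruct (unit_rotation (Cmult a b)) as [eta [He Hab]].
  rewrite Cmod_mult in Hab.
  set (X := Cmult a eta); set (Y := Cmult b eta).
  assert (HXY : Cmult X Y = RtoC (Cmod a * Cmod b)) by (rewrite <- Hab; unfold X, Y; ring).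
  assert (HX : Cmod X = Cmod a) by (unfold X; rewrite Cmod_mult, He; ring).
  assert (HY : Cmod Y = Cmod b) by (unfold Y; rewrite Cmod_mult, He; ring).
  assert (H1 := H eta (Cmult Ci eta) He ltac:(rewrite Cmod_mult, Cmod_Ci, He; ring)).
  replace (Cmult a (Cmult Ci eta)) with (Cmult Ci X) in H1 by (unfold X; ring).
  replace (Cmult b (Cmult Ci eta)) with (Cmult Ci Y) in H1 by (unfold Y; ring).
  fold X Y in H1.
  assert (H2 : Cmod (Cplus X (Cconj Y)) ^ 2 <= K ^ 2 * Cmod (Cplus (Cmult Ci X) (Cconj (Cmult Ci Y))) ^ 2).
  { rewrite <- Rpow_mult_distr; apply pow_incr; split; [apply Cmod_ge_0 | exact H1]. }
  assert (EX : Cmod a ^ 2 = Re X ^ 2 + Im X ^ 2) by (rewrite <- HX; apply Cmod2_alt).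
  assert (EY : Cmod b ^ 2 = Re Y ^ 2 + Im Y ^ 2) by (rewrite <- HY; apply Cmod2_alt).
  assert (E3 := f_equal Re HXY).
  rewrite !Cmod2_alt in H2.
  rewrite (Cmod2_alt (Cplus a b)).
  rewrite (Cmod2_alt a) in EX; rewrite (Cmod2_alt b) in EY.
  assert (Hm0 : 0 <= Cmod a * Cmod b) by (apply Rmult_le_pos; apply Cmod_ge_0).
  assert (Hdot : - (Cmod a * Cmod b) <= Re a * Re b + Im a * Im b).
  { assert (T := re_le_Cmod (Cmult a (Cconj b))); rewrite Cmod_mult, Cmod_conj in T.
    apply Rabs_le_between in T; simpl in T; unfold Re, Im; lra. }
  destruct a as [a1 a2], b as [b1 b2], X as [x1 x2], Y as [y1 y2].
  simpl in *; set (m := Cmod (a1, a2) * Cmod (b1, b2)) in *.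
  set (A := x1 ^ 2 + x2 ^ 2 + (y1 ^ 2 + y2 ^ 2)).
  assert (H3 : A + 2 * m <= K ^ 2 * (A - 2 * m)).
  { unfold A; rewrite <- E3; eapply Rle_trans; [| eapply Rle_trans; [exact H2 |]]; right; ring. }
  assert (H4 : A - 2 * m <= (a1 + b1) ^ 2 + (a2 + b2) ^ 2).
  { unfold A; simpl; lra. }
  assert (H5 : (K ^ 2 - 1) * (A - 2 * m) <= (K ^ 2 - 1) * ((a1 + b1) ^ 2 + (a2 + b2) ^ 2)).
  { apply Rmult_le_compat_l; [nra | exact H4]. }
  simpl in *; lra.
Qed.

(** Off the null set the given real differential must be [w |-> g' w + conj (h' w)]. Both sides of
    the inequality are continuous, so a strict violation would persist on a square, which no null
    set contains. *)
Lemma quasiregular_ineq (K : R) (f g h g1 h1 : C -> C) :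
  1 <= K -> quasiregular_D K f ->
  (forall z, inD z -> f z = Cplus (g z) (Cconj (h z))) ->
  (forall z, inD z -> is_Cderive g z (g1 z)) -> holo g1 ->
  (forall z, inD z -> is_Cderive h z (h1 z)) -> holo h1 ->
  forall z, inD z -> 4 * (Cmod (g1 z) * Cmod (h1 z)) <= (K ^ 2 - 1) * Cmod (Cplus (g1 z) (h1 z)) ^ 2.
Proof.
  intros HK [_ [_ [N [HN Hqr]]]] Hf Hg Hg1 Hh Hh1.
  assert (Hoff : forall z, inD z -> ~ N z ->
    4 * (Cmod (g1 z) * Cmod (h1 z)) <= (K ^ 2 - 1) * Cmod (Cplus (g1 z) (h1 z)) ^ 2).
  { intros z Hz HNz; destruct (Hqr z Hz HNz) as [L [[[_ HLs] HL] HLK]].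
    set (L0 := fun w => Cplus (Cmult (g1 z) w) (Cconj (Cmult (h1 z) w))).
    assert (EL : forall w, Cmod w = 1 -> L w = L0 w).
    { intros w Hw.
      (* At the point [z + t w] the remainders of [f], [g] and [h] are each at most [eps * t]; real
         homogeneity of [L] lets [t] be divided out. *)
      assert (Hsm : forall eps, 0 < eps -> Cmod (Cminus (L w) (L0 w)) <= 3 * eps).
      { intros eps He.
        destruct (HL eps He) as [d1 [Hd1 K1]].
        destruct (proj1 (is_Cderive_eps _ _ _) (Hg z Hz) eps He) as [d2 [Hd2 K2]].
        destruct (proj1 (is_Cderive_eps _ _ _) (Hh z Hz) eps He) as [d3 [Hd3 K3]].
        assert (Hd4 : 0 < 1 - Cmod z) by (unfold inD in Hz; lra).
        set (t := Rmin (Rmin d1 d2) (Rmin d3 (1 - Cmod z)) / 2).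
        assert (Ht0 : 0 < Rmin (Rmin d1 d2) (Rmin d3 (1 - Cmod z))) by (repeat apply Rmin_pos; assumption).
        assert (T1 : t < d1).
        { assert (Rmin (Rmin d1 d2) (Rmin d3 (1 - Cmod z)) <= d1)
            by (eapply Rle_trans; [apply Rmin_l | apply Rmin_l]); unfold t; lra. }
        assert (T2 : t < d2).
        { assert (Rmin (Rmin d1 d2) (Rmin d3 (1 - Cmod z)) <= d2)
            by (eapply Rle_trans; [apply Rmin_l | apply Rmin_r]); unfold t; lra. }
        assert (T3 : t < d3).
        { assert (Rmin (Rmin d1 d2) (Rmin d3 (1 - Cmod z)) <= d3)
            by (eapply Rle_trans; [apply Rmin_r | apply Rmin_l]); unfold t; lra. }
        assert (T4 : t < 1 - Cmod z).
        { assert (Rmin (Rmin d1 d2) (Rmin d3 (1 - Cmod z)) <= 1 - Cmod z)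
            by (eapply Rle_trans; [apply Rmin_r | apply Rmin_r]); unfold t; lra. }
        assert (Ht : 0 < t) by (unfold t; lra).
        assert (Em : Cmod (Cmult (RtoC t) w) = t).
        { rewrite Cmod_mult, Cmod_R, Hw, Rabs_pos_eq; lra. }
        set (v := Cplus z (Cmult (RtoC t) w)).
        assert (Ev : Cminus v z = Cmult (RtoC t) w) by (unfold v; ring).
        assert (Hv : inD v).
        { unfold inD, v; eapply Rle_lt_trans; [apply Cmod_triangle |]; rewrite Em; lra. }
        specialize (K1 (Cmult (RtoC t) w)); specialize (K2 v); specialize (K3 v).
        fold v in K1; rewrite Ev in K2, K3; rewrite Em in K1, K2, K3.
        specialize (K1 T1); specialize (K2 T2); specialize (K3 T3).
        rewrite HLs in K1.
        apply Rmult_le_reg_l with t; [exact Ht |].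
        rewrite <- (Rabs_pos_eq t) at 1 by lra.
        rewrite <- Cmod_R, <- Cmod_mult.
        replace (Cmult (RtoC t) (Cminus (L w) (L0 w))) with
          (Cplus (Copp (Cminus (Cminus (f v) (f z)) (Cmult (RtoC t) (L w))))
             (Cplus (Cminus (Cminus (g v) (g z)) (Cmult (g1 z) (Cmult (RtoC t) w)))
                    (Cconj (Cminus (Cminus (h v) (h z)) (Cmult (h1 z) (Cmult (RtoC t) w)))))).
        - eapply Rle_trans; [apply Cmod_triangle |]; rewrite Cmod_opp.
          assert (Q := Cmod_triangle (Cminus (Cminus (g v) (g z)) (Cmult (g1 z) (Cmult (RtoC t) w)))
                    (Cconj (Cminus (Cminus (h v) (h z)) (Cmult (h1 z) (Cmult (RtoC t) w))))).
          rewrite (Cmod_conj (Cminus (Cminus (h v) (h z)) _)) in Q; lra.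
        - rewrite (Hf v Hv), (Hf z Hz); unfold L0.
          apply injective_projections; simpl; ring. }
      assert (E0 : Cmod (Cminus (L w) (L0 w)) = 0).
      { apply Rle_antisym; [| apply Cmod_ge_0]; apply Rnot_lt_le; intro Hp.
        set (x := Cmod (Cminus (L w) (L0 w))) in *.
        specialize (Hsm (x / 6) ltac:(lra)); lra. }
      apply Cmod_eq_0 in E0; rewrite <- (Cplus_0_r (L0 w)), <- E0; ring. }
    apply dilatation_ineq; [exact HK |]; intros u v Hu Hv.
    assert (H := HLK u v Hu Hv); rewrite !EL in H by assumption; exact H. }
  intros z Hz; apply Rnot_lt_le; intro Hlt.
  assert (Hcg : continuous g1 z) by (destruct (Hg1 z Hz) as [l Hl]; eapply is_Cderive_continuous, Hl).
  assert (Hch : continuous h1 z) by (destruct (Hh1 z Hz) as [l Hl]; eapply is_Cderive_continuous, Hl).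
  set (F := fun w => 4 * (Cmod (g1 w) * Cmod (h1 w)) - (K ^ 2 - 1) * Cmod (Cplus (g1 w) (h1 w)) ^ 2).
  assert (HF : continuous F z).
  { apply continuous_Rminus; apply continuous_Rmult; try apply continuous_const.
    - apply continuous_Rmult; apply continuous_Cmod; assumption.
    - simpl; apply continuous_Rmult; [| apply continuous_Rmult; [| apply continuous_const]];
        apply continuous_Cmod, continuous_Cplus; assumption. }
  assert (HFz : 0 < F z) by (unfold F; lra).
  assert (Hpos : locally z (fun w => 0 < F w)).
  { apply (HF (fun y => 0 < y)); exists (mkposreal _ HFz); intros y Hy.
    change (Rabs (y - F z) < F z) in Hy; apply Rabs_def2 in Hy; lra. }
  destruct (filter_and _ _ Hpos (locally_Cmod_lt z 1 Hz)) as [d Hd].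
  assert (Hd0 := cond_pos d).
  destruct (null_set_not_rect N (fst z) (fst z + d / 2) (snd z) (snd z + d / 2) HN) as [w [W1 [W2 W3]]];
    try lra.
  destruct (Hd w) as [P1 P2].
  { split; [change (Rabs (fst w - fst z) < d) | change (Rabs (snd w - snd z) < d)];
      apply Rabs_def1; lra. }
  specialize (Hoff w P2 W3); unfold F in P1; lra.
Qed.

(** * Trigonometric inequalities *)

Lemma rpow_pos_eq (x a : R) : 0 < x -> rpow x a = Rpower x a.
Proof. intro H; unfold rpow; destruct Rle_dec; [lra | reflexivity]. Qed.

Lemma rpow_npos_eq (x a : R) : x <= 0 -> rpow x a = 0.
Proof. intro H; unfold rpow; destruct Rle_dec; [reflexivity | lra]. Qed.

Lemma rpow_ge_0 (x a : R) : 0 <= rpow x a.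
Proof. unfold rpow; destruct Rle_dec; [lra | left; apply exp_pos]. Qed.

Lemma Rpower_pos (x a : R) : 0 < Rpower x a.
Proof. apply exp_pos. Qed.

Lemma Rpower_minus_1 (x a : R) : 0 < x -> Rpower x (a - 1) = Rpower x a / x.
Proof.
  intro Hx; unfold Rminus, Rdiv; rewrite Rpower_plus, (Rpower_Ropp x 1), Rpower_1 by exact Hx; reflexivity.
Qed.

Lemma decreasing_of_deriv (f f' : R -> R) (a b : R) :
  a <= b -> (forall x, a <= x <= b -> is_derive f x (f' x)) ->
  (forall x, a < x < b -> f' x <= 0) -> f b <= f a.
Proof.
  intros Hab Hd Hneg; destruct Hab as [Hab | ->]; [| lra].
  destruct (MVT_cor2 f f' a b Hab) as [c [Hc1 Hc2]].
  { intros c Hc; apply is_derive_Reals, Hd, Hc. }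
  specialize (Hneg c Hc2); nra.
Qed.

Lemma increasing_of_deriv (f f' : R -> R) (a b : R) :
  a <= b -> (forall x, a <= x <= b -> is_derive f x (f' x)) ->
  (forall x, a < x < b -> 0 <= f' x) -> f a <= f b.
Proof.
  intros Hab Hd Hpos.
  assert (- f b <= - f a); [| lra].
  apply (decreasing_of_deriv (fun x => - f x) (fun x => - f' x)); [exact Hab | |].
  - intros x Hx; apply (is_derive_opp (V := R_NormedModule)), Hd, Hx.
  - intros x Hx; specialize (Hpos x Hx); lra.
Qed.

Section Trigonometry.

Variable p : R.
Hypothesis Hp : 1 < p <= 2.

Let q := p - 1.
Let th0 := PI / (2 * p).

Lemma th0_bounds : PI / 4 <= th0 < PI / 2.
Proof.
  assert (Hpi := PI_RGT_0); unfold th0; split.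
  - apply Rmult_le_reg_r with (4 * p); [lra |]; field_simplify; [nra | lra].
  - apply Rmult_lt_reg_r with (2 * p); [lra |]; field_simplify; [nra | lra].
Qed.

Lemma sin_th0_pos : 0 < sin th0.
Proof. assert (H := th0_bounds); assert (Hpi := PI_RGT_0); apply sin_gt_0; lra. Qed.

Lemma cos_th0_pos : 0 < cos th0.
Proof. assert (H := th0_bounds); assert (Hpi := PI_RGT_0); apply cos_gt_0; lra. Qed.

Lemma p_th0 : p * th0 = PI / 2.
Proof. unfold th0; field; lra. Qed.

(** The angles [(p - 1) th0] and [th0] are complementary; this is the source of the denominators
    [cos th0] in the constants. *)
Lemma sin_q_th0 : sin (q * th0) = cos th0.
Proof.
  unfold q; replace ((p - 1) * th0) with (PI / 2 - th0) by (rewrite <- p_th0; ring).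
  apply sin_shift.
Qed.

Lemma sin_q_pos (x : R) : 0 < x < PI -> 0 < sin (q * x).
Proof. intros H; apply sin_gt_0; unfold q; nra. Qed.

(** The derivative has the sign of [- sin ((1 - q) t)], and [0 <= (1 - q) t < PI] since
    [0 < q <= 1]. Comparison with the value at [th0] gives the sign change required by
    [trig_maximum]. *)
Lemma Rpower_sin_ratio (x y : R) : 0 < x -> x <= y -> y < PI ->
  Rpower (sin y) q / sin (q * y) <= Rpower (sin x) q / sin (q * x).
Proof.
  intros Hx Hxy Hy.
  apply (decreasing_of_deriv (fun t => Rpower (sin t) q / sin (q * t))
    (fun t => q * Rpower (sin t) q * (cos t * sin (q * t) - sin t * cos (q * t)) / (sin t * sin (q * t) ^ 2)));
    [exact Hxy | |]; intros t Ht; assert (H1 : 0 < sin t) by (apply sin_gt_0; lra);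
    assert (H2 := sin_q_pos t ltac:(lra)).
  - unfold Rpower; auto_derive; [repeat split; lra | field; lra].
  - replace (cos t * sin (q * t) - sin t * cos (q * t)) with (- sin (t - q * t)) by (rewrite sin_minus; ring).
    assert (H3 : 0 <= sin (t - q * t)) by (apply sin_ge_0; unfold q; nra).
    assert (H4 := Rpower_pos (sin t) q).
    assert (0 <= q * Rpower (sin t) q * sin (t - q * t) / (sin t * sin (q * t) ^ 2)); [| unfold Rdiv in *; lra].
    apply Rmult_le_pos; [repeat apply Rmult_le_pos; [unfold q; lra | lra | exact H3] |].
    left; apply Rinv_0_lt_compat; apply Rmult_lt_0_compat; [lra | apply pow_lt; lra].
Qed.

(** The numerator of the derivative vanishes at 0 and has derivative
    [(q^2 - 1) sin t sin (q t) <= 0]. This is the analogue of the previous ratio for the bound on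
    [|f|]. *)
Lemma sin_ratio (x y : R) : 0 < x -> x <= y -> y < PI ->
  sin y / sin (q * y) <= sin x / sin (q * x).
Proof.
  intros Hx Hxy Hy.
  apply (decreasing_of_deriv (fun t => sin t / sin (q * t))
    (fun t => (cos t * sin (q * t) - q * sin t * cos (q * t)) / sin (q * t) ^ 2));
    [exact Hxy | |]; intros t Ht; assert (H1 : 0 < sin t) by (apply sin_gt_0; lra);
    assert (H2 := sin_q_pos t ltac:(lra)).
  - auto_derive; [lra | field; lra].
  - assert (H3 : cos t * sin (q * t) - q * sin t * cos (q * t)
                 <= cos 0 * sin (q * 0) - q * sin 0 * cos (q * 0)).
    { apply (decreasing_of_deriv (fun t => cos t * sin (q * t) - q * sin t * cos (q * t))
        (fun t => (q ^ 2 - 1) * (sin t * sin (q * t)))); [lra | |].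
      - intros s Hs; auto_derive; [trivial | ring].
      - intros s Hs; assert (H4 : 0 < sin s) by (apply sin_gt_0; lra).
        assert (H5 := sin_q_pos s ltac:(lra)).
        assert (0 <= sin s * sin (q * s)) by nra.
        assert (q ^ 2 <= 1) by (unfold q; nra); nra. }
    rewrite sin_0, Rmult_0_r, sin_0 in H3.
    apply Rmult_le_reg_r with (sin (q * t) ^ 2); [apply pow_lt; lra |].
    unfold Rdiv; rewrite Rmult_assoc, Rinv_l by (apply pow_nonzero; lra); lra.
Qed.

(* [T + B cos(p x) / cos^p x] has derivative [p cos^(-p-1) x (s x - B sin((p-1) x))],
   hence its maximum is attained at [th0], where [cos (p th0) = 0]. *)
Lemma trig_maximum (T s : R -> R) (B x : R) :
  0 <= x < PI / 2 ->
  (forall t, 0 <= t < PI / 2 -> x <= t \/ th0 <= t ->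
     is_derive T t (p * Rpower (cos t) (- p - 1) * s t)) ->
  (forall t, 0 < t <= th0 -> B * sin (q * t) <= s t) ->
  (forall t, th0 <= t < PI / 2 -> s t <= B * sin (q * t)) ->
  T x + B * (cos (p * x) * Rpower (cos x) (- p)) <= T th0.
Proof.
  intros Hx HT Hs1 Hs2.
  assert (H0 := th0_bounds); assert (Hpi := PI_RGT_0).
  set (f := fun t => T t + B * (cos (p * t) * Rpower (cos t) (- p))).
  set (f' := fun t => p * Rpower (cos t) (- p - 1) * (s t - B * sin (q * t))).
  (* Monotonicity is applied only between [x] and [th0]; the alternative on [t] admits a [T]
     differentiable just for positive arguments. *)
  assert (Hf : forall t, 0 <= t < PI / 2 -> x <= t \/ th0 <= t -> is_derive f t (f' t)).
  { intros t Ht Ht'.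
    assert (Hc : 0 < cos t) by (apply cos_gt_0; lra).
    replace (f' t) with (p * Rpower (cos t) (- p - 1) * s t +
      B * (- p * Rpower (cos t) (- p - 1) * sin (q * t))) by (unfold f'; ring).
    apply (is_derive_plus (V := R_NormedModule) T); [apply HT; assumption |].
    apply (is_derive_scal (fun t => cos (p * t) * Rpower (cos t) (- p))).
    replace (Rpower (cos t) (- p - 1)) with (Rpower (cos t) (- p) / cos t).
    2: { symmetry; apply Rpower_minus_1, Hc. }
    unfold q; replace ((p - 1) * t) with (p * t - t) by ring; rewrite sin_minus.
    unfold Rpower; auto_derive; [lra | field; lra]. }
  assert (Hq0 : f th0 = T th0).
  { unfold f; rewrite p_th0, cos_PI2; ring. }
  fold (f x); rewrite <- Hq0.
  destruct (Rle_dec x th0) as [Hle | Hgt].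
  - apply (increasing_of_deriv f f'); [exact Hle | |]; intros t Ht.
    + apply Hf; lra.
    + specialize (Hs1 t ltac:(lra)); unfold f'; assert (H := Rpower_pos (cos t) (- p - 1)).
      apply Rmult_le_pos; nra.
  - apply (decreasing_of_deriv f f'); [lra | |]; intros t Ht.
    + apply Hf; lra.
    + specialize (Hs2 t ltac:(lra)); unfold f'; assert (H := Rpower_pos (cos t) (- p - 1)).
      assert (0 <= p * Rpower (cos t) (- p - 1) * (B * sin (q * t) - s t)); [| nra].
      apply Rmult_le_pos; nra.
Qed.

(** Evenness reduces to [x >= 0], and the reflection [x |-> PI - x] to the first quadrant: it
    preserves [S] and [|cos x|], and only increases [cos (p x)] when [x >= PI / 2]. *)
Lemma trig_extend (S : R -> R) (A B : R) :
  0 <= B -> (forall x, S (- x) = S x) -> (forall x, S (PI - x) = S x) ->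
  (forall x, 0 <= x <= PI / 2 -> S x + B * cos (p * x) <= A * rpow (cos x) p) ->
  forall x, - PI < x < PI -> S x <= A * rpow (Rabs (cos x)) p - B * cos (p * x).
Proof.
  intros HB Heven Hrefl H.
  assert (Hpi := PI_RGT_0).
  assert (Hpos : forall x, 0 <= x < PI -> S x <= A * rpow (Rabs (cos x)) p - B * cos (p * x)).
  { intros x Hx; destruct (Rle_dec x (PI / 2)) as [Hle | Hgt].
    - rewrite Rabs_pos_eq by (apply cos_ge_0; lra); specialize (H x ltac:(lra)); lra.
    - specialize (H (PI - x) ltac:(lra)); rewrite Hrefl in H.
      replace (cos (PI - x)) with (- cos x) in H by (rewrite Rtrigo_facts.cos_pi_minus; ring).
      rewrite Rabs_left1 by (apply cos_le_0; lra).
      assert (cos (p * x) <= cos (p * (PI - x))); [| nra].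
      (* With [p x = X + Y] and [p (PI - x) = X - Y], the two cosines differ by [2 sin X sin Y],
         where both angles lie in [[0, PI]] because [p <= 2]. *)
      set (X := p * PI / 2); set (Y := p * (x - PI / 2)).
      replace (p * x) with (X + Y) by (unfold X, Y; field).
      replace (p * (PI - x)) with (X - Y) by (unfold X, Y; field).
      rewrite cos_plus, cos_minus.
      assert (0 <= sin X) by (apply sin_ge_0; unfold X; nra).
      assert (0 <= sin Y) by (apply sin_ge_0; unfold Y; nra).
      nra. }
  intros x Hx; destruct (Rle_dec 0 x) as [H0 | H0]; [apply Hpos; lra |].
  specialize (Hpos (- x) ltac:(lra)).
  rewrite Heven, cos_neg, <- Ropp_mult_distr_r, cos_neg in Hpos; exact Hpos.
Qed.

Lemma rpow_cos_scale (x S A B : R) : 0 < cos x ->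
  S * Rpower (cos x) (- p) + B * (cos (p * x) * Rpower (cos x) (- p)) <= A ->
  S + B * cos (p * x) <= A * rpow (cos x) p.
Proof.
  intros Hc H; rewrite rpow_pos_eq by exact Hc.
  apply (Rmult_le_compat_r (Rpower (cos x) p)) in H; [| left; apply Rpower_pos].
  replace ((S * Rpower (cos x) (- p) + B * (cos (p * x) * Rpower (cos x) (- p))) * Rpower (cos x) p)
    with ((S + B * cos (p * x)) * (Rpower (cos x) (- p) * Rpower (cos x) p)) in H by ring.
  rewrite <- Rpower_plus, Rplus_opp_l, Rpower_O in H by exact Hc; lra.
Qed.

Lemma sin_q_PI2 : sin (q * (PI / 2)) = - cos (p * (PI / 2)).
Proof.
  unfold q; replace ((p - 1) * (PI / 2)) with (p * (PI / 2) - PI / 2) by ring.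
  rewrite sin_minus, sin_PI2, cos_PI2; ring.
Qed.

Lemma ratio_le (a b c d : R) : 0 < b -> 0 < d -> a / b <= c / d -> a <= c / d * b.
Proof.
  intros Hb Hd H; apply (Rmult_le_compat_r b) in H; [| lra].
  unfold Rdiv at 1 in H; rewrite Rmult_assoc, Rinv_l in H by lra; lra.
Qed.

Lemma ratio_ge (a b c d : R) : 0 < b -> 0 < d -> c / d <= a / b -> c / d * b <= a.
Proof.
  intros Hb Hd H; apply (Rmult_le_compat_r b) in H; [| lra].
  unfold Rdiv at 2 in H; rewrite Rmult_assoc, Rinv_l in H by lra; lra.
Qed.

(** The case [T = cos^(-p)], [s = sin] of [trig_maximum]: the critical condition at [th0] is
    [B sin (q th0) = sin th0], whence [B = tan th0], and the maximum is [T th0]. *)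
Lemma trig_modulus (x : R) : - PI < x < PI ->
  1 <= / rpow (cos th0) p * rpow (Rabs (cos x)) p - tan th0 * cos (p * x).
Proof.
  assert (H0 := th0_bounds); assert (Hpi := PI_RGT_0).
  assert (Hs0 := sin_th0_pos); assert (Hc0 := cos_th0_pos).
  assert (HB : 0 <= tan th0) by (left; apply Rdiv_lt_0_compat; assumption).
  assert (Htan : tan th0 = sin th0 / sin (q * th0)) by (rewrite sin_q_th0; reflexivity).
  assert (Hs1 : forall t, 0 < t <= th0 -> tan th0 * sin (q * t) <= sin t).
  { intros t Ht; rewrite Htan; apply ratio_ge.
    - apply sin_q_pos; lra.
    - apply sin_q_pos; lra.
    - apply sin_ratio; lra. }
  assert (Hs2 : forall t, th0 <= t < PI -> sin t <= tan th0 * sin (q * t)).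
  { intros t Ht; rewrite Htan; apply ratio_le.
    - apply sin_q_pos; lra.
    - apply sin_q_pos; lra.
    - apply sin_ratio; lra. }
  apply (trig_extend (fun _ => 1)); try reflexivity; [exact HB |].
  clear x; intros x Hx; destruct (Rle_lt_or_eq_dec x (PI / 2)) as [Hlt | ->]; [lra | |].
  - assert (Hc : 0 < cos x) by (apply cos_gt_0; lra).
    apply rpow_cos_scale; [exact Hc |].
    rewrite (rpow_pos_eq (cos th0)), <- Rpower_Ropp, Rmult_1_l by exact Hc0.
    apply (trig_maximum (fun t => Rpower (cos t) (- p)) sin (tan th0) x); [lra | | exact Hs1 |].
    + intros t Ht _; assert (Hct : 0 < cos t) by (apply cos_gt_0; lra).
      replace (Rpower (cos t) (- p - 1)) with (Rpower (cos t) (- p) / cos t).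
      2: { symmetry; apply Rpower_minus_1, Hct. }
      unfold Rpower; auto_derive; [lra | field; lra].
    + intros t Ht; apply Hs2; lra.
  (* At [PI / 2] the power of the cosine is 0 and division by it fails; what remains is the ratio
     inequality at [PI / 2], since [sin (q PI / 2) = - cos (p PI / 2)]. *)
  - rewrite cos_PI2, (rpow_npos_eq 0) by lra.
    specialize (Hs2 (PI / 2) ltac:(lra)); rewrite sin_PI2, sin_q_PI2 in Hs2; lra.
Qed.

(** The case [T = tan^p], [s = sin^(p-1)] of [trig_maximum]: [B] is the value at [th0] of the
    decreasing ratio [sin^q t / sin (q t)], and [A = T th0 = tan^p th0]. *)
Lemma trig_sin (x : R) : - PI < x < PI ->
  rpow (Rabs (sin x)) p <=
  rpow (tan th0) (p - 1) / (cos th0 / sin th0) * rpow (Rabs (cos x)) p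
  - rpow (sin th0) (p - 1) / cos th0 * cos (p * x).
Proof.
  assert (H0 := th0_bounds); assert (Hpi := PI_RGT_0).
  assert (Hs0 := sin_th0_pos); assert (Hc0 := cos_th0_pos).
  assert (Ht0 : 0 < tan th0) by (apply Rdiv_lt_0_compat; assumption).
  fold q; rewrite (rpow_pos_eq (tan th0)), (rpow_pos_eq (sin th0)) by assumption.
  set (B := Rpower (sin th0) q / cos th0).
  set (A := Rpower (tan th0) q / (cos th0 / sin th0)).
  assert (HB : 0 < B) by (apply Rdiv_lt_0_compat; [apply Rpower_pos | assumption]).
  assert (EB : B = Rpower (sin th0) q / sin (q * th0)) by (rewrite sin_q_th0; reflexivity).
  assert (Hs1 : forall t, 0 < t <= th0 -> B * sin (q * t) <= Rpower (sin t) q).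
  { intros t Ht; rewrite EB; apply ratio_ge.
    - apply sin_q_pos; lra.
    - apply sin_q_pos; lra.
    - apply Rpower_sin_ratio; lra. }
  assert (Hs2 : forall t, th0 <= t < PI -> Rpower (sin t) q <= B * sin (q * t)).
  { intros t Ht; rewrite EB; apply ratio_le.
    - apply sin_q_pos; lra.
    - apply sin_q_pos; lra.
    - apply Rpower_sin_ratio; lra. }
  assert (EA : A = Rpower (sin th0) p * Rpower (cos th0) (- p)).
  { unfold A, tan, Rdiv at 2; rewrite <- Rpower_mult_distr by (try apply Rinv_0_lt_compat; assumption).
    replace (Rpower (sin th0) p) with (Rpower (sin th0) q * sin th0).
    2: { unfold q; rewrite Rpower_minus_1 by assumption; field; lra. }
    rewrite Rpower_Ropp.
    replace (Rpower (cos th0) p) with (Rpower (cos th0) q * cos th0).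
    2: { unfold q; rewrite Rpower_minus_1 by assumption; field; lra. }
    replace (Rpower (/ cos th0) q) with (/ Rpower (cos th0) q).
    2: { rewrite <- Rpower_Ropp; unfold Rpower; rewrite ln_Rinv by assumption; f_equal; ring. }
    assert (H := Rpower_pos (cos th0) q); field; lra. }
  assert (Hmain : forall x, 0 < x < PI / 2 -> Rpower (sin x) p + B * cos (p * x) <= A * rpow (cos x) p).
  { clear x; intros x Hx; assert (Hc : 0 < cos x) by (apply cos_gt_0; lra).
    apply rpow_cos_scale; [exact Hc |]; rewrite EA.
    apply (trig_maximum (fun t => Rpower (sin t) p * Rpower (cos t) (- p))
             (fun t => Rpower (sin t) q) B x); [lra | | exact Hs1 |].
    (* The alternative [Ht'] makes [t] positive, hence [sin t] a legitimate base for [Rpower]. *)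
    - intros t Ht Ht'; assert (Hct : 0 < cos t) by (apply cos_gt_0; lra).
      assert (Hst : 0 < sin t) by (apply sin_gt_0; lra).
      replace (Rpower (cos t) (- p - 1)) with (Rpower (cos t) (- p) / cos t).
      2: { symmetry; apply Rpower_minus_1, Hct. }
      (* Differentiating the quotient of powers leaves a factor [sin^2 + cos^2], inserted here so
         that both sides agree as rational expressions. *)
      replace (Rpower (sin t) q) with (Rpower (sin t) p * (sin t ^ 2 + cos t ^ 2) / sin t).
      2: { unfold q; rewrite Rpower_minus_1 by exact Hst.
           replace (sin t ^ 2 + cos t ^ 2) with 1 by (generalize (sin2_cos2 t); unfold Rsqr; lra).
           field; lra. }
      unfold Rpower; auto_derive; [lra | field; lra].
    - intros t Ht; apply Hs2; lra. }
  (* This is the inequality at [x = 0], obtained as a limit: if [A < B], continuity gives a small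
     positive [t] with [B cos (p t) > A], against [Hmain], because [cos^p t <= 1] and
     [sin^p t > 0]. *)
  assert (Hzero : B <= A).
  { apply Rnot_lt_le; intro Hlt.
    assert (Hcont : continuity_pt (fun t => B * cos (p * t) - A) 0).
    { apply derivable_continuous_pt; exists (- (B * (p * sin (p * 0)))).
      apply is_derive_Reals; auto_derive; [trivial | ring]. }
    destruct (Hcont (B - A)) as [d [Hd1 Hd2]]; [lra |].
    set (t := Rmin d (PI / 2) / 2).
    assert (T1 := Rmin_l d (PI / 2)); assert (T2 := Rmin_r d (PI / 2)).
    assert (T3 : 0 < Rmin d (PI / 2)) by (apply Rmin_pos; lra).
    specialize (Hd2 t); unfold dist in Hd2; simpl in Hd2; unfold Rdist in Hd2.
    rewrite Rmult_0_r, cos_0 in Hd2.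
    assert (Ht : Rabs (B * cos (p * t) - A - (B * 1 - A)) < B - A).
    { apply Hd2; split; [split; [exact I | unfold t; lra] |].
      rewrite Rabs_pos_eq; unfold t; lra. }
    apply Rabs_def2 in Ht.
    specialize (Hmain t ltac:(unfold t; lra)).
    assert (Hc : 0 < cos t) by (apply cos_gt_0; unfold t; lra).
    rewrite rpow_pos_eq in Hmain by exact Hc.
    assert (HA : 0 < A) by (rewrite EA; apply Rmult_lt_0_compat; apply Rpower_pos).
    assert (Hc1 : Rpower (cos t) p <= 1).
    { rewrite <- (Rpower_O (cos t)) by exact Hc.
      destruct (COS_bound t) as [_ [Hlt1 | ->]].
      - left; unfold Rpower; apply exp_increasing.
        assert (ln (cos t) < 0) by (rewrite <- ln_1; apply ln_increasing; assumption); nra.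
      - unfold Rpower; rewrite ln_1; right; f_equal; ring. }
    assert (Hsp := Rpower_pos (sin t) p); nra. }
  apply (trig_extend (fun x => rpow (Rabs (sin x)) p)).
  - lra.
  - intro y; rewrite sin_neg, Rabs_Ropp; reflexivity.
  - intro y; rewrite Rtrigo_facts.sin_pi_minus; reflexivity.
  - clear x; intros x Hx.
    destruct (Rle_lt_or_eq_dec x (PI / 2)) as [Hlt | ->]; [lra | |].
    + destruct (Rle_lt_or_eq_dec 0 x) as [Hpos | <-]; [lra | |].
      * assert (Hs : 0 < sin x) by (apply sin_gt_0; lra).
        rewrite Rabs_pos_eq, rpow_pos_eq by lra; apply Hmain; lra.
      * rewrite sin_0, Rabs_R0, rpow_npos_eq, Rmult_0_r, cos_0 by lra.
        rewrite rpow_pos_eq by lra; unfold Rpower; rewrite ln_1, Rmult_0_r, exp_0; lra.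
    + rewrite sin_PI2, cos_PI2, Rabs_R1, (rpow_npos_eq 0), rpow_pos_eq by lra.
      unfold Rpower; rewrite ln_1, Rmult_0_r, exp_0.
      specialize (Hs2 (PI / 2) ltac:(lra)); rewrite sin_PI2, sin_q_PI2 in Hs2.
      unfold Rpower in Hs2; rewrite ln_1, Rmult_0_r, exp_0 in Hs2; lra.
Qed.

End Trigonometry.

(** * The energy density *)

Lemma Derive_eq (f : R -> R) (x l : R) : is_derive f x l -> Derive (fun y : R => f y) x = l.
Proof. apply is_derive_unique. Qed.

Definition rho (x y : R) : R := sqrt (x * x + y * y).
(** The principal argument by the half-angle tangent, a single formula that is smooth on the whole
    slit plane. The condition [0 < x + rho x y] expresses that the point is off [(-infinity, 0]]. *)
Definition theta (x y : R) : R := 2 * atan (y / (x + rho x y)).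
(** [RP] and [IP] are the real and imaginary parts of the principal power [(x + i y)^a]. *)
Definition RP (a x y : R) : R := Rpower (rho x y) a * cos (a * theta x y).
Definition IP (a x y : R) : R := Rpower (rho x y) a * sin (a * theta x y).

Lemma rho_ge_0 (x y : R) : 0 <= rho x y.
Proof. apply sqrt_pos. Qed.

Lemma rho_sqr (x y : R) : rho x y * rho x y = x * x + y * y.
Proof. apply sqrt_sqrt; nra. Qed.

Lemma Cmod_rho (z : C) : Cmod z = rho (Re z) (Im z).
Proof. unfold Cmod, rho, Re, Im; f_equal; ring. Qed.

Lemma rho_ge_abs (x y : R) : Rabs x <= rho x y /\ Rabs y <= rho x y.
Proof.
  assert (H := rho_sqr x y); assert (H0 := rho_ge_0 x y).
  split; apply Rabs_le; nra.
Qed.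

Lemma slit_pos (x y : R) : (y = 0 -> 0 < x) -> 0 < x + rho x y.
Proof.
  intro H; assert (H1 := rho_sqr x y); assert (H0 := rho_ge_0 x y).
  destruct (Req_dec y 0) as [Hy | Hy]; [specialize (H Hy); lra |].
  assert (0 < y * y) by nra; nra.
Qed.

Lemma slit_rho_pos (x y : R) : 0 < x + rho x y -> 0 < rho x y.
Proof. intro H; destruct (rho_ge_abs x y) as [H1 _]; apply Rabs_le_between in H1; lra. Qed.

Lemma theta_bounds (x y : R) : - PI < theta x y < PI.
Proof. unfold theta; generalize (atan_bound (y / (x + rho x y))); lra. Qed.

Lemma cos_sin_2atan (t : R) :
  cos (2 * atan t) = (1 - t * t) / (1 + t * t) /\ sin (2 * atan t) = 2 * t / (1 + t * t).
Proof.
  assert (H := atan_bound t).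
  assert (Hc : 0 < cos (atan t)) by (apply cos_gt_0; lra).
  assert (Es : sin (atan t) = t * cos (atan t)).
  { rewrite <- (tan_atan t) at 2; unfold tan; field; lra. }
  assert (E := sin2_cos2 (atan t)); unfold Rsqr in E; rewrite Es in E.
  assert (ddenergy : cos (atan t) * cos (atan t) = / (1 + t * t)).
  { apply Rmult_eq_reg_r with (1 + t * t); [| nra]; rewrite Rinv_l by nra; lra. }
  rewrite cos_2a, sin_2a, Es; split.
  - transitivity ((1 - t * t) * (cos (atan t) * cos (atan t))); [ring | rewrite ddenergy; reflexivity].
  - transitivity (2 * t * (cos (atan t) * cos (atan t))); [ring | rewrite ddenergy; reflexivity].
Qed.

Lemma cos_theta (x y : R) : 0 < x + rho x y -> rho x y * cos (theta x y) = x.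
Proof.
  intro H; assert (Hr := slit_rho_pos x y H); assert (H1 := rho_sqr x y).
  unfold theta; rewrite (proj1 (cos_sin_2atan _)); set (r := rho x y) in *.
  apply Rmult_eq_reg_r with (2 * r * (x + r)); [| nra].
  transitivity (r * (((x + r) * (x + r) - y * y) / ((x + r) * (x + r) + y * y)) * (2 * r * (x + r))).
  { field; split; [nra | lra]. }
  replace ((x + r) * (x + r) + y * y) with (2 * r * (x + r)) by nra.
  replace (y * y) with (r * r - x * x) by lra; field; lra.
Qed.

Lemma sin_theta (x y : R) : 0 < x + rho x y -> rho x y * sin (theta x y) = y.
Proof.
  intro H; assert (Hr := slit_rho_pos x y H); assert (H1 := rho_sqr x y).
  unfold theta; rewrite (proj2 (cos_sin_2atan _)); set (r := rho x y) in *.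
  transitivity (r * (2 * y * (x + r) / ((x + r) * (x + r) + y * y))).
  { field; split; [nra | lra]. }
  replace ((x + r) * (x + r) + y * y) with (2 * r * (x + r)) by nra.
  field; lra.
Qed.

Lemma is_derive_rho (u v : R -> R) (s a b : R) :
  is_derive u s a -> is_derive v s b -> 0 < rho (u s) (v s) ->
  is_derive (fun x => rho (u x) (v x)) s ((u s * a + v s * b) / rho (u s) (v s)).
Proof.
  intros Hu Hv Hr; unfold rho in *.
  assert (Hpos : 0 < u s * u s + v s * v s).
  { apply sqrt_lt_0_alt; rewrite sqrt_0; exact Hr. }
  auto_derive.
  - repeat split; try (eexists; eassumption); exact Hpos.
  - rewrite (Derive_eq u _ _ Hu), (Derive_eq v _ _ Hv).
    field; lra.
Qed.

Lemma is_derive_theta (u v : R -> R) (s a b : R) :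
  is_derive u s a -> is_derive v s b -> 0 < u s + rho (u s) (v s) ->
  is_derive (fun x => theta (u x) (v x)) s ((u s * b - v s * a) / rho (u s) (v s) ^ 2).
Proof.
  intros Hu Hv Hs.
  assert (Hr := slit_rho_pos _ _ Hs); assert (H2 := rho_sqr (u s) (v s)).
  assert (Hrho := is_derive_rho u v s a b Hu Hv Hr).
  unfold theta; set (R := fun x => rho (u x) (v x)) in *.
  change (is_derive (fun x => 2 * atan (v x / (u x + R x))) s ((u s * b - v s * a) / R s ^ 2)).
  change (rho (u s) (v s)) with (R s) in *.
  auto_derive.
  - repeat split; try (eexists; eassumption); lra.
  - rewrite (Derive_eq u _ _ Hu), (Derive_eq v _ _ Hv),
      (Derive_eq R _ _ Hrho).
    set (r := R s) in *; set (x := u s) in *; set (y := v s) in *.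
    assert (E : 1 + y * / (x + r) * (y * / (x + r) * 1) = 2 * r / (x + r)).
    { transitivity (((x + r) * (x + r) + y * y) / ((x + r) * (x + r))); [field; lra |].
      replace ((x + r) * (x + r) + y * y) with (2 * r * (x + r)) by nra; field; lra. }
    rewrite E.
    transitivity (((x + r) * (r * b - y * a) - (y * y) * b) / (r * r * (x + r))); [field; lra |].
    replace (y * y) with ((x + r) * (r - x)) by lra; field; lra.
Qed.

Section PowerPath.

Variables (u v : R -> R) (s a b : R).
Hypothesis Hu : is_derive u s a.
Hypothesis Hv : is_derive v s b.
Hypothesis Hs : 0 < u s + rho (u s) (v s).

(** These are the components of [(w^q)' = q w^(q-1) w']; the exponent drops by one through
    [(q - 1) theta = q theta - theta] and [cos theta = u / rho], [sin theta = v / rho]. *)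
Lemma is_derive_RP_IP (q : R) :
  is_derive (fun x => RP q (u x) (v x)) s
    (q * (RP (q - 1) (u s) (v s) * a - IP (q - 1) (u s) (v s) * b)) /\
  is_derive (fun x => IP q (u x) (v x)) s
    (q * (RP (q - 1) (u s) (v s) * b + IP (q - 1) (u s) (v s) * a)).
Proof.
  assert (Hr := slit_rho_pos _ _ Hs).
  assert (Hrho := is_derive_rho u v s a b Hu Hv Hr).
  assert (Hth := is_derive_theta u v s a b Hu Hv Hs).
  assert (Hc := cos_theta _ _ Hs); assert (Hsn := sin_theta _ _ Hs).
  unfold RP, IP; rewrite Rpower_minus_1 by exact Hr.
  replace ((q - 1) * theta (u s) (v s)) with (q * theta (u s) (v s) - theta (u s) (v s)) by ring.
  rewrite cos_minus, sin_minus.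
  set (R := fun x => rho (u x) (v x)) in *; set (H := fun x => theta (u x) (v x)) in *.
  change (rho (u s) (v s)) with (R s) in *; change (theta (u s) (v s)) with (H s) in *.
  assert (Ec : cos (H s) = u s / R s) by (rewrite <- Hc; field; lra).
  assert (Es : sin (H s) = v s / R s) by (rewrite <- Hsn; field; lra).
  rewrite Ec, Es.
  split.
  - change (is_derive (fun x => exp (q * ln (R x)) * cos (q * H x)) s
      (q * (exp (q * ln (R s)) / R s * (cos (q * H s) * (u s / R s) + sin (q * H s) * (v s / R s)) * a -
        exp (q * ln (R s)) / R s * (sin (q * H s) * (u s / R s) - cos (q * H s) * (v s / R s)) * b))).
    auto_derive.
    + repeat split; try (eexists; eassumption); exact Hr.
    + rewrite (Derive_eq R _ _ Hrho), (Derive_eq H _ _ Hth).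
      field; lra.
  - change (is_derive (fun x => exp (q * ln (R x)) * sin (q * H x)) s
      (q * (exp (q * ln (R s)) / R s * (cos (q * H s) * (u s / R s) + sin (q * H s) * (v s / R s)) * b +
        exp (q * ln (R s)) / R s * (sin (q * H s) * (u s / R s) - cos (q * H s) * (v s / R s)) * a))).
    auto_derive.
    + repeat split; try (eexists; eassumption); exact Hr.
    + rewrite (Derive_eq R _ _ Hrho), (Derive_eq H _ _ Hth).
      field; lra.
Qed.

End PowerPath.

Section Energy.

Variables (p kap eps : R).
Hypothesis Heps : 0 < eps.

Definition energy (u v : R) : R := kap * Rpower (u * u + eps) (p / 2) + RP p u v.

(** [denergy] and [ddenergy] are the first and second derivatives of [energy] along a path with
    velocity [(a, b)] and acceleration [(a2, b2)]. Closed forms make continuity and the sign of the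
    Laplacian accessible. *)
Definition denergy (u v a b : R) : R :=
  kap * (p * u * Rpower (u * u + eps) (p / 2 - 1) * a) + p * (RP (p - 1) u v * a - IP (p - 1) u v * b).

Definition ddenergy (u v a b a2 b2 : R) : R :=
  kap * ((p * Rpower (u * u + eps) (p / 2 - 1)
          + p * (p - 2) * (u * u) * Rpower (u * u + eps) (p / 2 - 1 - 1)) * (a * a)
         + p * u * Rpower (u * u + eps) (p / 2 - 1) * a2)
  + p * ((p - 1) * (RP (p - 1 - 1) u v * (a * a - b * b) - IP (p - 1 - 1) u v * (2 * (a * b)))
         + RP (p - 1) u v * a2 - IP (p - 1) u v * b2).

Lemma is_derive_Q (c : R) (u : R -> R) (s a : R) : is_derive u s a ->
  is_derive (fun x => Rpower (u x * u x + eps) c) s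
    (2 * c * u s * Rpower (u s * u s + eps) (c - 1) * a).
Proof.
  intro Hu; assert (Hpos : 0 < u s * u s + eps) by nra.
  rewrite Rpower_minus_1 by exact Hpos; unfold Rpower; auto_derive.
  - repeat split; try (eexists; eassumption); exact Hpos.
  - rewrite (Derive_eq u _ _ Hu); field; lra.
Qed.

Lemma is_derive_energy (u v : R -> R) (s a b : R) :
  is_derive u s a -> is_derive v s b -> 0 < u s + rho (u s) (v s) ->
  is_derive (fun x => energy (u x) (v x)) s (denergy (u s) (v s) a b).
Proof.
  intros Hu Hv Hs; unfold energy, denergy.
  apply (is_derive_plus (V := R_NormedModule)).
  - apply (is_derive_scal (fun x => Rpower (u x * u x + eps) (p / 2))).
    assert (H := is_derive_Q (p / 2) u s a Hu).
    replace (p * u s) with (2 * (p / 2) * u s) by field; exact H.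
  - apply (is_derive_RP_IP u v s a b Hu Hv Hs p).
Qed.

Lemma is_derive_denergy (u v a b : R -> R) (s a2 b2 : R) :
  is_derive u s (a s) -> is_derive v s (b s) -> is_derive a s a2 -> is_derive b s b2 ->
  0 < u s + rho (u s) (v s) ->
  is_derive (fun x => denergy (u x) (v x) (a x) (b x)) s (ddenergy (u s) (v s) (a s) (b s) a2 b2).
Proof.
  intros Hu Hv Ha Hb Hs; unfold denergy, ddenergy.
  assert (HQ := is_derive_Q (p / 2 - 1) u s (a s) Hu).
  destruct (is_derive_RP_IP u v s (a s) (b s) Hu Hv Hs (p - 1)) as [HR HI].
  set (q := fun x => Rpower (u x * u x + eps) (p / 2 - 1)) in *.
  set (R := fun x => RP (p - 1) (u x) (v x)) in *.
  set (I := fun x => IP (p - 1) (u x) (v x)) in *.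
  change (is_derive (fun x => kap * (p * u x * q x * a x) + p * (R x * a x - I x * b x)) s
   (kap * ((p * q s + p * (p - 2) * (u s * u s) * Rpower (u s * u s + eps) (p / 2 - 1 - 1)) * (a s * a s)
         + p * u s * q s * a2)
  + p * ((p - 1) * (RP (p - 1 - 1) (u s) (v s) * (a s * a s - b s * b s)
           - IP (p - 1 - 1) (u s) (v s) * (2 * (a s * b s))) + R s * a2 - I s * b2))).
  auto_derive.
  - repeat split; eexists; eassumption.
  - rewrite (Derive_eq u _ _ Hu), (Derive_eq a _ _ Ha),
      (Derive_eq b _ _ Hb), (Derive_eq q _ _ HQ),
      (Derive_eq R _ _ HR), (Derive_eq I _ _ HI).
    field.
Qed.

Section Continuity.

Context {S : UniformSpace}.
Variables (u v : S -> R) (x : S).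
Hypothesis Hu : continuous u x.
Hypothesis Hv : continuous v x.
Hypothesis Hs : 0 < u x + rho (u x) (v x).

Lemma continuous_Rpower (w : S -> R) (c : R) :
  continuous w x -> 0 < w x -> continuous (fun y => Rpower (w y) c) x.
Proof.
  intros Hw Hpos; apply (continuous_comp (fun y => c * ln (w y)) exp).
  - apply continuous_Rmult; [apply continuous_const |].
    apply (continuous_comp w ln); [exact Hw | apply continuous_ln, Hpos].
  - apply continuous_exp.
Qed.

Lemma continuous_rho : continuous (fun y => rho (u y) (v y)) x.
Proof.
  apply (continuous_comp (fun y => u y * u y + v y * v y) sqrt).
  - apply continuous_Rplus; apply continuous_Rmult; assumption.
  - apply continuous_sqrt.
Qed.

Lemma continuous_theta : continuous (fun y => theta (u y) (v y)) x.
Proof.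
  unfold theta; apply continuous_Rmult; [apply continuous_const |].
  apply (continuous_comp (fun y => v y / (u y + rho (u y) (v y))) atan).
  - apply continuous_Rmult; [exact Hv |].
    apply continuous_Rinv'; [| lra].
    apply continuous_Rplus; [exact Hu | apply continuous_rho].
  - apply (ex_derive_continuous (V := R_NormedModule)); eexists; apply is_derive_atan.
Qed.

Lemma continuous_RP (c : R) : continuous (fun y => RP c (u y) (v y)) x.
Proof.
  apply continuous_Rmult.
  - apply continuous_Rpower; [apply continuous_rho | apply slit_rho_pos, Hs].
  - apply (continuous_comp (fun y => c * theta (u y) (v y)) cos); [| apply continuous_cos].
    apply continuous_Rmult; [apply continuous_const | apply continuous_theta].
Qed.

Lemma continuous_IP (c : R) : continuous (fun y => IP c (u y) (v y)) x.
Proof.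
  apply continuous_Rmult.
  - apply continuous_Rpower; [apply continuous_rho | apply slit_rho_pos, Hs].
  - apply (continuous_comp (fun y => c * theta (u y) (v y)) sin); [| apply continuous_sin].
    apply continuous_Rmult; [apply continuous_const | apply continuous_theta].
Qed.

Lemma continuous_Q (c : R) : continuous (fun y => Rpower (u y * u y + eps) c) x.
Proof.
  apply continuous_Rpower; [| nra].
  apply continuous_Rplus; [apply continuous_Rmult; exact Hu | apply continuous_const].
Qed.

Lemma continuous_energy : continuous (fun y => energy (u y) (v y)) x.
Proof.
  apply continuous_Rplus; [| apply continuous_RP].
  apply continuous_Rmult; [apply continuous_const | apply continuous_Q].
Qed.

Ltac Rcont :=
  repeat match goal with
  | |- continuous (fun _ => ?k) _ => apply continuous_const
  | |- continuous (fun y => Rpower _ ?c) _ => apply (continuous_Q c)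
  | |- continuous (fun y => RP ?c _ _) _ => apply (continuous_RP c)
  | |- continuous (fun y => IP ?c _ _) _ => apply (continuous_IP c)
  | |- continuous (fun y => @?f y - @?g y) _ => apply (continuous_Rminus f g)
  | |- continuous (fun y => @?f y + @?g y) _ => apply (continuous_Rplus f g)
  | |- continuous (fun y => @?f y * @?g y) _ => apply (continuous_Rmult f g)
  end; try assumption.

Lemma continuous_denergy (a b : S -> R) :
  continuous a x -> continuous b x -> continuous (fun y => denergy (u y) (v y) (a y) (b y)) x.
Proof. intros; unfold denergy; Rcont. Qed.

Lemma continuous_ddenergy (a b a2 b2 : S -> R) :
  continuous a x -> continuous b x -> continuous a2 x -> continuous b2 x ->
  continuous (fun y => ddenergy (u y) (v y) (a y) (b y) (a2 y) (b2 y)) x.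
Proof. intros; unfold ddenergy; Rcont. Qed.

End Continuity.

(* [(a1 + b1, a2 - b2)] and [(- (a2 + b2), a1 - b1)] are the derivatives of [g + conj h] in the two
   conformal directions; the second-order terms [c, d] cancel by harmonicity. *)
Lemma energy_laplacian_nonneg (K s u v a1 a2 b1 b2 c d : R) :
  1 < p <= 2 -> 1 <= K -> 0 < s -> kap = (K ^ 2 - 1) * (1 + s) ->
  0 < rho u v -> u * u + eps <= (1 + s) * (rho u v * rho u v) ->
  4 * (Cmod (a1, a2) * Cmod (b1, b2)) <= (K ^ 2 - 1) * Cmod (Cplus (a1, a2) (b1, b2)) ^ 2 ->
  0 <= ddenergy u v (a1 + b1) (a2 - b2) c d + ddenergy u v (- (a2 + b2)) (a1 - b1) (- c) (- d).
Proof.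
  intros Hp HK Hs Hkap Hr Hue Hqr.
  (* [X + i Y] is [a conj b], so [Rr * X - Ii * Y] is the real part of [f^(p-2) a conj b]. *)
  set (X := a1 * b1 + a2 * b2); set (Y := a2 * b1 - a1 * b2).
  set (N := (a1 + b1) * (a1 + b1) + (a2 + b2) * (a2 + b2)).
  set (q1 := Rpower (u * u + eps) (p / 2 - 1)); set (q2 := Rpower (u * u + eps) (p / 2 - 1 - 1)).
  set (Rr := RP (p - 1 - 1) u v); set (Ii := IP (p - 1 - 1) u v).
  assert (Hpos : 0 < u * u + eps) by nra.
  assert (E : ddenergy u v (a1 + b1) (a2 - b2) c d + ddenergy u v (- (a2 + b2)) (a1 - b1) (- c) (- d) =
    kap * ((p * q1 + p * (p - 2) * (u * u) * q2) * N) + p * (p - 1) * (4 * (Rr * X - Ii * Y))).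
  { unfold ddenergy; fold q1 q2 Rr Ii; unfold X, Y, N; ring. }
  rewrite E; clear E.
  assert (Hq1 : 0 < q1) by apply Rpower_pos.
  assert (Hq2 : 0 < q2) by apply Rpower_pos.
  assert (Eq2 : q1 = (u * u + eps) * q2).
  { unfold q1, q2; rewrite (Rpower_minus_1 _ (p / 2 - 1)) by exact Hpos; field; lra. }
  (* Replacing [u^2] by the larger [u^2 + eps] only decreases the term with the factor
     [p - 2 <= 0]. *)
  assert (Hphi : p * (p - 1) * q1 <= p * q1 + p * (p - 2) * (u * u) * q2).
  { rewrite Eq2.
    assert (0 <= p * (2 - p) * (eps * q2)); [| nra].
    apply Rmult_le_pos; nra. }
  set (r := rho u v) in *.
  set (rp := Rpower r (p - 1 - 1)).
  assert (Hrp : 0 < rp) by apply Rpower_pos.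
  assert (HRI : Rr * Rr + Ii * Ii = rp * rp).
  { unfold Rr, Ii, RP, IP; fold r rp.
    assert (H := sin2_cos2 ((p - 1 - 1) * theta u v)); unfold Rsqr in H.
    transitivity (rp * rp * (sin ((p - 1 - 1) * theta u v) * sin ((p - 1 - 1) * theta u v) +
      cos ((p - 1 - 1) * theta u v) * cos ((p - 1 - 1) * theta u v))); [ring | rewrite H; ring]. }
  set (M := Cmod (a1, a2) * Cmod (b1, b2)) in *.
  assert (HM0 : 0 <= M) by (apply Rmult_le_pos; apply Cmod_ge_0).
  assert (HM2 : M * M = X * X + Y * Y).
  { unfold M.
    assert (H1 := Cmod2_alt (a1, a2)); assert (H2 := Cmod2_alt (b1, b2)); simpl in H1, H2.
    transitivity ((Cmod (a1, a2) * (Cmod (a1, a2) * 1)) * (Cmod (b1, b2) * (Cmod (b1, b2) * 1))); [ring |].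
    rewrite H1, H2; unfold X, Y; ring. }
  assert (HN : Cmod (Cplus (a1, a2) (b1, b2)) ^ 2 = N).
  { rewrite Cmod2_alt; unfold N; simpl; ring. }
  rewrite HN in Hqr.
  assert (HN0 : 0 <= N) by (apply Rplus_le_le_0_compat; apply Rle_0_sqr).
  assert (Hcs : - (rp * M) <= Rr * X - Ii * Y).
  { assert ((Rr * X - Ii * Y) * (Rr * X - Ii * Y) <= (rp * M) * (rp * M)).
    { replace ((rp * M) * (rp * M)) with ((rp * rp) * (M * M)) by ring; rewrite <- HRI, HM2.
      assert (Hsq := Rle_0_sqr (Rr * Y + Ii * X)); unfold Rsqr in Hsq; lra. }
    assert (HrM : 0 <= rp * M) by (apply Rmult_le_pos; lra).
    revert H HrM; generalize (rp * M) (Rr * X - Ii * Y); clear; intros; nra. }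
  (* The exponent [1 - p / 2] is nonnegative, so it can be applied to [u^2 + eps <= (1 + s) r^2]; it
     is at most 1, so [(1 + s)^(1 - p/2) <= 1 + s]. This is why [kap] carries the factor [1 + s]. *)
  assert (Hcomp : rp <= (1 + s) * q1).
  { assert (H2p : 0 <= 1 - p / 2) by lra.
    assert (K1 : Rpower (u * u + eps) (1 - p / 2) <= Rpower ((1 + s) * (r * r)) (1 - p / 2)).
    { apply Rle_Rpower_l; [exact H2p | split; assumption]. }
    assert (K2 : Rpower (1 + s) (1 - p / 2) <= 1 + s).
    { rewrite <- (Rpower_1 (1 + s)) at 2 by lra; apply Rle_Rpower; lra. }
    rewrite <- Rpower_mult_distr in K1 by nra.
    assert (K3 : Rpower (r * r) (1 - p / 2) * rp = 1).
    { rewrite <- Rpower_mult_distr by exact Hr; unfold rp; rewrite <- !Rpower_plus.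
      transitivity (Rpower r 0); [f_equal; field | apply Rpower_O, Hr]. }
    assert (K4 : Rpower (u * u + eps) (1 - p / 2) * q1 = 1).
    { unfold q1; rewrite <- Rpower_plus.
      transitivity (Rpower (u * u + eps) 0); [f_equal; field | apply Rpower_O, Hpos]. }
    assert (P1 := Rpower_pos (r * r) (1 - p / 2)).
    set (y := Rpower (r * r) (1 - p / 2)) in *; set (w := Rpower (u * u + eps) (1 - p / 2)) in *.
    assert (Hw : w <= (1 + s) * y).
    { eapply Rle_trans; [exact K1 | apply Rmult_le_compat_r; lra]. }
    assert (Hwq : w * q1 <= (1 + s) * y * q1) by (apply Rmult_le_compat_r; lra).
    rewrite K4 in Hwq.
    replace rp with (rp * 1) by ring.
    replace ((1 + s) * q1) with (rp * ((1 + s) * y * q1)).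
    - apply Rmult_le_compat_l; lra.
    - transitivity ((y * rp) * ((1 + s) * q1)); [ring | rewrite K3; ring]. }
  assert (HK1 : 0 <= K ^ 2 - 1) by nra.
  assert (Hk0 : 0 <= kap) by (rewrite Hkap; apply Rmult_le_pos; lra).
  assert (S1 : kap * ((p * (p - 1) * q1) * N) <= kap * ((p * q1 + p * (p - 2) * (u * u) * q2) * N)).
  { apply Rmult_le_compat_l; [exact Hk0 |]; apply Rmult_le_compat_r; assumption. }
  assert (S2 : p * (p - 1) * (4 * - (rp * M)) <= p * (p - 1) * (4 * (Rr * X - Ii * Y))).
  { apply Rmult_le_compat_l; [nra | lra]. }
  assert (S3 : rp * (4 * M) <= kap * (q1 * N)).
  { rewrite Hkap.
    apply Rle_trans with (rp * ((K ^ 2 - 1) * N)); [apply Rmult_le_compat_l; lra |].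
    replace ((K ^ 2 - 1) * (1 + s) * (q1 * N)) with (((1 + s) * q1) * ((K ^ 2 - 1) * N)) by ring.
    apply Rmult_le_compat_r; [apply Rmult_le_pos; assumption | exact Hcomp]. }
  assert (S4 : p * (p - 1) * (rp * (4 * M)) <= p * (p - 1) * (kap * (q1 * N))).
  { apply Rmult_le_compat_l; [nra | exact S3]. }
  lra.
Qed.

End Energy.

(** * The sub-mean value property *)

Lemma is_derive_RInt_param_lt (F F1 : R -> R -> R) (X a b : R) : a <= b ->
  (forall x t, x < X -> is_derive (fun y => F y t) x (F1 x t)) ->
  (forall x t, x < X -> continuous (fun q : R * R => F1 (fst q) (snd q)) (x, t)) ->
  (forall x t, x < X -> continuous (F x) t) ->
  forall x, x < X -> is_derive (fun y => RInt (F y) a b) x (RInt (F1 x) a b).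
Proof.
  intros Hab Hd Hc1 Hc x Hx.
  assert (Hpos : 0 < X - x) by lra.
  assert (Hloc : forall y, ball x (mkposreal _ Hpos) y -> y < X).
  { intros y Hy; change (Rabs (y - x) < X - x) in Hy; apply Rabs_def2 in Hy; lra. }
  replace (RInt (F1 x) a b) with (RInt (fun t => Derive (fun u => F u t) x) a b).
  2: { apply RInt_ext; intros t _; apply is_derive_unique, Hd, Hx. }
  apply (is_derive_RInt_param F a b x).
  - exists (mkposreal _ Hpos); intros y Hy t _; eexists; apply Hd, Hloc, Hy.
  - intros t _; apply continuity_2d_pt_ext_loc with F1.
    + exists (mkposreal _ Hpos); intros y s Hy _; symmetry; apply is_derive_unique, Hd, Hloc, Hy.
    + apply continuity_2d_pt_filterlim, Hc1, Hx.
  - exists (mkposreal _ Hpos); intros y Hy.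
    apply (ex_RInt_continuous (V := R_CompleteNormedModule)); intros t _; apply Hc, Hloc, Hy.
Qed.

(** A convex function with a negative slope somewhere tends to [+infinity] to the left; with a
    finite limit there it must be nondecreasing, hence stays above that limit. *)
Lemma convex_ge_limit (m m1 m2 : R -> R) (X l : R) :
  (forall x, x < X -> is_derive m x (m1 x)) ->
  (forall x, x < X -> is_derive m1 x (m2 x)) ->
  (forall x, x < X -> 0 <= m2 x) ->
  (forall eta, 0 < eta -> exists x0, forall x, x < x0 -> x < X -> Rabs (m x - l) <= eta) ->
  forall x, x < X -> l <= m x.
Proof.
  intros H1 H2 Hpos Hlim.
  assert (Hm1 : forall x, x < X -> 0 <= m1 x).
  { intros x1 Hx1; apply Rnot_lt_le; intro Hneg.
    destruct (Hlim 1 Rlt_0_1) as [x0 Hx0].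
    (* At distance [T] to the left of [x1] the tangent at [x1] exceeds [l + 1], and convexity keeps
       [m] above the tangent. *)
    set (T := (Rabs (l + 1 - m x1) + 1) / - m1 x1).
    assert (HT : 0 < T).
    { apply Rdiv_lt_0_compat; [generalize (Rabs_pos (l + 1 - m x1)) |]; lra. }
    assert (ET : T * - m1 x1 = Rabs (l + 1 - m x1) + 1) by (unfold T; field; lra).
    set (y := Rmin x0 x1 - T).
    assert (Y1 := Rmin_l x0 x1); assert (Y2 := Rmin_r x0 x1).
    assert (Hy := Hx0 y ltac:(unfold y; lra) ltac:(unfold y; lra)).
    apply Rabs_le_between in Hy.
    assert (Hdec : m x1 - m1 x1 * x1 <= m y - m1 x1 * y).
    { apply (decreasing_of_deriv (fun x => m x - m1 x1 * x) (fun x => m1 x - m1 x1)).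
      - unfold y; lra.
      - intros x Hx; apply (is_derive_minus (V := R_NormedModule)); [apply H1; lra |].
        auto_derive; [trivial | ring].
      - intros x Hx; assert (m1 x <= m1 x1); [| lra].
        apply (increasing_of_deriv m1 m2); [lra | |]; intros z Hz; [apply H2 | apply Hpos]; lra. }
    assert (Habs := Rle_abs (l + 1 - m x1)).
    assert (T <= x1 - y) by (unfold y; lra).
    assert (T * - m1 x1 <= (x1 - y) * - m1 x1) by (apply Rmult_le_compat_r; lra).
    lra. }
  intros x Hx; apply Rnot_lt_le; intro Hlt.
  destruct (Hlim ((l - m x) / 2)) as [x0 Hx0]; [lra |].
  set (y := Rmin x0 x - 1).
  assert (Y1 := Rmin_l x0 x); assert (Y2 := Rmin_r x0 x).
  assert (Hy := Hx0 y ltac:(unfold y; lra) ltac:(unfold y; lra)).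
  apply Rabs_le_between in Hy.
  assert (m y <= m x); [| lra].
  apply (increasing_of_deriv m m1); [unfold y; lra | |]; intros z Hz; [apply H1 | apply Hm1]; unfold y in Hz; lra.
Qed.

(* Logarithmic polar coordinates: conformal, so that the Laplacian keeps its form. *)
Definition lpol (x t : R) : C := Cmult (RtoC (exp x)) (cis t).

Lemma Cmod_lpol (x t : R) : Cmod (lpol x t) = exp x.
Proof.
  unfold lpol; rewrite Cmod_mult, Cmod_R, Cmod_cis, Rabs_pos_eq; [ring | left; apply exp_pos].
Qed.

Lemma lpol_inD (x t : R) : x < 0 -> inD (lpol x t).
Proof.
  intro H; unfold inD; rewrite Cmod_lpol, <- exp_0; apply exp_increasing, H.
Qed.

Lemma lpol_derive_x (x t : R) : is_path_derive (fun y => lpol y t) x (lpol x t).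
Proof. unfold lpol, cis; split; simpl; auto_derive; trivial; ring. Qed.

Lemma lpol_derive_t (x t : R) : is_path_derive (lpol x) t (Cmult Ci (lpol x t)).
Proof. unfold lpol, cis; split; simpl; auto_derive; trivial; ring. Qed.

Lemma lpol_continuous (q : R * R) : continuous (fun q : R * R => lpol (fst q) (snd q)) q.
Proof.
  unfold lpol; apply continuous_Cmult.
  - apply continuous_pairC; simpl; [| apply continuous_const].
    apply (continuous_comp fst exp); [apply continuous_fst | apply continuous_exp].
  - apply (continuous_comp snd cis); [apply continuous_snd | apply cis_continuous].
Qed.

Section SubMean.

Variables (p K s r0 eps : R) (g h g1 h1 g2 h2 : C -> C).
Hypothesis Hp : 1 < p <= 2.
Hypothesis HK : 1 <= K.
Hypothesis Hs : 0 < s.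
Hypothesis Hr0 : 0 < r0 < 1.
Hypothesis Heps : 0 < eps.
Hypothesis Hg : forall z, inD z -> is_Cderive g z (g1 z).
Hypothesis Hh : forall z, inD z -> is_Cderive h z (h1 z).
Hypothesis Hg1 : forall z, inD z -> is_Cderive g1 z (g2 z).
Hypothesis Hh1 : forall z, inD z -> is_Cderive h1 z (h2 z).
Hypothesis Hg2 : forall z, inD z -> continuous g2 z.
Hypothesis Hh2 : forall z, inD z -> continuous h2 z.
Hypothesis Hqr : forall z, inD z ->
  4 * (Cmod (g1 z) * Cmod (h1 z)) <= (K ^ 2 - 1) * Cmod (Cplus (g1 z) (h1 z)) ^ 2.

Let u (z : C) : R := Re (g z) + Re (h z) + s.
Let v (z : C) : R := Im (g z) - Im (h z).

Hypothesis Hslit : forall z, inD z -> 0 < u z + rho (u z) (v z).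
Hypothesis Hlow : forall z, Cmod z < r0 -> eps <= s * (rho (u z) (v z) * rho (u z) (v z)).

Let kap := (K ^ 2 - 1) * (1 + s).
(** With [z = e^(x + it)], [G1] and [G2] are the first and second derivatives of [g] in the variable
    [x + it]; [H1] and [H2] are those of [h]. *)
Let G1 z := Cmult (g1 z) z.
Let H1 z := Cmult (h1 z) z.
Let G2 z := Cmult (Cplus (Cmult (g2 z) z) (Cmult (g1 z) (RtoC 1))) z.
Let H2 z := Cmult (Cplus (Cmult (h2 z) z) (Cmult (h1 z) (RtoC 1))) z.
Let ux z := Re (G1 z) + Re (H1 z).
Let vx z := Im (G1 z) - Im (H1 z).
(** The angular derivative multiplies the radial one by [i] on [g] and by [-i] on [conj h]; done
    twice, this gives [- uxx] and [- vxx], which is harmonicity. *)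
Let ut z := - (Im (G1 z) + Im (H1 z)).
Let vt z := Re (G1 z) - Re (H1 z).
Let uxx z := Re (G2 z) + Re (H2 z).
Let vxx z := Im (G2 z) - Im (H2 z).

Let cont_lpol (phi : C -> R) (x t : R) :
  continuous phi (lpol x t) -> continuous (fun q : R * R => phi (lpol (fst q) (snd q))) (x, t).
Proof.
  intro H; apply (continuous_comp (fun q : R * R => lpol (fst q) (snd q)) phi);
    [apply lpol_continuous | exact H].
Qed.

Let cont_lpol_t (phi : C -> R) (x t : R) :
  continuous phi (lpol x t) -> continuous (fun t => phi (lpol x t)) t.
Proof.
  intro H; apply (continuous_comp (lpol x) phi); [| exact H].
  eapply is_path_derive_continuous, lpol_derive_t.
Qed.

Let contC (phi psi : C -> C) z : continuous phi z -> continuous psi z ->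
  continuous (fun z => Re (phi z) + Re (psi z)) z /\ continuous (fun z => Im (phi z) - Im (psi z)) z /\
  continuous (fun z => Re (phi z) - Re (psi z)) z /\ continuous (fun z => - (Im (phi z) + Im (psi z))) z.
Proof.
  intros H H'.
  assert (A1 := continuous_fstC _ _ H); assert (A2 := continuous_sndC _ _ H).
  assert (A3 := continuous_fstC _ _ H'); assert (A4 := continuous_sndC _ _ H').
  repeat split; [apply continuous_Rplus | apply continuous_Rminus | apply continuous_Rminus |
    apply continuous_Ropp, continuous_Rplus]; assumption.
Qed.

Let cg z : inD z -> continuous g z.
Proof. intro H; eapply is_Cderive_continuous, Hg, H. Qed.
Let ch z : inD z -> continuous h z.
Proof. intro H; eapply is_Cderive_continuous, Hh, H. Qed.
Let cg1 z : inD z -> continuous g1 z.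
Proof. intro H; eapply is_Cderive_continuous, Hg1, H. Qed.
Let ch1 z : inD z -> continuous h1 z.
Proof. intro H; eapply is_Cderive_continuous, Hh1, H. Qed.
Let cG1 z : inD z -> continuous G1 z.
Proof. intro H; apply continuous_Cmult; [apply cg1, H | apply continuous_id]. Qed.
Let cH1 z : inD z -> continuous H1 z.
Proof. intro H; apply continuous_Cmult; [apply ch1, H | apply continuous_id]. Qed.
Let cG2 z : inD z -> continuous G2 z.
Proof.
  intro H; apply continuous_Cmult; [| apply continuous_id].
  apply continuous_Cplus; apply continuous_Cmult;
    [apply Hg2, H | apply continuous_id | apply cg1, H | apply continuous_const].
Qed.
Let cH2 z : inD z -> continuous H2 z.
Proof.
  intro H; apply continuous_Cmult; [| apply continuous_id].
  apply continuous_Cplus; apply continuous_Cmult;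
    [apply Hh2, H | apply continuous_id | apply ch1, H | apply continuous_const].
Qed.

Let cu z : inD z -> continuous u z.
Proof.
  intro H; apply continuous_Rplus; [apply (contC g h z); auto | apply continuous_const].
Qed.
Let cv z : inD z -> continuous v z.
Proof. intro H; apply (contC g h z); auto. Qed.
Let cux z : inD z -> continuous ux z.
Proof. intro H; apply (contC G1 H1 z); auto. Qed.
Let cvx z : inD z -> continuous vx z.
Proof. intro H; apply (contC G1 H1 z); auto. Qed.
Let cut z : inD z -> continuous ut z.
Proof. intro H; apply (contC G1 H1 z); auto. Qed.
Let cvt z : inD z -> continuous vt z.
Proof. intro H; apply (contC G1 H1 z); auto. Qed.
Let cuxx z : inD z -> continuous uxx z.
Proof. intro H; apply (contC G2 H2 z); auto. Qed.
Let cvxx z : inD z -> continuous vxx z.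
Proof. intro H; apply (contC G2 H2 z); auto. Qed.

Let dx (phi : C -> C) (l : C) x t : is_Cderive phi (lpol x t) l ->
  is_path_derive (fun y => phi (lpol y t)) x (Cmult l (lpol x t)).
Proof. intro H; apply is_path_derive_comp; [exact H | apply lpol_derive_x]. Qed.

Let dt (phi : C -> C) (l : C) x t : is_Cderive phi (lpol x t) l ->
  is_path_derive (fun y => phi (lpol x y)) t (Cmult l (Cmult Ci (lpol x t))).
Proof. intro H; apply (is_path_derive_comp phi (lpol x)); [exact H | apply lpol_derive_t]. Qed.

Let DG1 z : inD z -> is_Cderive G1 z (Cplus (Cmult (g2 z) z) (Cmult (g1 z) (RtoC 1))).
Proof. intro H; apply is_Cderive_mult; [apply Hg1, H | apply is_Cderive_id]. Qed.
Let DH1 z : inD z -> is_Cderive H1 z (Cplus (Cmult (h2 z) z) (Cmult (h1 z) (RtoC 1))).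
Proof. intro H; apply is_Cderive_mult; [apply Hh1, H | apply is_Cderive_id]. Qed.

Let X := ln r0.
Let X_lt x : x < X -> x < 0.
Proof. intro H; assert (ln r0 < 0) by (rewrite <- ln_1; apply ln_increasing; lra); unfold X in H; lra. Qed.

Let Ein x t : x < X -> inD (lpol x t).
Proof. intro H; apply lpol_inD, X_lt, H. Qed.

Let der_u_x x t : x < X -> is_derive (fun y => u (lpol y t)) x (ux (lpol x t)).
Proof.
  intro H; destruct (dx g _ x t (Hg _ (Ein x t H))) as [A1 _]; destruct (dx h _ x t (Hh _ (Ein x t H))) as [B1 _].
  replace (ux (lpol x t)) with (ux (lpol x t) + 0) by ring.
  apply (is_derive_plus (V := R_NormedModule)); [| apply (is_derive_const (V := R_NormedModule))].
  exact (is_derive_plus (V := R_NormedModule) _ _ _ _ _ A1 B1).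
Qed.
Let der_v_x x t : x < X -> is_derive (fun y => v (lpol y t)) x (vx (lpol x t)).
Proof.
  intro H; destruct (dx g _ x t (Hg _ (Ein x t H))) as [_ A2]; destruct (dx h _ x t (Hh _ (Ein x t H))) as [_ B2].
  exact (is_derive_minus (V := R_NormedModule) _ _ _ _ _ A2 B2).
Qed.
Let der_ux_x x t : x < X -> is_derive (fun y => ux (lpol y t)) x (uxx (lpol x t)).
Proof.
  intro H; destruct (dx G1 _ x t (DG1 _ (Ein x t H))) as [A1 _]; destruct (dx H1 _ x t (DH1 _ (Ein x t H))) as [B1 _].
  exact (is_derive_plus (V := R_NormedModule) _ _ _ _ _ A1 B1).
Qed.
Let der_vx_x x t : x < X -> is_derive (fun y => vx (lpol y t)) x (vxx (lpol x t)).
Proof.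
  intro H; destruct (dx G1 _ x t (DG1 _ (Ein x t H))) as [_ A2]; destruct (dx H1 _ x t (DH1 _ (Ein x t H))) as [_ B2].
  exact (is_derive_minus (V := R_NormedModule) _ _ _ _ _ A2 B2).
Qed.
Let der_u_t x t : x < X -> is_derive (fun y => u (lpol x y)) t (ut (lpol x t)).
Proof.
  intro H; destruct (dt g _ x t (Hg _ (Ein x t H))) as [A1 _]; destruct (dt h _ x t (Hh _ (Ein x t H))) as [B1 _].
  assert (D := is_derive_plus (V := R_NormedModule) _ _ _ _ _
    (is_derive_plus (V := R_NormedModule) _ _ _ _ _ A1 B1) (is_derive_const (V := R_NormedModule) s t)).
  match type of D with is_derive _ _ ?l => replace (ut (lpol x t)) with l; [exact D |] end.
  unfold ut, G1, H1, plus, zero; simpl; unfold lpol; simpl; ring.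
Qed.
Let der_v_t x t : x < X -> is_derive (fun y => v (lpol x y)) t (vt (lpol x t)).
Proof.
  intro H; destruct (dt g _ x t (Hg _ (Ein x t H))) as [_ A2]; destruct (dt h _ x t (Hh _ (Ein x t H))) as [_ B2].
  assert (D := is_derive_minus (V := R_NormedModule) _ _ _ _ _ A2 B2).
  match type of D with is_derive _ _ ?l => replace (vt (lpol x t)) with l; [exact D |] end.
  unfold vt, G1, H1, minus, plus, opp; simpl; unfold lpol; simpl; ring.
Qed.
Let der_ut_t x t : x < X -> is_derive (fun y => ut (lpol x y)) t (- uxx (lpol x t)).
Proof.
  intro H; destruct (dt G1 _ x t (DG1 _ (Ein x t H))) as [_ A2]; destruct (dt H1 _ x t (DH1 _ (Ein x t H))) as [_ B2].
  assert (D := is_derive_opp (V := R_NormedModule) _ _ _ (is_derive_plus (V := R_NormedModule) _ _ _ _ _ A2 B2)).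
  match type of D with is_derive _ _ ?l => replace (- uxx (lpol x t)) with l; [exact D |] end.
  unfold uxx, G2, H2, plus, opp; simpl; unfold lpol; simpl; ring.
Qed.
Let der_vt_t x t : x < X -> is_derive (fun y => vt (lpol x y)) t (- vxx (lpol x t)).
Proof.
  intro H; destruct (dt G1 _ x t (DG1 _ (Ein x t H))) as [A1 _]; destruct (dt H1 _ x t (DH1 _ (Ein x t H))) as [B1 _].
  assert (D := is_derive_minus (V := R_NormedModule) _ _ _ _ _ A1 B1).
  match type of D with is_derive _ _ ?l => replace (- vxx (lpol x t)) with l; [exact D |] end.
  unfold vxx, G2, H2, minus, plus, opp; simpl; unfold lpol; simpl; ring.
Qed.

Let F0 x t := energy p kap eps (u (lpol x t)) (v (lpol x t)).
Let F1 x t := denergy p kap eps (u (lpol x t)) (v (lpol x t)) (ux (lpol x t)) (vx (lpol x t)).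
Let F2 x t := ddenergy p kap eps (u (lpol x t)) (v (lpol x t)) (ux (lpol x t)) (vx (lpol x t))
                (uxx (lpol x t)) (vxx (lpol x t)).
Let F1t x t := denergy p kap eps (u (lpol x t)) (v (lpol x t)) (ut (lpol x t)) (vt (lpol x t)).
Let F2t x t := ddenergy p kap eps (u (lpol x t)) (v (lpol x t)) (ut (lpol x t)) (vt (lpol x t))
                (- uxx (lpol x t)) (- vxx (lpol x t)).

Let F2_cont x t : x < X -> continuous (fun q : R * R => F2 (fst q) (snd q)) (x, t).
Proof.
  intro H; assert (Hz := Ein x t H).
  apply (cont_lpol (fun z => ddenergy p kap eps (u z) (v z) (ux z) (vx z) (uxx z) (vxx z))).
  apply continuous_ddenergy; auto.
Qed.

Let F1_cont x t : x < X -> continuous (fun q : R * R => F1 (fst q) (snd q)) (x, t).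
Proof.
  intro H; assert (Hz := Ein x t H).
  apply (cont_lpol (fun z => denergy p kap eps (u z) (v z) (ux z) (vx z))).
  apply continuous_denergy; auto.
Qed.

Let F0_cont_t x t : x < X -> continuous (F0 x) t.
Proof.
  intro H; assert (Hz := Ein x t H).
  apply (cont_lpol_t (fun z => energy p kap eps (u z) (v z))); apply continuous_energy; auto.
Qed.

Let F1_cont_t x t : x < X -> continuous (F1 x) t.
Proof.
  intro H; assert (Hz := Ein x t H).
  apply (cont_lpol_t (fun z => denergy p kap eps (u z) (v z) (ux z) (vx z))); apply continuous_denergy; auto.
Qed.

Let F2_cont_t x t : x < X -> continuous (F2 x) t.
Proof.
  intro H; assert (Hz := Ein x t H).
  apply (cont_lpol_t (fun z => ddenergy p kap eps (u z) (v z) (ux z) (vx z) (uxx z) (vxx z)));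
    apply continuous_ddenergy; auto.
Qed.

Let F2t_cont_t x t : x < X -> continuous (F2t x) t.
Proof.
  intro H; assert (Hz := Ein x t H).
  apply (cont_lpol_t (fun z => ddenergy p kap eps (u z) (v z) (ut z) (vt z) (- uxx z) (- vxx z)));
    apply continuous_ddenergy; auto; apply continuous_Ropp; auto.
Qed.

(** The angular second derivative [F2t] integrates to 0, so the integral equals that of the
    Laplacian [F2 + F2t], which is pointwise nonnegative. *)
Let F2_int_nonneg x : x < X -> 0 <= RInt (F2 x) 0 (2 * PI).
Proof.
  intro H; assert (Hpi := PI_RGT_0).
  assert (It : is_RInt (F2t x) 0 (2 * PI) 0).
  { replace 0 with (minus (F1t x (2 * PI)) (F1t x 0)) at 2.
    2: { unfold F1t, lpol; rewrite cis_2PI; unfold minus, plus, opp; simpl; ring. }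
    apply (is_RInt_derive (V := R_CompleteNormedModule) (F1t x)).
    - intros t _; apply (is_derive_denergy p kap eps Heps (fun t => u (lpol x t)) (fun t => v (lpol x t))
        (fun t => ut (lpol x t)) (fun t => vt (lpol x t))); auto.
    - intros t _; apply F2t_cont_t, H. }
  assert (I2 : is_RInt (F2 x) 0 (2 * PI) (RInt (F2 x) 0 (2 * PI))).
  { apply (RInt_correct (V := R_CompleteNormedModule)), (ex_RInt_continuous (V := R_CompleteNormedModule)).
    intros t _; apply F2_cont_t, H. }
  assert (IS := is_RInt_plus (V := R_NormedModule) _ _ _ _ _ _ I2 It).
  replace (RInt (F2 x) 0 (2 * PI)) with (plus (RInt (F2 x) 0 (2 * PI)) 0).
  2: { unfold plus; simpl; ring. }
  apply (is_RInt_ge_0 (fun t => plus (F2 x t) (F2t x t)) 0 (2 * PI)); [lra | exact IS |].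
  intros t _.
  assert (Hz := Ein x t H).
  assert (Hm : Cmod (lpol x t) < r0).
  { rewrite Cmod_lpol, <- (exp_ln r0) by lra; apply exp_increasing, H. }
  set (z := lpol x t) in *.
  assert (Hrho : 0 < rho (u z) (v z)) by (apply slit_rho_pos, Hslit, Hz).
  assert (L := energy_laplacian_nonneg p kap eps Heps K s (u z) (v z)
    (Re (G1 z)) (Im (G1 z)) (Re (H1 z)) (Im (H1 z)) (uxx z) (vxx z) Hp HK Hs eq_refl Hrho).
  apply L.
  (* Here [u^2 <= rho^2] is combined with [eps <= s * rho^2]. *)
  - rewrite rho_sqr; specialize (Hlow z Hm); rewrite rho_sqr in Hlow.
    assert (0 <= v z * v z) by nra; lra.
  - change (4 * (Cmod (G1 z) * Cmod (H1 z)) <= (K ^ 2 - 1) * Cmod (Cplus (G1 z) (H1 z)) ^ 2).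
    replace (Cplus (G1 z) (H1 z)) with (Cmult (Cplus (g1 z) (h1 z)) z) by (unfold G1, H1; ring).
    unfold G1, H1; rewrite !Cmod_mult, Rpow_mult_distr.
    specialize (Hqr z Hz); assert (0 <= Cmod z ^ 2) by apply pow2_ge_0; nra.
Qed.

(** As a function of [x] the integral over the circle of radius [e^x] is convex, and by continuity
    at the origin it tends to [2 * PI] times the central value as [x] goes to [-infinity]. *)
Lemma energy_submean (x : R) : x < ln r0 ->
  2 * PI * energy p kap eps (u (RtoC 0)) (v (RtoC 0)) <=
  RInt (fun t => energy p kap eps (u (lpol x t)) (v (lpol x t))) 0 (2 * PI).
Proof.
  assert (Hpi := PI_RGT_0).
  apply (convex_ge_limit (fun x => RInt (F0 x) 0 (2 * PI)) (fun x => RInt (F1 x) 0 (2 * PI))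
    (fun x => RInt (F2 x) 0 (2 * PI)) X).
  - apply is_derive_RInt_param_lt; auto; [lra |].
    intros y t Hy; apply is_derive_energy; auto.
  - apply is_derive_RInt_param_lt; auto; [lra |].
    intros y t Hy; apply (is_derive_denergy p kap eps Heps (fun y => u (lpol y t)) (fun y => v (lpol y t))
        (fun y => ux (lpol y t)) (fun y => vx (lpol y t))); auto.
  - exact F2_int_nonneg.
  - intros eta Heta.
    assert (H0 : inD (RtoC 0)) by (unfold inD; rewrite Cmod_0; lra).
    assert (Hc : continuous (fun z => energy p kap eps (u z) (v z)) (RtoC 0)) by (apply continuous_energy; auto).
    assert (Hc' := proj1 (continuous_epsC (fun z => RtoC (energy p kap eps (u z) (v z))) (RtoC 0))
      (continuous_pairC (fun z => RtoC (energy p kap eps (u z) (v z))) (RtoC 0) Hc (continuous_const _ _))).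
    destruct (Hc' (eta / (2 * PI))) as [d [Hd1 Hd2]]; [apply Rdiv_lt_0_compat; lra |].
    exists (ln d); intros y Hy HyX.
    set (e0 := energy p kap eps (u (RtoC 0)) (v (RtoC 0))) in *.
    assert (Hex : ex_RInt (F0 y) 0 (2 * PI)).
    { apply (ex_RInt_continuous (V := R_CompleteNormedModule)); intros t _; apply F0_cont_t, HyX. }
    assert (Hexm : ex_RInt (fun t => F0 y t - e0) 0 (2 * PI)).
    { apply (ex_RInt_minus (V := R_NormedModule)); [exact Hex | apply ex_RInt_const]. }
    replace (RInt (F0 y) 0 (2 * PI) - 2 * PI * e0) with (RInt (fun t => F0 y t - e0) 0 (2 * PI)).
    2: { rewrite (RInt_minus (V := R_CompleteNormedModule) (F0 y) (fun _ => e0)) by (assumption || apply ex_RInt_const).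
         rewrite RInt_const; unfold minus, plus, opp, scal; simpl; unfold mult; simpl; ring. }
    replace eta with ((2 * PI - 0) * (eta / (2 * PI))) by (field; lra).
    apply abs_RInt_le_const; [lra | exact Hexm |].
    intros t _; left.
    specialize (Hd2 (lpol y t)).
    rewrite <- RtoC_minus, Cmod_R in Hd2; apply Hd2.
    unfold Cminus; rewrite <- RtoC_opp, Ropp_0, Cplus_0_r, Cmod_lpol, <- (exp_ln d) by exact Hd1.
    apply exp_increasing, Hy.
Qed.

End SubMean.

(** * Integral estimates *)

Lemma rpow_le (x y a : R) : 0 <= a -> x <= y -> rpow x a <= rpow y a.
Proof.
  intros Ha Hxy; destruct (Rle_dec x 0) as [Hx | Hx].
  - rewrite (rpow_npos_eq x) by exact Hx; apply rpow_ge_0.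
  - rewrite !rpow_pos_eq by lra; apply Rle_Rpower_l; lra.
Qed.

Lemma rpow_mult (x y a : R) : 0 <= x -> 0 <= y -> rpow (x * y) a = rpow x a * rpow y a.
Proof.
  intros [Hx | <-] Hy.
  - destruct Hy as [Hy | <-].
    + rewrite !rpow_pos_eq by nra; symmetry; apply Rpower_mult_distr; assumption.
    + rewrite Rmult_0_r, (rpow_npos_eq 0) by lra; ring.
  - rewrite Rmult_0_l, (rpow_npos_eq 0) by lra; ring.
Qed.

Section RpowLipschitz.

Variable p : R.
Hypothesis Hp : 1 < p <= 2.

(** Mean value theorem, all intermediate points being at most [M + 2]; for [y = 0] one writes
    [h^p = h^(p-1) h]. The range up to 2 accommodates the increment [2 * s] with [s < 1]. *)
Lemma rpow_lipschitz (M y h : R) : 0 <= y <= M -> 0 <= h <= 2 ->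
  rpow (y + h) p <= rpow y p + p * Rpower (M + 2) (p - 1) * h.
Proof.
  intros Hy Hh.
  assert (HR := Rpower_pos (M + 2) (p - 1)).
  destruct Hh as [[Hh | <-] Hh2]; [| rewrite Rplus_0_r, Rmult_0_r; lra].
  assert (Hmon : forall c, 0 < c <= M + 2 -> Rpower c (p - 1) <= Rpower (M + 2) (p - 1)).
  { intros c Hc; apply Rle_Rpower_l; lra. }
  destruct Hy as [[Hy | <-] HyM].
  - rewrite !rpow_pos_eq by lra.
    destruct (MVT_cor2 (fun x => Rpower x p) (fun x => p * Rpower x (p - 1)) y (y + h)) as [c [Hc1 Hc2]].
    + lra.
    + intros c Hc; apply is_derive_Reals; rewrite Rpower_minus_1 by lra.
      unfold Rpower; auto_derive; [lra | field; lra].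
    + specialize (Hmon c ltac:(lra)).
      replace (y + h - y) with h in Hc1 by ring.
      assert (p * Rpower c (p - 1) * h <= p * Rpower (M + 2) (p - 1) * h); [| lra].
      apply Rmult_le_compat_r; [lra |]; apply Rmult_le_compat_l; lra.
  - rewrite Rplus_0_l, (rpow_npos_eq 0), rpow_pos_eq by lra.
    specialize (Hmon h ltac:(lra)).
    replace (Rpower h p) with (Rpower h (p - 1) * h) by (rewrite Rpower_minus_1 by exact Hh; field; lra).
    assert (Rpower h (p - 1) * h <= Rpower (M + 2) (p - 1) * h) by (apply Rmult_le_compat_r; lra).
    assert (0 <= (p - 1) * (Rpower (M + 2) (p - 1) * h)) by (apply Rmult_le_pos; nra); lra.
Qed.

Lemma continuous_rpow (x : R) : continuous (fun y => rpow y p) x.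
Proof.
  destruct (Rtotal_order x 0) as [Hx | [-> | Hx]].
  - assert (H : 0 < - x) by lra.
    apply continuous_ext_loc with (fun _ => 0); [| apply continuous_const].
    exists (mkposreal _ H); intros y Hy; change (Rabs (y - x) < - x) in Hy.
    apply Rabs_def2 in Hy; symmetry; apply rpow_npos_eq; lra.
  - intros P [eps HP]; change (locally 0 (fun y => P (rpow y p))).
    assert (He : 0 < Rmin 1 eps) by (apply Rmin_pos; [lra | apply cond_pos]).
    exists (mkposreal _ He); intros y Hy; change (Rabs (y - 0) < Rmin 1 eps) in Hy.
    apply HP; change (Rabs (rpow y p - rpow 0 p) < eps).
    rewrite (rpow_npos_eq 0), Rminus_0_r, Rabs_pos_eq by (lra || apply rpow_ge_0).
    rewrite Rminus_0_r in Hy; apply Rabs_def2 in Hy.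
    assert (M1 := Rmin_l 1 eps); assert (M2 := Rmin_r 1 eps).
    destruct (Rle_dec y 0) as [H0 | H0]; [rewrite rpow_npos_eq by exact H0; apply cond_pos |].
    rewrite rpow_pos_eq by lra.
    apply Rle_lt_trans with y; [| lra].
    replace (Rpower y p) with (Rpower y (p - 1) * y) by (rewrite Rpower_minus_1 by lra; field; lra).
    assert (Rpower y (p - 1) <= 1); [| nra].
    apply Rle_trans with (Rpower 1 (p - 1)); [apply Rle_Rpower_l; lra |].
    unfold Rpower; rewrite ln_1, Rmult_0_r, exp_0; lra.
  - apply continuous_ext_loc with (fun y => Rpower y p).
    + exists (mkposreal _ Hx); intros y Hy; change (Rabs (y - x) < x) in Hy.
      apply Rabs_def2 in Hy; symmetry; apply rpow_pos_eq; lra.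
    + apply (continuous_Rpower x (fun y => y) p); [apply continuous_id | exact Hx].
Qed.

(** The trigonometric inequality at the angle of [(U, V)] is multiplied by [rho^p], with
    [rho |cos theta| = |U|] and [|U|^p <= (U^2 + eps)^(p/2)]. *)
Lemma polar_pointwise (A B S U V eps : R) :
  0 <= A -> 0 < eps -> 0 < U + rho U V ->
  S <= A * rpow (Rabs (cos (theta U V))) p - B * cos (p * theta U V) ->
  rpow (rho U V) p * S <= A * Rpower (U * U + eps) (p / 2) - B * RP p U V.
Proof.
  intros HA He Hs HS.
  assert (Hr := slit_rho_pos U V Hs); assert (Hc := cos_theta U V Hs).
  unfold RP; rewrite (rpow_pos_eq (rho U V)) by exact Hr.
  set (R := Rpower (rho U V) p) in *.
  assert (HR : 0 < R) by apply Rpower_pos.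
  assert (HU : R * rpow (Rabs (cos (theta U V))) p <= Rpower (U * U + eps) (p / 2)).
  { destruct (Req_dec U 0) as [HU | HU].
    - assert (E : cos (theta U V) = 0) by nra.
      rewrite E, Rabs_R0, rpow_npos_eq, Rmult_0_r by lra; left; apply Rpower_pos.
    - assert (E : cos (theta U V) <> 0) by nra.
      rewrite rpow_pos_eq by (apply Rabs_pos_lt, E).
      unfold R; rewrite Rpower_mult_distr by (try apply Rabs_pos_lt; assumption).
      rewrite <- (Rabs_pos_eq (rho U V)) at 1 by lra.
      rewrite <- Rabs_mult, Hc.
      assert (HaU := Rabs_pos_lt U HU).
      apply Rle_trans with (Rpower (Rabs U * Rabs U) (p / 2)).
      + rewrite <- Rpower_mult_distr, <- Rpower_plus by exact HaU.
        right; f_equal; field.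
      + apply Rle_Rpower_l; [lra |]; rewrite <- Rabs_mult, Rabs_pos_eq by nra; nra. }
  assert (K1 : R * S <= R * (A * rpow (Rabs (cos (theta U V))) p - B * cos (p * theta U V)))
    by (apply Rmult_le_compat_l; lra).
  assert (K2 : A * (R * rpow (Rabs (cos (theta U V))) p) <= A * Rpower (U * U + eps) (p / 2))
    by (apply Rmult_le_compat_l; assumption).
  lra.
Qed.

(** Since [eps <= s^2], [(u + s)^2 + eps <= (|u| + 2 s)^2]: both regularizations amount to an
    increment [2 s] of [|u|]. *)
Lemma shifted_square_le (u s eps : R) : 0 < s -> 0 < eps <= s * s ->
  Rpower ((u + s) * (u + s) + eps) (p / 2) <= rpow (Rabs u + 2 * s) p.
Proof.
  intros Hs He; assert (Ha := Rabs_pos u).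
  rewrite rpow_pos_eq by lra.
  apply Rle_trans with (Rpower ((Rabs u + 2 * s) * (Rabs u + 2 * s)) (p / 2)).
  - assert (Hsq := Rle_0_sqr (u + s)); unfold Rsqr in Hsq.
    apply Rle_Rpower_l; [lra |]; split; [lra |].
    assert (E : Rabs u * Rabs u = u * u) by (rewrite <- Rabs_mult; apply Rabs_pos_eq, Rle_0_sqr).
    assert (Hu := Rle_abs u).
    assert (u * s <= Rabs u * s) by (apply Rmult_le_compat_r; lra).
    assert (0 <= Rabs u * s) by (apply Rmult_le_pos; lra); nra.
  - rewrite <- Rpower_mult_distr, <- Rpower_plus by lra; right; f_equal; field.
Qed.

(** The common end of both estimates: integrate the pointwise bound, discard the nonnegative
    integral of the energy, and let [s] tend to 0. The choice of [S] selects the imaginary part or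
    the modulus, and [Cst] absorbs the effect of the shift on [Phi]. *)
Lemma energy_integral_bound (K A B Cst M a b : R) (S : R -> R) (U V Phi : R -> R) :
  a <= b -> 1 <= K -> 0 <= A -> 0 <= B -> 0 <= Cst -> 0 <= M ->
  (forall t, continuous U t) -> (forall t, continuous V t) -> (forall t, continuous Phi t) ->
  (forall t, a <= t <= b -> Rabs (U t) <= M) ->
  (forall s t, 0 < s -> 0 < U t + s + rho (U t + s) (V t)) ->
  (forall s, 0 < s < 1 -> exists eps, 0 < eps <= s * s /\
     0 <= RInt (fun t => energy p ((K ^ 2 - 1) * (1 + s)) eps (U t + s) (V t)) a b) ->
  (forall x, - PI < x < PI -> S x <= A * rpow (Rabs (cos x)) p - B * cos (p * x)) ->
  (forall s t, 0 < s < 1 -> a <= t <= b ->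
     Phi t <= rpow (rho (U t + s) (V t)) p * S (theta (U t + s) (V t)) + Cst * s) ->
  RInt Phi a b <= (A + (K ^ 2 - 1) * B) * RInt (fun t => rpow (Rabs (U t)) p) a b.
Proof.
  intros Hab HK HA HB HC HM HU HV HPhi HUM Hslit Hen HS HPhiS.
  assert (HK2 : 0 <= K ^ 2 - 1) by nra.
  set (k := K ^ 2 - 1) in *.
  assert (HUc : forall t, continuous (fun t => rpow (Rabs (U t)) p) t).
  { intro t; apply (continuous_comp (fun t => Rabs (U t)) (fun y => rpow y p)); [| apply continuous_rpow].
    apply (continuous_comp U Rabs); [apply HU | apply continuous_Rabs]. }
  assert (IU : ex_RInt (fun t => rpow (Rabs (U t)) p) a b)
    by (apply (ex_RInt_continuous (V := R_CompleteNormedModule)); auto).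
  assert (IP : ex_RInt Phi a b) by (apply (ex_RInt_continuous (V := R_CompleteNormedModule)); auto).
  set (Y := RInt (fun t => rpow (Rabs (U t)) p) a b).
  assert (HY : 0 <= Y) by (apply RInt_ge_0; [exact Hab | exact IU | intros; apply rpow_ge_0]).
  set (L := p * Rpower (M + 2) (p - 1)).
  assert (HL : 0 <= L) by (apply Rmult_le_pos; [lra | left; apply Rpower_pos]).
  assert (Hstep : forall s, 0 < s < 1 ->
    RInt Phi a b <= (A + B * (k * (1 + s))) * (Y + (b - a) * (L * (2 * s))) + (b - a) * (Cst * s)).
  { intros s Hs; destruct (Hen s Hs) as [eps [He Hint]].
    set (kap := k * (1 + s)) in *.
    assert (Hkap : 0 <= kap) by (apply Rmult_le_pos; lra).
    set (en := fun t => energy p kap eps (U t + s) (V t)) in *.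
    assert (IE : ex_RInt en a b).
    { apply (ex_RInt_continuous (V := R_CompleteNormedModule)); intros t _.
      apply continuous_energy; [lra | | apply HV | apply Hslit; lra].
      apply continuous_Rplus; [apply HU | apply continuous_const]. }
    assert (IUc := RInt_correct (V := R_CompleteNormedModule) _ _ _ IU).
    assert (IEc := RInt_correct (V := R_CompleteNormedModule) _ _ _ IE).
    set (c := A + B * kap) in *.
    assert (Hc : 0 <= c) by (assert (0 <= B * kap) by (apply Rmult_le_pos; assumption); unfold c; lra).
    assert (ID := is_RInt_plus (V := R_NormedModule) _ _ _ _ _ _
      (is_RInt_plus (V := R_NormedModule) _ _ _ _ _ _
        (is_RInt_scal (V := R_NormedModule) _ _ _ c _ IUc)
        (is_RInt_scal (V := R_NormedModule) _ _ _ (- B) _ IEc))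
      (is_RInt_const (V := R_NormedModule) a b (c * (L * (2 * s)) + Cst * s))).
    eapply Rle_trans.
    { apply (is_RInt_le Phi _ a b _ _ Hab (RInt_correct (V := R_CompleteNormedModule) _ _ _ IP) ID).
      intros t Ht.
      change (Phi t <= c * rpow (Rabs (U t)) p + - B * en t + (c * (L * (2 * s)) + Cst * s)).
      specialize (HPhiS s t Hs ltac:(lra)); specialize (HUM t ltac:(lra)).
      assert (P := polar_pointwise A B (S (theta (U t + s) (V t))) (U t + s) (V t) eps HA ltac:(lra)
        (Hslit s t ltac:(lra)) (HS _ (theta_bounds _ _))).
      assert (Q := shifted_square_le (U t) s eps ltac:(lra) He).
      assert (Q' := rpow_lipschitz M (Rabs (U t)) (2 * s) ltac:(split; [apply Rabs_pos | exact HUM]) ltac:(lra)).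
      fold L in Q'.
      set (q := Rpower ((U t + s) * (U t + s) + eps) (p / 2)) in *.
      (* Hence [A q - B Re (f + s)^p = c q - B en]: the part of unknown sign goes into [en], whose
         integral is nonnegative. *)
      assert (E : en t = kap * q + RP p (U t + s) (V t)) by reflexivity.
      assert (c * q <= c * (rpow (Rabs (U t)) p + L * (2 * s))) by (apply Rmult_le_compat_l; lra).
      unfold c in *; rewrite E; lra. }
    unfold plus, scal; simpl; unfold mult; simpl; fold Y.
    assert (0 <= B * RInt en a b) by (apply Rmult_le_pos; assumption).
    unfold Y; lra. }
  apply Rnot_lt_le; intro Hlt.
  (* [D] collects the error of first order in [s], the term in [s^2] being absorbed by [s^2 <= s]. A
     positive gap is then at most [D * s] for all [s] in [(0, 1)], which fails at [s0]. *)
  set (D := B * k * Y + (A + 2 * (B * k)) * ((b - a) * (L * 2)) + (b - a) * Cst).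
  assert (HBk : 0 <= B * k) by (apply Rmult_le_pos; assumption).
  assert (HbaL : 0 <= (b - a) * (L * 2)) by (apply Rmult_le_pos; lra).
  assert (HD : 0 <= D).
  { unfold D; repeat apply Rplus_le_le_0_compat; apply Rmult_le_pos; try assumption; lra. }
  set (gap := RInt Phi a b - (A + k * B) * Y) in *.
  assert (Hgap : 0 < gap) by (unfold gap; fold Y in Hlt; lra).
  assert (HS' : forall s, 0 < s < 1 -> gap <= D * s).
  { intros s Hs; specialize (Hstep s Hs); unfold gap, D.
    assert (B * k * ((b - a) * (L * 2)) * (s * s) <= B * k * ((b - a) * (L * 2)) * s).
    { apply Rmult_le_compat_l; [apply Rmult_le_pos; assumption | nra]. }
    lra. }
  assert (Hs0 : 0 < gap / (2 * (D + gap))) by (apply Rdiv_lt_0_compat; lra).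
  assert (Es0 : gap / (2 * (D + gap)) * (2 * (D + gap)) = gap) by (field; lra).
  set (s0 := gap / (2 * (D + gap))) in *.
  assert (s0 < 1) by nra.
  specialize (HS' s0 ltac:(lra)); nra.
Qed.

End RpowLipschitz.

(** In [tan (theta / 2) = Y / (X + rho)] a shift to the right leaves [Y] fixed and enlarges the
    denominator, so the argument shrinks in absolute value. *)
Lemma theta_shift_le (x y r s th : R) : 0 < r -> 0 < s -> - (PI / 2) < th < PI / 2 ->
  x = r * cos th -> y = r * sin th -> Rabs (theta (x + s) y) <= Rabs th.
Proof.
  intros Hr Hs Hth -> ->.
  set (a := Rabs th).
  assert (Ha : 0 <= a < PI / 2) by (split; [apply Rabs_pos | apply Rabs_def1; lra]).
  assert (Hc : cos th = cos a).
  { unfold a, Rabs; destruct Rcase_abs; [symmetry; apply cos_neg | reflexivity]. }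
  assert (Hsn : Rabs (sin th) = sin a).
  { assert (Hsa : 0 <= sin a) by (apply sin_ge_0; lra).
    destruct (Rle_dec 0 th).
    - assert (Ea : a = th) by (apply Rabs_pos_eq; lra).
      rewrite Ea in Hsa |- *; apply Rabs_pos_eq, Hsa.
    - assert (Ea : a = - th) by (apply Rabs_left; lra).
      rewrite Ea, sin_neg in Hsa |- *; apply Rabs_left1; lra. }
  set (X := r * cos th + s); set (Y := r * sin th).
  assert (Hca : 0 < cos a) by (apply cos_gt_0; lra).
  assert (HY : Rabs Y = r * sin a) by (unfold Y; rewrite Rabs_mult, Hsn, Rabs_pos_eq; lra).
  assert (HX : r * cos a < X) by (unfold X; rewrite Hc; lra).
  assert (Hrho : r <= rho X Y).
  { assert (E := rho_sqr X Y); assert (E0 := rho_ge_0 X Y).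
    assert (EY : Y * Y = r * sin a * (r * sin a)).
    { rewrite <- HY, <- Rabs_mult, Rabs_pos_eq; nra. }
    assert (T := sin2_cos2 a); unfold Rsqr in T.
    assert (0 < r * cos a) by (apply Rmult_lt_0_compat; lra).
    assert (r * cos a * (r * cos a) <= X * X) by (apply Rmult_le_compat; lra).
    assert (Er : r * r = r * sin a * (r * sin a) + r * cos a * (r * cos a)).
    { transitivity (r * r * (sin a * sin a + cos a * cos a)); [rewrite T; ring | ring]. }
    rewrite EY in E; nra. }
  set (h := a / 2).
  assert (Hch : 0 < cos h) by (apply cos_gt_0; unfold h; lra).
  assert (Eh : sin a = tan h * (1 + cos a)).
  { replace a with (2 * h) by (unfold h; field); rewrite sin_2a, cos_2a_cos; unfold tan; field; lra. }
  assert (Hth0 : 0 <= tan h).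
  { unfold tan; apply Rmult_le_pos; [apply sin_ge_0; unfold h; lra | left; apply Rinv_0_lt_compat, Hch]. }
  assert (Hden : r * (1 + cos a) <= X + rho X Y) by lra.
  assert (Hden0 : 0 < X + rho X Y) by nra.
  assert (Hw : Rabs (Y / (X + rho X Y)) <= tan h).
  { unfold Rdiv; rewrite Rabs_mult, HY, (Rabs_pos_eq (/ _)) by (left; apply Rinv_0_lt_compat, Hden0).
    apply Rmult_le_reg_r with (X + rho X Y); [exact Hden0 |].
    rewrite Rmult_assoc, Rinv_l, Rmult_1_r, Eh by lra.
    replace (r * (tan h * (1 + cos a))) with (tan h * (r * (1 + cos a))) by ring.
    apply Rmult_le_compat_l; assumption. }
  assert (Hat : atan (tan h) = h) by (apply atan_tan; unfold h; lra).
  assert (Hmono : forall x1 x2, x1 <= x2 -> atan x1 <= atan x2).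
  { intros x1 x2 [H | ->]; [left; apply atan_increasing, H | lra]. }
  apply Rabs_le_between in Hw; destruct Hw as [W1 W2].
  apply Hmono in W1; apply Hmono in W2; rewrite atan_opp in W1; rewrite Hat in W1, W2.
  unfold theta; apply Rabs_le; unfold h in *; lra.
Qed.

(** * Integral inequalities for [f] on circles *)

Section MainEstimate.

Variables (p K : R) (f : C -> C).
Hypothesis Hp : 1 < p <= 2.
Hypothesis HK : 1 <= K.
Hypothesis Hharm : harmonic_D f.
Hypothesis Hqr : quasiregular_D K f.
Hypothesis Harg : exists theta, principal_arg (f (RtoC 0)) theta /\
     - (PI / (2 * p)) < theta < PI / (2 * p).
Hypothesis Havoid : forall z, inD z -> ~ (Im (f z) = 0 /\ Re (f z) < 0).

Let zc (r t : R) : C := Cmult (RtoC r) (cis t).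

Lemma slit_shift (s : R) (z : C) : 0 < s -> inD z ->
  0 < Re (f z) + s + rho (Re (f z) + s) (Im (f z)).
Proof.
  intros Hs Hz; apply slit_pos; intro H0.
  assert (~ Re (f z) < 0) by (intro H1; apply (Havoid z Hz); split; assumption); lra.
Qed.

Lemma f_continuous (z : C) : inD z -> continuous f z.
Proof. apply Hqr. Qed.

(** Compactness of the closed disc, by bisecting the square around it and taking the minimum of four
    bounds. The result determines how small [eps] must be compared with [s]. *)
Lemma rho_lower_bound (s r1 : R) : 0 < s -> r1 < 1 ->
  exists m, 0 < m /\ forall z, Cmod z <= r1 -> m <= rho (Re (f z) + s) (Im (f z)).
Proof.
  intros Hs Hr1.
  assert (H : exists m, 0 < m /\ forall x y, -1 <= x <= 1 -> -1 <= y <= 1 -> Cmod (x, y) <= r1 ->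
            m <= rho (Re (f (x, y)) + s) (Im (f (x, y)))).
  { apply (rect_bisection (fun a b c d => exists m, 0 < m /\ forall x y, a <= x <= b -> c <= y <= d ->
       Cmod (x, y) <= r1 -> m <= rho (Re (f (x, y)) + s) (Im (f (x, y))))); try lra.
    - intros a b c d _ _ _ _ _ _ [m1 [P1 Q1]] [m2 [P2 Q2]] [m3 [P3 Q3]] [m4 [P4 Q4]].
      exists (Rmin (Rmin m1 m2) (Rmin m3 m4)); split; [repeat apply Rmin_pos; assumption |].
      intros x y Hx Hy Hxy.
      assert (R1 := Rmin_l (Rmin m1 m2) (Rmin m3 m4)); assert (R2 := Rmin_r (Rmin m1 m2) (Rmin m3 m4)).
      assert (R3 := Rmin_l m1 m2); assert (R4 := Rmin_r m1 m2).
      assert (R5 := Rmin_l m3 m4); assert (R6 := Rmin_r m3 m4).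
      destruct (Rle_dec x ((a + b) / 2)), (Rle_dec y ((c + d) / 2)).
      + specialize (Q1 x y ltac:(lra) ltac:(lra) Hxy); lra.
      + specialize (Q3 x y ltac:(lra) ltac:(lra) Hxy); lra.
      + specialize (Q2 x y ltac:(lra) ltac:(lra) Hxy); lra.
      + specialize (Q4 x y ltac:(lra) ltac:(lra) Hxy); lra.
    - intros x y Hx Hy.
      assert (Hloc : exists m, 0 < m /\ locally ((x, y) : C)
                (fun w : C => Cmod w <= r1 -> m <= rho (Re (f w) + s) (Im (f w)))).
      { destruct (Rle_dec (Cmod (x, y)) r1) as [Hle | Hgt].
        - assert (Hz : inD (x, y)) by (unfold inD; lra).
          assert (Hpos := slit_rho_pos _ _ (slit_shift s (x, y) Hs Hz)).
          set (m := rho (Re (f (x, y)) + s) (Im (f (x, y)))) in *.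
          exists (m / 2); split; [lra |].
          assert (Hc : continuous (fun w => rho (Re (f w) + s) (Im (f w))) (x, y)).
          { apply continuous_rho.
            - apply continuous_Rplus; [apply (continuous_fstC f), f_continuous, Hz | apply continuous_const].
            - apply (continuous_sndC f), f_continuous, Hz. }
          assert (Hm2 : 0 < m / 2) by lra.
          assert (HL : locally ((x, y) : C) (fun w : C => m / 2 <= rho (Re (f w) + s) (Im (f w)))).
          { apply (Hc (fun v => m / 2 <= v)); exists (mkposreal _ Hm2); intros v Hv.
            change (Rabs (v - m) < m / 2) in Hv; apply Rabs_def2 in Hv; lra. }
          revert HL; apply filter_imp; intros w Hw _; exact Hw.
        (* Near a point outside the closed disc the condition is vacuous, so any positive value
           serves. *)
        - exists 1; split; [lra |].
          assert (Hc : continuous (fun w : C => Cmod w) (x, y)) by apply continuous_Cmod, continuous_id.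
          assert (Hd : 0 < Cmod (x, y) - r1) by lra.
          assert (HL : locally ((x, y) : C) (fun w : C => r1 < Cmod w)).
          { apply (Hc (fun v => r1 < v)); exists (mkposreal _ Hd); intros v Hv.
            change (Rabs (v - Cmod (x, y)) < Cmod (x, y) - r1) in Hv; apply Rabs_def2 in Hv; lra. }
          revert HL; apply filter_imp; intros w Hw Hw'; lra. }
      destruct Hloc as [m [Hm [d Hd]]].
      exists d; split; [apply cond_pos |].
      intros a b c e _ _ _ _ Hxab Hyce Hba Hec; exists m; split; [exact Hm |].
      intros x' y' Hx' Hy' Hxy'; apply (Hd (x', y')); [| exact Hxy'].
      split; [change (Rabs (x' - x) < d) | change (Rabs (y' - y) < d)]; apply Rabs_def1; lra. }
  destruct H as [m [Hm H]]; exists m; split; [exact Hm |].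
  intros z Hz; assert (HR := Rmax_Cmod z).
  assert (H1 := Rmax_l (Rabs (fst z)) (Rabs (snd z))); assert (H2 := Rmax_r (Rabs (fst z)) (Rabs (snd z))).
  assert (H3 : Rabs (fst z) <= 1) by lra; assert (H4 : Rabs (snd z) <= 1) by lra.
  apply Rabs_le_between in H3; apply Rabs_le_between in H4.
  destruct z as [x y]; apply H; assumption.
Qed.

(** Shifting to the right does not enlarge [|arg f(0)|], so [p] times the new argument stays in
    [(-PI/2, PI/2)], where the cosine is nonnegative. *)
Lemma energy_at_0_nonneg (kap eps s : R) : 0 <= kap -> 0 < s ->
  0 <= energy p kap eps (Re (f (RtoC 0)) + s) (Im (f (RtoC 0))).
Proof.
  intros Hk Hs; unfold energy, RP.
  apply Rplus_le_le_0_compat; apply Rmult_le_pos; try (left; apply Rpower_pos); [exact Hk |].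
  destruct Harg as [th [[Hne [_ Hpol]] Hth]].
  assert (Hpi := PI_RGT_0).
  assert (Hhalf : PI / (2 * p) < PI / 2) by (apply (th0_bounds p Hp)).
  assert (Hr := proj1 (Cmod_gt_0 _) Hne).
  set (r := Cmod (f (RtoC 0))) in *.
  assert (Hle := theta_shift_le (Re (f (RtoC 0))) (Im (f (RtoC 0))) r s th Hr Hs ltac:(lra)).
  rewrite Hpol in Hle at 1 2; simpl in Hle.
  specialize (Hle ltac:(ring) ltac:(ring)).
  assert (Ha : Rabs th < PI / (2 * p)) by (apply Rabs_def1; lra).
  set (th' := theta (Re (f (RtoC 0)) + s) (Im (f (RtoC 0)))) in *.
  assert (Hth' : Rabs th' < PI / (2 * p)) by lra.
  apply Rabs_def2 in Hth'.
  assert (Epp : p * (PI / (2 * p)) = PI / 2) by (field; lra).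
  apply cos_ge_0; nra.
Qed.

Lemma shifted_energy_nonneg (r s : R) : 0 < r < 1 -> 0 < s < 1 ->
  exists eps, 0 < eps <= s * s /\
    0 <= RInt (fun t => energy p ((K ^ 2 - 1) * (1 + s)) eps (Re (f (zc r t)) + s) (Im (f (zc r t)))) 0 (2 * PI).
Proof.
  intros Hr Hs; assert (Hpi := PI_RGT_0).
  destruct Hharm as [g [h [Hg0 [Hh0 Hf]]]].
  assert (Hhol : forall k, holomorphic_D k -> holo k).
  { intros k Hk z Hz; destruct (Hk z Hz) as [l Hl]; exists l; apply is_Cderive_of_is_derive, Hl. }
  destruct (holo_deriv g (Hhol g Hg0)) as [g1 [Hg Hg1]].
  destruct (holo_deriv h (Hhol h Hh0)) as [h1 [Hh Hh1]].
  destruct (holo_deriv g1 Hg1) as [g2 [Hg2 Hg2']].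
  destruct (holo_deriv h1 Hh1) as [h2 [Hh2 Hh2']].
  assert (Hc : forall k, holo k -> forall z, inD z -> continuous k z).
  { intros k Hk z Hz; destruct (Hk z Hz) as [l Hl]; eapply is_Cderive_continuous, Hl. }
  (* The sub-mean property needs the circle of radius [r] strictly inside the disc on which [eps] is
     adjusted. *)
  set (r1 := (1 + r) / 2).
  destruct (rho_lower_bound s r1) as [m [Hm Hlow]]; [lra | unfold r1; lra |].
  (* The first bound is for [shifted_square_le], the second for the comparison of [u^2 + eps] with
     [(1 + s) rho^2] in the Laplacian. *)
  set (eps := Rmin (s * s) (s * (m * m))).
  assert (E1 := Rmin_l (s * s) (s * (m * m))); assert (E2 := Rmin_r (s * s) (s * (m * m))).
  assert (He : 0 < eps) by (apply Rmin_pos; repeat apply Rmult_lt_0_compat; lra).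
  exists eps; split; [split; [exact He | exact E1] |].
  assert (ERe : forall z, inD z -> Re (g z) + Re (h z) = Re (f z)).
  { intros z Hz; rewrite (Hf z Hz); reflexivity. }
  assert (EIm : forall z, inD z -> Im (g z) - Im (h z) = Im (f z)).
  { intros z Hz; rewrite (Hf z Hz); reflexivity. }
  assert (H0 : inD (RtoC 0)) by (unfold inD; rewrite Cmod_0; lra).
  assert (Hsub : 2 * PI * energy p ((K ^ 2 - 1) * (1 + s)) eps (Re (f (RtoC 0)) + s) (Im (f (RtoC 0))) <=
    RInt (fun t => energy p ((K ^ 2 - 1) * (1 + s)) eps
      (Re (g (lpol (ln r) t)) + Re (h (lpol (ln r) t)) + s)
      (Im (g (lpol (ln r) t)) - Im (h (lpol (ln r) t)))) 0 (2 * PI)).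
  { rewrite <- (ERe _ H0), <- (EIm _ H0).
    apply (energy_submean p K s r1 eps g h g1 h1 g2 h2);
      try assumption; try (unfold r1; lra); try (apply Hc; assumption).
    - apply (quasiregular_ineq K f g h g1 h1); assumption.
    - intros z Hz; rewrite (ERe z Hz), (EIm z Hz); apply slit_shift; [lra | exact Hz].
    - intros z Hz; assert (HzD : inD z) by (unfold inD, r1 in *; lra).
      rewrite (ERe z HzD), (EIm z HzD); eapply Rle_trans; [exact E2 |].
      specialize (Hlow z ltac:(lra)); apply Rmult_le_compat_l; [lra | apply Rmult_le_compat; lra].
    - apply ln_increasing; unfold r1; lra. }
  assert (Hk0 : 0 <= (K ^ 2 - 1) * (1 + s)) by (apply Rmult_le_pos; [nra | lra]).
  assert (Hz0 := energy_at_0_nonneg ((K ^ 2 - 1) * (1 + s)) eps s Hk0 ltac:(lra)).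
  eapply Rle_trans; [| eapply Rle_trans; [exact Hsub |]].
  - apply Rmult_le_pos; [lra | exact Hz0].
  - right; apply RInt_ext; intros t _.
    unfold lpol; rewrite exp_ln by lra; fold (zc r t).
    assert (Hz : inD (zc r t)).
    { unfold inD, zc; rewrite Cmod_mult, Cmod_R, Cmod_cis, Rabs_pos_eq; lra. }
    rewrite (ERe _ Hz), (EIm _ Hz); reflexivity.
Qed.

Lemma circle_inD (r t : R) : 0 < r < 1 -> inD (zc r t).
Proof. intro Hr; unfold inD, zc; rewrite Cmod_mult, Cmod_R, Cmod_cis, Rabs_pos_eq; lra. Qed.

Lemma f_circle_continuous (r t : R) : 0 < r < 1 -> continuous (fun t => f (zc r t)) t.
Proof.
  intro Hr; apply (continuous_comp (zc r) f); [| apply f_continuous, circle_inD, Hr].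
  apply continuous_Cmult; [apply continuous_const | apply cis_continuous].
Qed.

(** The bound depends on [r], but it enters only Lipschitz constants multiplied by [s] and
    disappears in the limit. *)
Lemma f_circle_bounded (r : R) : 0 < r < 1 ->
  exists M, 0 <= M /\ forall t, 0 <= t <= 2 * PI -> Cmod (f (zc r t)) <= M.
Proof.
  intro Hr; assert (Hpi := PI_RGT_0).
  destruct (continuity_ab_maj (fun t => Cmod (f (zc r t))) 0 (2 * PI)) as [tm [Htm _]]; [lra | |].
  - intros t _; apply continuity_pt_filterlim, (continuous_Cmod (fun t => f (zc r t))), f_circle_continuous, Hr.
  - exists (Cmod (f (zc r tm))); split; [apply Cmod_ge_0 | exact Htm].
Qed.

Let th0 := PI / (2 * p).

(** The instance [S = |sin|^p] with the constants of [trig_sin]. *)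
Lemma im_circle_bound (r : R) : 0 < r < 1 ->
  RInt (fun t => rpow (Rabs (Im (f (zc r t)))) p) 0 (2 * PI) <=
  (rpow (tan th0) (p - 1) / (cos th0 / sin th0) + (K ^ 2 - 1) * (rpow (sin th0) (p - 1) / cos th0))
  * RInt (fun t => rpow (Rabs (Re (f (zc r t)))) p) 0 (2 * PI).
Proof.
  intro Hr; assert (Hpi := PI_RGT_0).
  assert (Hs0 := sin_th0_pos p Hp); assert (Hc0 := cos_th0_pos p Hp); fold th0 in Hs0, Hc0.
  destruct (f_circle_bounded r Hr) as [M [HM0 HM]].
  apply (energy_integral_bound p Hp K _ _ 0 M 0 (2 * PI) (fun x => rpow (Rabs (sin x)) p)
    (fun t => Re (f (zc r t))) (fun t => Im (f (zc r t)))); try lra.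
  - apply Rmult_le_pos; [apply rpow_ge_0 | left; apply Rinv_0_lt_compat, Rdiv_lt_0_compat; assumption].
  - apply Rmult_le_pos; [apply rpow_ge_0 | left; apply Rinv_0_lt_compat; assumption].
  - intro t; apply (continuous_fstC (fun t => f (zc r t))), f_circle_continuous, Hr.
  - intro t; apply (continuous_sndC (fun t => f (zc r t))), f_circle_continuous, Hr.
  - intro t; apply (continuous_comp (fun t => Rabs (Im (f (zc r t)))) (fun y => rpow y p)); [| apply continuous_rpow, Hp].
    apply (continuous_comp (fun t => Im (f (zc r t))) Rabs); [| apply continuous_Rabs].
    apply (continuous_sndC (fun t => f (zc r t))), f_circle_continuous, Hr.
  - intros t Ht; eapply Rle_trans; [apply re_le_Cmod | apply HM, Ht].
  - intros s t Hs; apply slit_shift, circle_inD; assumption.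
  - intros s Hs; apply shifted_energy_nonneg; assumption.
  - intros x Hx; apply (trig_sin p Hp x Hx).
  (* The shift is real, so [rho |sin theta|] is exactly [|Im f|] and the error constant is 0. *)
  - intros s t Hs _.
    assert (Hsl := slit_shift s (zc r t) ltac:(lra) (circle_inD r t Hr)).
    rewrite <- rpow_mult by (apply rho_ge_0 || apply Rabs_pos).
    rewrite <- (Rabs_pos_eq (rho _ _)) at 1 by apply rho_ge_0.
    rewrite <- Rabs_mult, sin_theta by exact Hsl; lra.
Qed.

(** The instance [S = 1] with the constants of [trig_modulus]. Here the shift changes the modulus:
    [|f| <= |f + s| + s] with [|f + s| <= M + 1], and the Lipschitz bound for the power supplies
    [Cst]. *)
Lemma mod_circle_bound (r : R) : 0 < r < 1 ->
  RInt (fun t => rpow (Cmod (f (zc r t))) p) 0 (2 * PI) <=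
  (/ rpow (cos th0) p + (K ^ 2 - 1) * tan th0)
  * RInt (fun t => rpow (Rabs (Re (f (zc r t)))) p) 0 (2 * PI).
Proof.
  intro Hr; assert (Hpi := PI_RGT_0).
  assert (Hs0 := sin_th0_pos p Hp); assert (Hc0 := cos_th0_pos p Hp); fold th0 in Hs0, Hc0.
  destruct (f_circle_bounded r Hr) as [M [HM0 HM]].
  assert (HL : 0 <= p * Rpower (M + 1 + 2) (p - 1)) by (apply Rmult_le_pos; [lra | left; apply Rpower_pos]).
  apply (energy_integral_bound p Hp K _ _ (p * Rpower (M + 1 + 2) (p - 1)) M 0 (2 * PI) (fun _ => 1)
    (fun t => Re (f (zc r t))) (fun t => Im (f (zc r t)))); try lra.
  - left; apply Rinv_0_lt_compat; rewrite rpow_pos_eq by exact Hc0; apply Rpower_pos.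
  - left; apply Rdiv_lt_0_compat; assumption.
  - intro t; apply (continuous_fstC (fun t => f (zc r t))), f_circle_continuous, Hr.
  - intro t; apply (continuous_sndC (fun t => f (zc r t))), f_circle_continuous, Hr.
  - intro t; apply (continuous_comp (fun t => Cmod (f (zc r t))) (fun y => rpow y p)); [| apply continuous_rpow, Hp].
    apply (continuous_Cmod (fun t => f (zc r t))), f_circle_continuous, Hr.
  - intros t Ht; eapply Rle_trans; [apply re_le_Cmod | apply HM, Ht].
  - intros s t Hs; apply slit_shift, circle_inD; assumption.
  - intros s Hs; apply shifted_energy_nonneg; assumption.
  - intros x Hx; apply (trig_modulus p Hp x Hx).
  - intros s t Hs Ht; rewrite Rmult_1_r; specialize (HM t Ht).
    set (w := f (zc r t)) in *.
    set (ws := (Re w + s, Im w) : C).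
    assert (Ews : rho (Re w + s) (Im w) = Cmod ws) by (rewrite Cmod_rho; reflexivity).
    rewrite Ews.
    assert (T1 : Cmod w <= Cmod ws + s).
    { replace w with (Cminus ws (RtoC s)) by (apply injective_projections; simpl; unfold Re, Im; ring).
      eapply Rle_trans; [apply Cmod_minus_le |]; rewrite Cmod_R, Rabs_pos_eq; lra. }
    assert (T2 : Cmod ws <= M + 1).
    { replace ws with (Cplus w (RtoC s)) by (apply injective_projections; simpl; unfold Re, Im; ring).
      eapply Rle_trans; [apply Cmod_triangle |]; rewrite Cmod_R, Rabs_pos_eq; lra. }
    eapply Rle_trans; [apply rpow_le; [lra | exact T1] |].
    apply rpow_lipschitz; [exact Hp | split; [apply Cmod_ge_0 | exact T2] | lra].
Qed.

End MainEstimate.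

(** * From circles to Hardy norms *)

Lemma Mp_le (p c r : R) (F1 F2 : C -> C) : 1 < p -> 0 <= c ->
  0 <= RInt (fun t => rpow (Cmod (F1 (Cmult (RtoC r) (cos t, sin t)))) p) 0 (2 * PI) ->
  RInt (fun t => rpow (Cmod (F2 (Cmult (RtoC r) (cos t, sin t)))) p) 0 (2 * PI) <=
  c * RInt (fun t => rpow (Cmod (F1 (Cmult (RtoC r) (cos t, sin t)))) p) 0 (2 * PI) ->
  Mp p F2 r <= rpow c (/ p) * Mp p F1 r.
Proof.
  intros Hp Hc H0 H; assert (Hpi := PI_RGT_0); unfold Mp.
  assert (Hip : 0 < / p) by (apply Rinv_0_lt_compat; lra).
  assert (Hi : 0 < / (2 * PI)) by (apply Rinv_0_lt_compat; lra).
  rewrite <- rpow_mult; [| exact Hc | apply Rmult_le_pos; lra].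
  apply rpow_le; [lra |]; unfold Rdiv; rewrite <- Rmult_assoc.
  apply Rmult_le_compat_r; lra.
Qed.

Lemma hp_norm_le (p c : R) (F1 F2 : C -> C) : 0 <= c -> in_hp p F1 ->
  (forall r, 0 < r < 1 -> Mp p F2 r <= c * Mp p F1 r) ->
  in_hp p F2 /\ Rbar_le (hp_norm p F2) (Rbar_mult c (hp_norm p F1)).
Proof.
  intros Hc HF1 HM; unfold in_hp in *.
  destruct (Lub_Rbar_correct (fun x => exists r, 0 < r < 1 /\ x = Mp p F1 r)) as [U1 _].
  fold (hp_norm p F1) in U1; rewrite <- HF1 in U1 |- *.
  destruct (Lub_Rbar_correct (fun x => exists r, 0 < r < 1 /\ x = Mp p F2 r)) as [U2 L2].
  fold (hp_norm p F2) in U2, L2.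
  set (N := real (hp_norm p F1)) in *.
  assert (Hle : Rbar_le (hp_norm p F2) (Finite (c * N))).
  { apply L2; intros x [r [Hr ->]]; simpl.
    eapply Rle_trans; [apply HM, Hr |]; apply Rmult_le_compat_l; [exact Hc |].
    apply (U1 (Mp p F1 r)); exists r; split; [exact Hr | reflexivity]. }
  split; [| exact Hle].
  (* The mean at radius [1/2] excludes the value [-infinity] of the supremum, while the upper bound
     excludes [+infinity]. *)
  assert (Hhalf : 0 < / 2 < 1) by lra.
  assert (Hge := U2 (Mp p F2 (/ 2)) (ex_intro _ (/ 2) (conj Hhalf eq_refl))).
  destruct (hp_norm p F2) as [x | |]; [reflexivity | contradiction | contradiction].
Qed.

Theorem theorem2p2 (p K : R) (f : C -> C) :
  1 < p <= 2 -> 1 <= K ->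
  harmonic_D f -> quasiregular_D K f ->
  (exists theta, principal_arg (f (RtoC 0)) theta /\
     - (PI / (2 * p)) < theta < PI / (2 * p)) ->
  in_hp p (ReF f) ->
  (forall z, inD z -> ~ (Im (f z) = 0 /\ Re (f z) < 0)) ->
  in_hp p f /\
  Rbar_le (hp_norm p (ImF f)) (Rbar_mult (cKp K p) (hp_norm p (ReF f))) /\
  Rbar_le (hp_norm p f) (Rbar_mult (dKp K p) (hp_norm p (ReF f))).
Proof.
  intros Hp HK Hharm Hqr Harg Hre Havoid.
  assert (Hpi := PI_RGT_0).
  assert (Hs0 := sin_th0_pos p Hp); assert (Hc0 := cos_th0_pos p Hp).
  assert (HK2 : 0 <= K ^ 2 - 1) by nra.
  set (th0 := PI / (2 * p)) in *.
  assert (ERe : forall r, RInt (fun t => rpow (Cmod (ReF f (Cmult (RtoC r) (cos t, sin t)))) p) 0 (2 * PI) =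
    RInt (fun t => rpow (Rabs (Re (f (Cmult (RtoC r) (cis t))))) p) 0 (2 * PI)).
  { intro r; apply RInt_ext; intros t _; unfold ReF; rewrite Cmod_R; reflexivity. }
  assert (EIm : forall r, RInt (fun t => rpow (Cmod (ImF f (Cmult (RtoC r) (cos t, sin t)))) p) 0 (2 * PI) =
    RInt (fun t => rpow (Rabs (Im (f (Cmult (RtoC r) (cis t))))) p) 0 (2 * PI)).
  { intro r; apply RInt_ext; intros t _; unfold ImF; rewrite Cmod_R; reflexivity. }
  assert (H0 : forall r, 0 < r < 1 ->
    0 <= RInt (fun t => rpow (Rabs (Re (f (Cmult (RtoC r) (cis t))))) p) 0 (2 * PI)).
  { intros r Hr; apply RInt_ge_0; [lra | | intros; apply rpow_ge_0].
    apply (ex_RInt_continuous (V := R_CompleteNormedModule)); intros t _.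
    apply (continuous_comp (fun t => Rabs (Re (f (Cmult (RtoC r) (cis t))))) (fun y => rpow y p));
      [| apply continuous_rpow, Hp].
    apply (continuous_comp (fun t => Re (f (Cmult (RtoC r) (cis t)))) Rabs); [| apply continuous_Rabs].
    apply (continuous_fstC (fun t => f (Cmult (RtoC r) (cis t)))), (f_circle_continuous K f Hqr), Hr. }
  assert (Him := hp_norm_le p (cKp K p) (ReF f) (ImF f)).
  assert (Hf := hp_norm_le p (dKp K p) (ReF f) f).
  destruct Hf as [Hf1 Hf2]; [apply rpow_ge_0 | exact Hre | |].
  { intros r Hr; apply Mp_le; [lra | | rewrite ERe; apply H0, Hr |].
    - fold th0; apply Rplus_le_le_0_compat.
      + left; apply Rinv_0_lt_compat; rewrite rpow_pos_eq by exact Hc0; apply Rpower_pos.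
      + apply Rmult_le_pos; [exact HK2 | left; apply Rdiv_lt_0_compat; assumption].
    - rewrite ERe; apply (mod_circle_bound p K f); assumption. }
  split; [exact Hf1 | split; [| exact Hf2]].
  apply Him; [apply rpow_ge_0 | exact Hre |].
  intros r Hr; apply Mp_le; [lra | | rewrite ERe; apply H0, Hr |].
  - fold th0; apply Rplus_le_le_0_compat.
    + apply Rmult_le_pos; [apply rpow_ge_0 | left; apply Rinv_0_lt_compat, Rdiv_lt_0_compat; assumption].
    + apply Rmult_le_pos; [exact HK2 |].
      apply Rmult_le_pos; [apply rpow_ge_0 | left; apply Rinv_0_lt_compat; assumption].
  - rewrite EIm, ERe; apply (im_circle_bound p K f); assumption.
Qed.
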